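(* Let $p$ be an odd prime, $k\ge 1$ an integer and $q=p^k$. Let $F$ be the extension of $\mathbb{Q}(t)$ that is the (unique) twist of the $q$-th roots of unity by the algebra consisting of $\phi(q)/2$ copies of $\mathbb{Q}(t)(\sqrt{t^2-4})$ (as defined in the context). For all $j\in\mathbb{Z}$ outside a thin set, specializing $t$ to $j$ produces a cyclic extension $F_j$ of $\mathbb{Q}$ of degree $\phi(q)$. For such $j$, suppose that $j$ is not a $p$-th Chebyshev power, i.e. there is no integer $n$ with $j=C_p(n)$, and suppose that $j$ is congruent to a fixed point $m\in\mathbb{Z}_p$ of $C_p$ (that is, a root $m$ of $C_p(x)-x$) modulo $p^{2k+1}$ if $m\equiv\pm2\pmod p$, or modulo $p^{k+1}$ otherwise. Then the splitting field over $\mathbb{Q}$ of $C_q(x)-j$ (that is, the splitting field of $\mathbb{Q}(\alpha)$ with $\alpha$ a root of $C_q(x)=j$) is an unramified cyclic extension of $F_j$.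
   Context: For $n\ge1$, $C_n(x)\in\mathbb{Z}[x]$ is the $n$-th Chebyshev polynomial normalized to be monic and orthogonal over $[-2,2]$, characterized by $C_n(z+z^{-1})=z^n+z^{-n}$. $\mathbb{Z}_p$ denotes the $p$-adic integers, and $\phi$ is Euler's function. The twist $F$: let $\zeta$ be a primitive $q$-th root of unity and let $G$ be the Galois group of $\mathbb{Q}(\zeta,t,\sqrt{t^2-4})$ over $\mathbb{Q}(t)$. Let $\chi:G\to(\mathbb{Z}/q\mathbb{Z})^*$ be the cyclotomic character ($g(\zeta)=\zeta^{\chi(g)}$) and $\varepsilon:G\to\{\pm1\}\subset(\mathbb{Z}/q\mathbb{Z})^*$ the character defined by $g(\sqrt{t^2-4})=\varepsilon(g)\sqrt{t^2-4}$. Then $F$ is the fixed field of the kernel of $\chi\varepsilon$. It is a cyclic extension of $\mathbb{Q}(t)$ with group $(\mathbb{Z}/q\mathbb{Z})^*$, and $F_j$ is its specialization at $t=j$, namely the analogous subfield of $\mathbb{Q}(\zeta,\sqrt{j^2-4})$. ''Thin set'' is in the sense of Hilbert's irreducibility theorem (Serre). *)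

(* Defs.v *)
From HB Require Import structures.
From mathcomp Require Import all_boot all_order all_algebra all_fingroup.
From mathcomp Require Import all_solvable all_field.
From mathcomp Require Import boolp.

Set Implicit Arguments.
Unset Strict Implicit.
Unset Printing Implicit Defensive.

Import Order.TTheory GRing.Theory Num.Theory.
Local Open Scope ring_scope.

(* The Chebyshev polynomials that are monic and orthogonal on [-2, 2]
   (C_n(x) = 2 T_n(x / 2)); chebE below is their characterization.  At n = 0
   this is the constant 2, which is not monic. *)
Fixpoint cheb (n : nat) : {poly int} :=
  match n with
  | 0 => 2%:P
  | n1.+1 => match n1 with
             | 0 => 'X
             | n2.+1 => 'X * cheb n1 - cheb n2
             end
  end.

Lemma chebE (K : fieldType) (z : K) (n : nat) :
  z != 0 -> (map_poly intr (cheb n)).[z + z^-1] = z ^+ n + z ^- n.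
Proof.
move=> nz_z.
suff [] : (map_poly intr (cheb n)).[z + z^-1] = z ^+ n + z ^- n /\
  (map_poly intr (cheb n.+1)).[z + z^-1] = z ^+ n.+1 + z ^- n.+1 by [].
elim: n => [|n [IHn IHn1]].
  by rewrite /= map_polyC map_polyX hornerC hornerX /= expr0 invr1.
split=> //.
rewrite [cheb n.+2]/= -/(cheb n) -/(cheb n.+1).
rewrite rmorphB rmorphM /= map_polyX hornerD hornerN hornerM hornerX IHn IHn1.
rewrite -!exprVn; set w := z^-1; have zw : z * w = 1 by rewrite divff.
have zwX m : z * w ^+ m.+1 = w ^+ m by rewrite exprS mulrA zw mul1r.
have wzX m : w * z ^+ m.+1 = z ^+ m by rewrite exprS mulrA (mulrC w) zw mul1r.
rewrite mulrDl !mulrDr -!exprS zwX wzX.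
by rewrite [z ^+ n + w ^+ n.+2]addrC addrACA [w ^+ n + z ^+ n]addrC addrK.
Qed.

(* The ring of p-adic integers as the projective limit of the Z / p ^ n; the
   component at n is the representative in [0, p ^ n) of the residue class.
   The primality proof is a parameter of the type so that its ring instances,
   which need 0 <> 1, can be inferred. *)
Record padic_int (p : nat) (p_pr : prime p) := PadicInt {
  padic_res : nat -> int;
  padic_resP : forall n, (padic_res n.+1 %% p%:Z ^+ n)%Z = padic_res n }.

Section PadicIntegers.

Variables (p : nat) (p_pr : prime p).

Local Notation padic_int := (padic_int p_pr).
Local Notation PadicInt := (PadicInt p_pr).
Implicit Types x y z : padic_int.

Lemma padic_ext x y : (forall n, padic_res x n = padic_res y n) -> x = y.
Proof.
case: x y => [f fP] [g gP] /= /funext eq_fg.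
by case: _ / eq_fg gP => gP; rewrite (Prop_irrelevance fP gP).
Qed.

Let modzX (a : int) n :
  ((a %% p%:Z ^+ n.+1)%Z %% p%:Z ^+ n)%Z = (a %% p%:Z ^+ n)%Z.
Proof.
by rewrite [in RHS](divz_eq a (p%:Z ^+ n.+1)) exprS mulrA modzMDl.
Qed.

Let resE x n : (padic_res x n %% p%:Z ^+ n)%Z = padic_res x n.
Proof. by rewrite -[padic_res x n]padic_resP modz_mod. Qed.

Definition padic_of_int (a : int) : padic_int :=
  PadicInt (padic_res := fun n => (a %% p%:Z ^+ n)%Z) (modzX a).

Fact padic_add_subproof x y n :
  (((padic_res x n.+1 + padic_res y n.+1) %% p%:Z ^+ n.+1)%Z %% p%:Z ^+ n)%Z
   = ((padic_res x n + padic_res y n) %% p%:Z ^+ n)%Z.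
Proof. by rewrite modzX -modzDm !padic_resP. Qed.

Definition padic_add x y := PadicInt (padic_add_subproof x y).

Fact padic_opp_subproof x n :
  ((- padic_res x n.+1 %% p%:Z ^+ n.+1)%Z %% p%:Z ^+ n)%Z
   = (- padic_res x n %% p%:Z ^+ n)%Z.
Proof. by rewrite modzX -modzNm padic_resP. Qed.

Definition padic_opp x := PadicInt (padic_opp_subproof x).

Fact padic_mul_subproof x y n :
  (((padic_res x n.+1 * padic_res y n.+1) %% p%:Z ^+ n.+1)%Z %% p%:Z ^+ n)%Z
   = ((padic_res x n * padic_res y n) %% p%:Z ^+ n)%Z.
Proof. by rewrite modzX -modzMm !padic_resP. Qed.

Definition padic_mul x y := PadicInt (padic_mul_subproof x y).

HB.instance Definition _ := gen_eqMixin padic_int.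
HB.instance Definition _ := gen_choiceMixin padic_int.

Fact padic_addA : associative padic_add.
Proof. by move=> x y z; apply: padic_ext => n /=; rewrite modzDml modzDmr addrA. Qed.
Fact padic_addC : commutative padic_add.
Proof. by move=> x y; apply: padic_ext => n /=; rewrite addrC. Qed.
Fact padic_add0 : left_id (padic_of_int 0) padic_add.
Proof. by move=> x; apply: padic_ext => n /=; rewrite modzDml add0r resE. Qed.
Fact padic_addN : left_inverse (padic_of_int 0) padic_opp padic_add.
Proof. by move=> x; apply: padic_ext => n /=; rewrite modzDml addNr. Qed.

HB.instance Definition _ := GRing.isZmodule.Build padic_int
  padic_addA padic_addC padic_add0 padic_addN.

Fact padic_mulA : associative padic_mul.
Proof. by move=> x y z; apply: padic_ext => n /=; rewrite modzMml modzMmr mulrA. Qed.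
Fact padic_mulC : commutative padic_mul.
Proof. by move=> x y; apply: padic_ext => n /=; rewrite mulrC. Qed.
Fact padic_mul1 : left_id (padic_of_int 1) padic_mul.
Proof. by move=> x; apply: padic_ext => n /=; rewrite modzMml mul1r resE. Qed.
Fact padic_mulDl : left_distributive padic_mul padic_add.
Proof.
by move=> x y z; apply: padic_ext => n /=; rewrite modzMml modzDm mulrDl.
Qed.
Fact padic_one_neq0 : padic_of_int 1 != padic_of_int 0.
Proof.
apply/eqP => /(congr1 (fun x : padic_int => padic_res x 1)) /=; rewrite expr1 mod0z.
by rewrite modz_small //= ltz_nat prime_gt1.
Qed.

HB.instance Definition _ := GRing.Zmodule_isComNzRing.Build padic_int
  padic_mulA padic_mulC padic_mul1 padic_mulDl padic_one_neq0.

End PadicIntegers.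

Definition padic_eqmod (p : nat) (p_pr : prime p) (n : nat)
    (x y : padic_int p_pr) : Prop :=
  exists c : padic_int p_pr, x - y = c * p%:R ^+ n.

(* Thin subsets of the affine line over Q: those covered by finitely many
   points and finitely many sets of rational points t that lift to a rational
   point of an irreducible cover f(t, x) = 0 of degree at least 2.  The inner
   variable of f is t and the outer one is x; irreducibility is over Q(t). *)
Definition thin (A : rat -> Prop) : Prop :=
  exists (s : seq rat) (fs : seq {poly {poly rat}}),
    (forall f, f \in fs ->
       irreducible_poly (map_poly (@FracField.tofrac {poly rat}) f)
       /\ (2 < size f)%N)
    /\ (forall t, A t ->
         t \in s \/ exists2 f, f \in fs & exists x : rat, f.[x%:P].[t] = 0).

(* Let zeta be a primitive q-th root of unity and delta a square root of
   d ^ 2 - 4, where d lies in the base field.  Then twist_field q zeta delta is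
   the fixed field of ker (chi * eps) in K0(zeta, delta): the field F for
   K0 = Q(t) and d = t, and its specialization F_j for K0 = Q and d = j.
   Characters take their values in 'Z_q, so 1 < q is assumed; when delta = 0
   the sign character is trivial. *)
Section Twist.

Variables (K0 : fieldType) (L : splittingFieldType K0).
Variables (q : nat) (zeta delta : L).

Definition twist_ambient : {subfield L} := <<1 & [:: zeta; delta]>>%AS.

Definition cyclotomic_char (g : gal_of twist_ambient) : 'Z_q :=
  odflt 0 [pick a : 'Z_q | g zeta == zeta ^+ a].

Definition sign_char (g : gal_of twist_ambient) : 'Z_q :=
  if g delta == delta then 1 else -1.

Definition twist_field : {subfield L} :=
  [aspace of fixedField
    [set g in 'Gal(twist_ambient / 1)%g | cyclotomic_char g * sign_char g == 1]].

End Twist.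

Definition cyclic_extension (K0 : fieldType) (L : splittingFieldType K0)
    (F E : {subfield L}) : Prop :=
  galois F E /\ cyclic 'Gal(E / F)%g.

(* Ideals are represented by their membership predicates on the ambient field. *)
Section Ramification.

Variable L : splittingFieldType rat.
Implicit Types (E F : {subfield L}) (I J P : L -> Prop).

Definition integers_of E (x : L) : Prop :=
  x \in E /\ integralOver (intr : int -> L) x.

Definition prime_ideal E P : Prop :=
  [/\ forall x, P x -> integers_of E x,
      P 0 /\ ~ P 1,
      forall x y, P x -> P y -> P (x + y),
      forall a x, integers_of E a -> P x -> P (a * x)
    & forall x y, integers_of E x -> integers_of E y ->
        P (x * y) -> P x \/ P y].

Definition ideal_mul I J (x : L) : Prop :=
  exists (n : nat) (a b : 'I_n -> L),
    [/\ forall i, I (a i), forall i, J (b i) & x = \sum_(i < n) a i * b i].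

Definition ideal_exp E I (n : nat) : L -> Prop :=
  iter n (ideal_mul I) (integers_of E).

Definition ideal_below F P (x : L) : Prop := integers_of F x /\ P x.

Definition ideal_extend E I : L -> Prop := ideal_mul I (integers_of E).

(* e(P | P \cap O_F) = e *)
Definition ramification_index F E P (e : nat) : Prop :=
  (forall x, ideal_extend E (ideal_below F P) x -> ideal_exp E P e x)
  /\ ~ (forall x, ideal_extend E (ideal_below F P) x -> ideal_exp E P e.+1 x).

(* Residue fields are finite, so no separability condition is needed at the
   finite places.  The last clause says that the real places of F stay real;
   every complex embedding of E is the restriction of some sigma. *)
Definition unramified F E : Prop :=
  (forall P, prime_ideal E P -> (exists2 x, P x & x != 0) ->
     ramification_index F E P 1)
  /\ (forall sigma : {rmorphism L -> algC},
        (forall x, x \in F -> sigma x \is Num.real) ->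
        forall x, x \in E -> sigma x \is Num.real).

End Ramification.

(* Main.v *)
Require Import Defs.
From HB Require Import structures.
From mathcomp Require Import all_boot all_order all_algebra all_fingroup.
From mathcomp Require Import all_solvable all_field.
From mathcomp Require Import generic_quotient boolp ring zify.

(* Write j = z + 1/z and z = y^q, so that the roots of C_q - j are the
   A(w) = w y + 1/(w y) with w^q = 1.  An automorphism maps (zeta, sqrt D, y), where
   D = j^2 - 4, to (zeta^a, e sqrt D, v y^e); it fixes the element
   (zeta - 1/zeta) sqrt D of F_j only if zeta^a = zeta^e, and then it maps A(w) to
   A(w v^e).  Hence the Galois group of the splitting field K over F_j is a group of
   translations w |-> w v, which is cyclic.

   If C_q - j is reducible, the constant coefficient of the minimal polynomial of y over
   the real quadratic field Q(sqrt D) shows that z is a p-th power there, and taking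
   traces makes j a p-th Chebyshev power.

   A prime P of K is unramified over F_j once every nontrivial translation moves some
   integer modulo P.  Away from p: if all A(w v) - A(w) lie in P, then so does
   (v - 1/v)^2, which divides a power of p.  Above p: the congruence on j says that on a small disc
   a + R x the polynomial C_q - j is, up to a constant and modulo p, equal to h + u x
   with h and u units (or, for p = 3 and j close to 2 or -2, to a cubic); the numbers
   h R / (A(w) - a) are then algebraic integers one of which is a nonzero simple root of
   their common polynomial modulo P, and no nontrivial translation can fix it.

   At the infinite places there is nothing to prove: D > 0, so (zeta - 1/zeta) sqrt D is
   not real. *)

Set Implicit Arguments.
Unset Strict Implicit.
Unset Printing Implicit Defensive.

Import Order.TTheory GRing.Theory Num.Theory.
Local Open Scope ring_scope.

(** * Chebyshev polynomials *)

(** The two moduli come from C_p'. At 2 and -2 it equals p^2; at the other points that occur it is p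
    times a unit. So k iterations of C_p shrink a disc of radius p to radius p^(2k+1), respectively
    p^(k+1), and j has to match a point of the image to that accuracy.

    The thin set has to be fixed before j. The degree of F_j can drop only if sqrt D lies in Q(zeta)
    but not in Q. As Q(zeta) is cyclic over Q, it contains at most one quadratic field Q(sqrt c), so
    such j lie on the single conic t^2 - 4 = c s^2.

    K need not contain zeta, y or sqrt D. Elements of K are therefore produced from the A(w) alone;
    for instance (v - 1/v)^2 = A(w v) A(w / v) - A(w)^2.

    Ramification is phrased through membership in P and P^2. No factorization of ideals enters: if P
    meets F_j in an ideal that generates a part of P^2, a trace argument gives s P inside P^2 for
    some s outside P, against Nakayama's lemma.

    That D > 0 is a consequence of the two hypotheses on j: each of the five values with |j| <= 2 is
    a p-th Chebyshev power or violates the congruence. *)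

Fixpoint chebU (n : nat) : {poly int} :=
  match n with
  | 0 => 0
  | n1.+1 => match n1 with
             | 0 => 1
             | n2.+1 => 'X * chebU n1 - chebU n2
             end
  end.

Lemma chebSS n : cheb n.+2 = 'X * cheb n.+1 - cheb n. Proof. by []. Qed.
Lemma chebUSS n : chebU n.+2 = 'X * chebU n.+1 - chebU n. Proof. by []. Qed.

Lemma nat_ind2 (P : nat -> Prop) :
  P 0%N -> P 1%N -> (forall n, P n -> P n.+1 -> P n.+2) -> forall n, P n.
Proof.
move=> P0 P1 PSS n; suff [] : P n /\ P n.+1 by [].
by elim: n => // n [Pn Pn1]; split=> //; apply: PSS.
Qed.

(** At z + 1/z, [chebU n] is (z^n - z^-n) / (z - 1/z); this identity and the next one expand z^(n+1)
    = z^n z. The factor 2 avoids halves. *)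
Lemma cheb_addition n : cheb n.+1 *+ 2 = 'X * cheb n + ('X ^+ 2 - 4%:P) * chebU n.
Proof.
elim/nat_ind2: n => [||n IH0 IH1].
- by rewrite /=; ring.
- by rewrite /=; ring.
rewrite (chebSS n.+1) (chebUSS n) mulrnBl -mulrnAr IH1 IH0 (chebSS n); ring.
Qed.

Lemma chebU_addition n : chebU n.+1 *+ 2 = 'X * chebU n + cheb n.
Proof.
elim/nat_ind2: n => [||n IH0 IH1].
- by rewrite /=; ring.
- by rewrite /=; ring.
rewrite (chebUSS n.+1) (chebSS n) mulrnBl -mulrnAr IH1 IH0 (chebUSS n); ring.
Qed.

Lemma mulrn_injI (p q : {poly int}) n : (0 < n)%N -> p *+ n = q *+ n -> p = q.
Proof.
move=> n_gt0 /polyP eq_pq; apply/polyP=> i.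
have := eq_pq i; rewrite !coefMn => /eqP.
by rewrite eqr_pMn2r // => /eqP.
Qed.

(** At z + 1/z this reads (z^n + z^-n)^2 - (z^n - z^-n)^2 = 4. *)
Lemma cheb_pell n : cheb n ^+ 2 - ('X ^+ 2 - 4%:P) * chebU n ^+ 2 = 4%:P.
Proof.
elim: n => [|n IHn]; first by rewrite /= expr0n mulr0 subr0 -rmorphXn.
apply: (@mulrn_injI _ _ 4) => //.
rewrite [LHS](_ : _ = (cheb n.+1 *+ 2) ^+ 2 - ('X ^+ 2 - 4%:P) * (chebU n.+1 *+ 2) ^+ 2);
  last by ring.
rewrite cheb_addition chebU_addition -[in RHS]IHn.
rewrite [LHS](_ : _ = 4%:P * (cheb n ^+ 2 - ('X ^+ 2 - 4%:P) * chebU n ^+ 2)); last by ring.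
by rewrite IHn -!rmorphM -polyCMn.
Qed.

(** The two formulas need a common induction: differentiating [cheb_addition] brings in the
    derivative of [chebU n]. *)
Lemma cheb_deriv_pair n :
  (cheb n)^`() = chebU n *+ n /\
  ('X ^+ 2 - 4%:P) * (chebU n)^`() = cheb n *+ n - 'X * chebU n.
Proof.
elim: n => [|n [IHC IHU]]; first by rewrite /= !linearE /= !derivC; split; ring.
have dC : (cheb n.+1)^`() = chebU n.+1 *+ n.+1.
  apply: (@mulrn_injI _ _ 2) => //.
  rewrite -derivMn cheb_addition mulrnAC chebU_addition.
  rewrite derivD !derivM derivX derivB derivC derivXn /= subr0 IHC expr1.
  rewrite [LHS](_ : _ = cheb n + 'X * (chebU n *+ n) + 'X *+ 2 * chebU n
    + ('X ^+ 2 - 4%:P) * (chebU n)^`()); last by ring.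
  by rewrite IHU; ring.
split=> //; apply: (@mulrn_injI _ _ 2) => //.
rewrite -mulrnAr -derivMn chebU_addition.
rewrite [RHS](_ : _ = cheb n.+1 *+ 2 *+ n.+1 - 'X * (chebU n.+1 *+ 2)); last by ring.
rewrite cheb_addition chebU_addition derivD derivM derivX IHC.
rewrite [LHS](_ : _ = ('X ^+ 2 - 4%:P) * (chebU n + chebU n *+ n)
  + 'X * (('X ^+ 2 - 4%:P) * (chebU n)^`())); last by ring.
by rewrite IHU; ring.
Qed.

Lemma size_cheb n : size (cheb n) = n.+1.
Proof.
elim/nat_ind2: n => [||n IH0 IH1]; rewrite ?size_polyC ?size_polyX //.
have sX : size ('X * cheb n.+1) = n.+3.
  by rewrite mulrC size_mulX ?IH1 // -size_poly_eq0 IH1.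
by rewrite chebSS size_polyDl sX // size_polyN IH0.
Qed.

Lemma cheb_monic n : (0 < n)%N -> cheb n \is monic.
Proof.
case: n => // n _; rewrite monicE.
elim/nat_ind2: n => [||n IH0 IH1]; rewrite ?lead_coefX //.
  by rewrite /= lead_coefDl ?lead_coefM ?lead_coefX ?mulr1 // size_polyN size_polyC -expr2 size_polyXn.
have sX : size ('X * cheb n.+2) = n.+4.
  by rewrite mulrC size_mulX ?size_cheb // -size_poly_eq0 size_cheb.
rewrite (chebSS n.+1) lead_coefDl ?lead_coefM ?lead_coefX ?mul1r //.
by rewrite sX size_polyN size_cheb.
Qed.

(** The product formula C_a C_b = C_(a+b) + C_(a-b) for a = m + n and b = n, which keeps truncated
    subtraction out. *)
Lemma cheb_mul_cheb m n : cheb (m + n.*2) + cheb m = cheb (m + n) * cheb n.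
Proof.
(* The left-hand side is a quadratic form in two consecutive terms that the recurrence preserves. *)
have quad k : cheb k.+1 ^+ 2 - 'X * cheb k.+1 * cheb k + cheb k ^+ 2 = 4%:P - 'X ^+ 2.
  elim: k => [|k <-]; first by rewrite /=; ring.
  by rewrite chebSS; ring.
have [B0 B1] : cheb n.*2 + cheb 0 = cheb n * cheb n /\
               cheb n.*2.+1 + cheb 1 = cheb n.+1 * cheb n.
  elim: n => [|n [IH0 IH1]]; first by rewrite /=; split; ring.
  have e0 : cheb n.+1.*2 = cheb n.+1 ^+ 2 - 2%:P.
    rewrite doubleS chebSS.
    have -> : cheb n.*2 = cheb n ^+ 2 - 2%:P by rewrite expr2 -IH0 [cheb 0]/= addrK.
    have -> : cheb n.*2.+1 = cheb n.+1 * cheb n - 'X by rewrite -IH1 [cheb 1]/= addrK.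
    rewrite [RHS](_ : _ = (cheb n.+1 ^+ 2 - 'X * cheb n.+1 * cheb n + cheb n ^+ 2)
      + ('X * cheb n.+1 * cheb n - cheb n ^+ 2 - 2%:P)); last by ring.
    by rewrite quad; ring.
  split; first by rewrite e0 [cheb 0]/=; ring.
  rewrite [in cheb n.+1.*2.+1]doubleS chebSS -doubleS e0 chebSS.
  have -> : cheb n.*2.+1 = cheb n.+1 * cheb n - 'X by rewrite -IH1 [cheb 1]/= addrK.
  by rewrite [cheb 1]/=; ring.
elim/nat_ind2: m => [||m IH0 IH1]; rewrite ?add0n ?add1n //.
rewrite !addSn chebSS (chebSS (m + n)) (chebSS m) mulrBl -mulrA -addSn -IH0 -addSn -IH1.
by rewrite !addSn; ring.
Qed.

Lemma cheb_comp m n : cheb (m * n) = cheb m \Po cheb n.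
Proof.
elim/nat_ind2: m => [||m IH0 IH1]; first by rewrite /= comp_polyC.
  by rewrite mul1n comp_polyX.
rewrite chebSS rmorphB rmorphM /= comp_polyX -IH0 -IH1.
by rewrite mulrC !mulSn addnA addnn addnC [(n + _)%N]addnC -cheb_mul_cheb addrK.
Qed.

Lemma chebU_horner (K : fieldType) (z : K) n : z != 0 ->
  (map_poly intr (chebU n)).[z + z^-1] * (z - z^-1) = z ^+ n - z ^- n.
Proof.
move=> nz_z; elim/nat_ind2: n => [||n IH0 IH1].
- by rewrite /= rmorph0 horner0 mul0r invr1 subrr.
- by rewrite /= rmorph1 hornerC mul1r !expr1.
rewrite chebUSS rmorphB rmorphM /= map_polyX !hornerE mulrBl -mulrA IH1 IH0.
rewrite !exprS !invfM; set u := z ^+ n; set v := u^-1; set w := z^-1.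
have zw : z * w = 1 by rewrite divff.
rewrite [LHS](_ : _ = z * (z * u) - w * (w * v) + (z * w - 1) * (u - v)); last by ring.
by rewrite zw subrr mul0r addr0.
Qed.

(** A sign is encoded as e * e = 1 from here on, so that 2 and -2 are treated together. At these
    points z = 1/z and the quotient formula for [chebU] degenerates. *)
Lemma cheb_at_pm2 (e : int) n : e * e = 1 ->
  (cheb n).[2 * e] = 2 * e ^+ n /\ (chebU n).[2 * e] = n%:R * e ^+ n.+1.
Proof.
move=> ee; suff /(_ n) [] : forall n, (cheb n).[2 * e] = 2 * e ^+ n /\
    (chebU n).[2 * e] = n%:R * e ^+ n.+1 by [].
elim/nat_ind2 => [||m [C0 U0] [C1 U1]].
- by rewrite /= !hornerE; split=> //; ring.
- by rewrite /= !hornerE expr2 ee.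
have e2 i : e ^+ i.+2 = e ^+ i by rewrite (exprS e i.+1) (exprS e i) mulrA ee mul1r.
rewrite chebSS chebUSS !(hornerD, hornerN, hornerM, hornerX) C0 C1 U0 U1 !e2.
rewrite -[m.+2%:R]natr1 -[m.+1%:R]natr1 (exprS e m); set x := e ^+ m; split.
  rewrite [LHS](_ : _ = (4 * (e * e) - 2) * x); last by ring.
  by rewrite ee; ring.
by ring.
Qed.

Lemma cheb_at0 n : odd n -> (cheb n).[0] = 0.
Proof.
elim/nat_ind2: n => [//||n IH0 _]; first by rewrite hornerX.
by rewrite /odd negbK -/odd chebSS !hornerE => /IH0->; rewrite oppr0.
Qed.

(** * C_q near a fixed point of C_p *)

(** S records where the remainder lives: it is everything over Z and Z_p, and the ring of integers
    of a subfield when A is the ambient field. *)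
Lemma taylor2 (A : comNzRingType) (S : A -> Prop) (g : {poly int}) (x y : A) :
  S 0 -> (forall a b, S a -> S b -> S (a + b)) ->
  (forall a b, S a -> S b -> S (a * b)) -> (forall n : int, S n%:~R) ->
  S x -> S y ->
  exists2 r, S r & (map_poly intr g).[x + y] =
    (map_poly intr g).[x] + (map_poly intr g^`()).[x] * y + y ^+ 2 * r.
Proof.
move=> S0 SD SM SZ Sx Sy.
have Sh (f : {poly int}) : S (map_poly intr f).[x].
  elim/poly_ind: f => [|f c IH]; first by rewrite rmorph0 horner0.
  by rewrite rmorphD rmorphM /= map_polyX map_polyC !hornerE; apply/SD/SZ/SM.
elim/poly_ind: g => [|g c [r Sr IH]].
  by exists 0; rewrite // derivC rmorph0 !horner0 mul0r mulr0 !addr0.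
exists ((map_poly intr g^`()).[x] + (x + y) * r).
  by apply/SD; [exact: Sh | apply/SM => //; apply: SD].
rewrite derivD derivC derivM derivX mulr1 addr0 !(rmorphD, rmorphM) /= map_polyX map_polyC.
rewrite !(hornerD, hornerM, hornerX, hornerC) IH; ring.
Qed.

Lemma taylor2_int (g : {poly int}) (x y : int) :
  exists r, g.[x + y] = g.[x] + g^`().[x] * y + y ^+ 2 * r.
Proof.
have mapz (f : {poly int}) : map_poly intr f = f.
  by rewrite map_poly_id // => ? _; rewrite intz.
have [r _] := @taylor2 int (fun _ => True) g x y I (fun _ _ _ _ => I)
  (fun _ _ _ _ => I) (fun _ => I) I I.
by rewrite !mapz; exists r.
Qed.

Lemma dvdz_horner_sub (g : {poly int}) (x y d : int) :
  (d %| x - y)%Z -> (d %| g.[x] - g.[y])%Z.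
Proof.
have [r] := taylor2_int g y (x - y); rewrite [y + _]addrC subrK => -> dxy.
rewrite [X in (d %| X)%Z](_ : _ = (x - y) * (g^`().[y] + (x - y) * r)); last by ring.
exact: dvdz_mulr.
Qed.

(** * The action of C_p on p-adic discs *)

Section Prime.
Variables (p : nat) (p_pr : prime p) (p_odd : odd p).

Let pN0 : p%:Z != 0. Proof. by have := prime_gt0 p_pr; case: (p). Qed.
Let p_gt2 : (2 < p)%N. Proof. by apply: odd_prime_gt2. Qed.

Lemma Euclid_dvdzM (x y : int) : (p%:Z %| x * y)%Z = (p%:Z %| x)%Z || (p%:Z %| y)%Z.
Proof. by rewrite !dvdzE abszM Euclid_dvdM. Qed.

Lemma Euclid_dvdzX (x : int) n : (p%:Z %| x ^+ n.+1)%Z = (p%:Z %| x)%Z.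
Proof. by elim: n => // n IHn; rewrite exprS Euclid_dvdzM IHn orbb. Qed.

Lemma dvdz_small (n : nat) : (0 < n < p)%N -> (p%:Z %| n%:Z)%Z = false.
Proof. by case/andP=> n0 np; rewrite dvdzE /= gtnNdvd. Qed.

Lemma dvdz_prime1 : (p%:Z %| 1%R)%Z = false.
Proof. by rewrite (@dvdz_small 1) // prime_gt1. Qed.

(** This is C_p' = p U_p read on coefficients; it makes the coefficients of degrees strictly between
    0 and p divisible by p. *)
Lemma cheb_shift_coef (b : int) i :
  (cheb p \Po ('X + b%:P))`_i.+1 *+ i.+1 = p%:Z * (chebU p \Po ('X + b%:P))`_i.
Proof.
rewrite -coef_deriv deriv_comp derivD derivX derivC addr0 mulr1.
by rewrite (cheb_deriv_pair p).1 linearMn /= coefMn -mulr_natl natz.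
Qed.

Lemma cheb_shift_coef0 (b : int) : (cheb p \Po ('X + b%:P))`_0 = (cheb p).[b].
Proof. by rewrite -horner_coef0 horner_comp !hornerE. Qed.

Lemma cheb_shift_coef1 (b : int) :
  (cheb p \Po ('X + b%:P))`_1 = p%:Z * (chebU p).[b].
Proof. by have := cheb_shift_coef b 0; rewrite -horner_coef0 horner_comp !hornerE. Qed.

Lemma dvdz_cheb_shift_coef (b : int) i :
  (0 < i < p)%N -> (p%:Z %| (cheb p \Po ('X + b%:P))`_i)%Z.
Proof.
case: i => // i ip; have := cheb_shift_coef b i.
move/(congr1 (fun x => (p%:Z %| x)%Z)); rewrite dvdz_mulr // -mulr_natr Euclid_dvdzM natz.
by rewrite dvdz_small // orbF.
Qed.

Lemma size_cheb_shift (b : int) : size (cheb p \Po ('X + b%:P)) = p.+1.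
Proof. by rewrite size_comp_poly2 ?size_cheb // size_XaddC. Qed.

Lemma cheb_shift_lead (b : int) : (cheb p \Po ('X + b%:P))`_p = 1.
Proof.
have := lead_coef_comp (cheb p) (q := 'X + b%:P).
rewrite size_XaddC => /(_ isT); rewrite lead_coefE size_cheb_shift /= => ->.
rewrite lead_coefXaddC expr1n mulr1; apply/monicP/cheb_monic.
exact: prime_gt0.
Qed.

(** On the disc b + c G the linear term contributes c d u G, and the divisibility assumption makes
    all higher terms negligible modulo c d p. Iterating C_p amounts to iterating this. *)
Lemma cheb_step (b c d u : int) (G : {poly int}) :
  p%:Z * (chebU p).[b] = d * u ->
  (forall i, (1 < i <= p)%N -> (c * d * p%:Z %| (cheb p \Po ('X + b%:P))`_i * c ^+ i)%Z) ->
  exists E : {poly int}, cheb p \Po (b%:P + c *: G) =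
    ((cheb p).[b])%:P + (c * d) *: (u *: G + p%:Z *: E).
Proof.
move=> def_u dvd_Q; set Q := cheb p \Po ('X + b%:P) in dvd_Q *.
exists (\sum_(2 <= i < p.+1) (Q`_i * c ^+ i %/ (c * d * p%:Z))%Z *: G ^+ i).
have -> : b%:P + c *: G = ('X + b%:P) \Po (c *: G).
  by rewrite comp_polyD comp_polyX comp_polyC addrC.
rewrite comp_polyA -/Q comp_polyE size_cheb_shift.
rewrite -(big_mkord xpredT (fun i => Q`_i *: (c *: G) ^+ i)).
rewrite big_ltn // big_ltn ?ltnS ?prime_gt0 // expr0 expr1 scalerDr !addrA.
rewrite /Q cheb_shift_coef0 cheb_shift_coef1 def_u -/Q; congr (_ + _).
  by rewrite alg_polyC !scalerA; congr (_ + _ *: _); ring.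
rewrite !scaler_sumr big_nat [RHS]big_nat; apply: eq_bigr => i /dvd_Q dvd_i.
by rewrite exprZn !scalerA -[in LHS](divzK dvd_i); congr (_ *: _); ring.
Qed.

Lemma dvdz_exp_leq (x : int) m n : (m <= n)%N -> (x ^+ m %| x ^+ n)%Z.
Proof. by move=> /subnKC <-; rewrite exprD dvdz_mulr. Qed.

(** For i < p the coefficient supplies one factor p and the power at least 2N of them; for i = p the
    power supplies at least 3N. Both reach N + e + 1. *)
Lemma cheb_step_dvd (b : int) N e : (0 < e <= N)%N -> (e < 3)%N ->
  forall i, (1 < i <= p)%N ->
  (p%:Z ^+ N * p%:Z ^+ e * p%:Z %| (cheb p \Po ('X + b%:P))`_i * (p%:Z ^+ N) ^+ i)%Z.
Proof.
move=> eN e3 i ip; rewrite -exprD -exprSr -exprM.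
have [->|ltip] := eqVneq i p.
  rewrite cheb_shift_lead mul1r dvdz_exp_leq //.
  by move: p_gt2; nia.
have /dvdzP[t ->] : (p%:Z %| (cheb p \Po ('X + b%:P))`_i)%Z.
  by apply: dvdz_cheb_shift_coef; lia.
by rewrite -mulrA -exprS dvdz_mull // dvdz_exp_leq //; nia.
Qed.

Lemma sgn_expp (e : int) : e * e = 1 -> e ^+ p = e /\ e ^+ p.+1 = 1.
Proof.
move=> ee; have ep : e ^+ p = e.
  by rewrite -(odd_double_half p) p_odd -muln2 mulnC exprD exprM [e ^+ 2]expr2 ee expr1n mulr1.
by rewrite exprS ep.
Qed.

Lemma cheb_prime_pm2 (e : int) : e * e = 1 ->
  (cheb p).[2 * e] = 2 * e /\ p%:Z * (chebU p).[2 * e] = p%:Z ^+ 2.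
Proof.
move=> ee; have [-> ->] := cheb_at_pm2 p ee; have [-> ->] := sgn_expp ee.
split=> //; by rewrite mulr1 natz expr2.
Qed.

(** At b = 2e, where X^2 - 4 vanishes, the derivative of the second identity of [cheb_deriv_pair]
    gives 3 b U_p'(b) = (p^2 - 1) U_p(b). With U_p(b) = p this yields 12 e Q2 = (p^2 - 1) p^2, and
    12 is prime to p. On a disc of radius p around 2e the quadratic term must be divisible by p^4; a
    single p in Q2 would only give p^3. *)
Lemma cheb_shift_coef2 (e : int) : e * e = 1 -> (3 < p)%N ->
  (p%:Z ^+ 2 %| (cheb p \Po ('X + (2 * e)%:P))`_2)%Z.
Proof.
move=> ee p3; set b := 2 * e; set Q2 := _`_2.
have dU : 3 * b * (chebU p)^`().[b] = (p%:Z ^+ 2 - 1) * (chebU p).[b].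
  have := congr1 (fun f : {poly int} => f^`().[b]) (cheb_deriv_pair p).2.
  rewrite derivM [in X in X = _ -> _]derivB derivXn derivC derivB derivMn derivM derivX subr0 /=.
  rewrite (cheb_deriv_pair p).1 !(hornerMn, hornerD, hornerN, hornerM, hornerXn, hornerC, hornerX).
  have -> : b ^+ 2 - 4 = 0.
    by rewrite [b ^+ 2](_ : _ = 4 * (e * e)); [rewrite ee | rewrite /b; ring].
  move: ((chebU p)^`().[b]) ((chebU p).[b]) => x y E.
  rewrite [LHS](_ : _ = b ^+ 1 *+ 2 * x + 0 * (chebU p)^`()^`().[b] + b * x); last by ring.
  rewrite E; have -> : y *+ p *+ p = p%:Z ^+ 2 * y.
    by rewrite -[y *+ p]mulr_natl -mulr_natl natz mulrA expr2.
  by move: (p%:Z ^+ 2) => P; ring.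
have Q2E : Q2 *+ 2 = p%:Z * (chebU p)^`().[b].
  rewrite cheb_shift_coef; congr (_ * _).
  have -> : (chebU p \Po ('X + b%:P))`_1 = ((chebU p \Po ('X + b%:P))^`())`_0.
    by rewrite coef_deriv.
  by rewrite deriv_comp derivD derivX derivC addr0 mulr1 -horner_coef0 horner_comp !hornerE.
have [_ pU] := cheb_prime_pm2 ee.
have : (p%:Z ^+ 2 %| (12 * e) * Q2)%Z.
  rewrite [X in (_ %| X)%Z](_ : _ = 3 * b * (Q2 *+ 2)); last by rewrite /b; ring.
  by rewrite Q2E mulrCA dU mulrCA pU dvdz_mull.
rewrite Gauss_dvdzr // coprimezE abszM abszX coprimeXl // coprimeMr.
have e1 : `|e|%N = 1%N by have /(congr1 absz) := ee; rewrite abszM => /eqP; rewrite muln_eq1 => /andP[/eqP].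
rewrite e1 coprimen1 andbT prime_coprime //.
have -> : `|12|%N = (2 * 2 * 3)%N by [].
by rewrite !Euclid_dvdM // !gtnNdvd // (ltn_trans _ p3).
Qed.

Lemma dvdz_cheb_iter (j : int) n k : (p%:Z ^+ n %| (cheb p).[j] - j)%Z ->
  (p%:Z ^+ n %| (cheb (p ^ k)).[j] - j)%Z.
Proof.
move=> Cj; elim: k => [|k IHk]; first by rewrite /= hornerX subrr dvdz0.
rewrite expnS cheb_comp horner_comp -(subrK (cheb p).[j] ((cheb p).[_])) -addrA.
by rewrite rpredD // dvdz_horner_sub.
Qed.

(** If p divides U_p(b) for the iterate b, the Pell identity gives C_p(b)^2 = 4 modulo p; but C_p(b)
    is congruent to j. *)
Lemma chebU_coprime (j : int) k : (p%:Z %| (cheb p).[j] - j)%Z ->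
  ~~ (p%:Z %| j ^+ 2 - 4)%Z -> ~~ (p%:Z %| (chebU p).[(cheb (p ^ k)).[j]])%Z.
Proof.
rewrite -[X in (X %| _ - _)%Z -> _]expr1 => Cj; apply: contra => pU.
have := dvdz_cheb_iter k.+1 Cj; have := dvdz_cheb_iter k Cj; rewrite expr1.
rewrite expnS cheb_comp horner_comp; set b := _.[j] in pU *.
move=> bj Cbj; have := congr1 (horner^~ b) (cheb_pell p).
rewrite !(hornerD, hornerN, hornerM, horner_exp, hornerC, hornerX) => pell.
rewrite (_ : j ^+ 2 - 4 = (b ^+ 2 - 4) * (chebU p).[b] ^+ 2
  - ((cheb p).[b] - j) * ((cheb p).[b] + j)); last by rewrite -[X in _ - X]pell; ring.
by apply: rpredB; [rewrite expr2 !dvdz_mull | apply: dvdz_mulr].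
Qed.

(** Away from 2 and -2 each application of C_p multiplies the radius by p and the linear coefficient
    by a unit. *)
Lemma cheb_iter_regular (a : int) k :
  (forall i, ~~ (p%:Z %| (chebU p).[(cheb (p ^ i)).[a]])%Z) ->
  exists2 u, ~~ (p%:Z %| u)%Z & exists E : {poly int},
    cheb (p ^ k) \Po (a%:P + p%:Z *: 'X) =
    ((cheb (p ^ k)).[a])%:P + p%:Z ^+ k.+1 *: (u *: 'X + p%:Z *: E).
Proof.
move=> Ua; elim: k => [|k [u pu [E IH]]].
  exists 1; first by rewrite dvdz_prime1.
  by exists 0; rewrite comp_polyX hornerX expr1 scaler0 addr0 scale1r.
rewrite expnS cheb_comp; set b := (cheb (p ^ k)).[a] in IH.
have [||E' IH'] := @cheb_step b (p%:Z ^+ k.+1) (p%:Z ^+ 1) (chebU p).[b] (u *: 'X + p%:Z *: E).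
- by rewrite expr1.
- exact: cheb_step_dvd.
exists ((chebU p).[b] * u); first by rewrite Euclid_dvdzM negb_or pu Ua.
exists ((chebU p).[b] *: E + E').
rewrite -comp_polyA IH IH' horner_comp -/b -exprD addn1; congr (_ + _ *: _).
by rewrite !scalerDr !scalerA addrA [_ * p%:Z]mulrC.
Qed.

(** Around the fixed point 2e the multiplier is exactly p^2, so G is preserved modulo p and the
    exponent grows by 2 per step. Leaving L, n and G free lets the iteration start from X as well as
    from the cubic that C_3 produces. Radius p, the case N = 1, relies on [cheb_shift_coef2]. *)
Lemma cheb_iter_pm2 (e : int) n N (L G E : {poly int}) k :
  e * e = 1 -> (1 < N)%N || (N == 1)%N && (3 < p)%N ->
  cheb n \Po L = (2 * e)%:P + p%:Z ^+ N *: (G + p%:Z *: E) ->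
  exists E' : {poly int}, cheb (p ^ k * n) \Po L =
    (2 * e)%:P + p%:Z ^+ (N + k.*2) *: (G + p%:Z *: E').
Proof.
move=> ee N1 H0; elim: k => [|k [E' IH]]; first by exists E; rewrite expn0 mul1n double0 addn0.
have [C2 U2] := cheb_prime_pm2 ee.
have [||E2 IH2] := @cheb_step (2 * e) (p%:Z ^+ (N + k.*2)) (p%:Z ^+ 2) 1 (G + p%:Z *: E').
- by rewrite mulr1.
- have [N2|] := leqP 2 (N + k.*2); first exact: cheb_step_dvd.
  move=> N2; have [N_1 k0] : N = 1%N /\ k = 0%N by lia.
  have p3 : (3 < p)%N by move: N1; rewrite N_1.
  move=> i ip; rewrite N_1 k0 -exprD -exprSr -exprM mul1n.
  have [->|nip] := eqVneq i p; first by rewrite cheb_shift_lead mul1r dvdz_exp_leq.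
  have [->|ni2] := eqVneq i 2.
    by rewrite -[(_ + 2).+1]/(2 + 2)%N exprD dvdz_mul ?cheb_shift_coef2.
  have /dvdzP[t ->] := @dvdz_cheb_shift_coef (2 * e) i ltac:(lia).
  by rewrite -mulrA -exprS dvdz_mull // dvdz_exp_leq; lia.
exists (E' + E2); rewrite expnS -mulnA cheb_comp -comp_polyA IH IH2 C2 -exprD.
by rewrite doubleS !addnS !addn0 scale1r -addrA -scalerDr.
Qed.

(* The cubic of the last alternative comes from
   C_3(2e + 3X) = 2e + 27 (X + 2e X^2 + X^3). *)
Definition disc_form (f : {poly int}) : Prop :=
  exists (a R c h : int) (H G E : {poly int}),
  [/\ R != 0, c != 0, ~~ (p%:Z %| h)%Z, f \Po (a%:P + R *: 'X) = c *: H
    & H = h%:P + G + p%:Z *: E /\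
      ((exists2 u, ~~ (p%:Z %| u)%Z & G = u *: 'X) \/
       p = 3 /\ exists2 e : int, e * e = 1 & G = 'X + (2 * e) *: 'X ^+ 2 + 'X ^+ 3)].

Lemma disc_form_linear (f : {poly int}) (a R c s u : int) (E : {poly int}) :
  R != 0 -> c != 0 -> ~~ (p%:Z %| u)%Z ->
  f \Po (a%:P + R *: 'X) = c *: (s%:P + u *: 'X + p%:Z *: E) ->
  disc_form f.
Proof.
move=> nzR nzc pu fE; have [/dvdzP[t ps]|ps] := boolP (p%:Z %| s)%Z; last first.
  by exists a, R, c, s, (s%:P + u *: 'X + p%:Z *: E), (u *: 'X), E; split=> //; split=> //; left; exists u.
(* When p divides the constant term s, moving the centre by one radius replaces s by s + u, which is
   a unit. *)
exists (a + R), R, c, u, (u%:P + u *: 'X + p%:Z *: (t%:P + (E \Po ('X + 1)))), (u *: 'X).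
exists (t%:P + (E \Po ('X + 1))); split=> //; last by split=> //; left; exists u.
have -> : (a + R)%:P + R *: 'X = (a%:P + R *: 'X) \Po ('X + 1).
  by rewrite comp_polyD comp_polyC comp_polyZ comp_polyX polyCD scalerDr alg_polyC; ring.
rewrite comp_polyA fE comp_polyZ !comp_polyD comp_polyC !comp_polyZ comp_polyX; congr (_ *: _).
by rewrite ps polyCM -mul_polyC !scalerDr -!mul_polyC; ring.
Qed.

Lemma disc_form_cheb (j : int) k : (0 < k)%N ->
  (p%:Z ^+ k.+1 %| (cheb p).[j] - j)%Z ->
  (forall e : int, e * e = 1 -> (p%:Z %| j - 2 * e)%Z ->
     (p%:Z ^+ (2 * k + 1) %| (cheb p).[j] - j)%Z) ->
  disc_form (cheb (p ^ k) - j%:P).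
Proof.
move=> k_gt0 Cj Cj2.
have Cj1 : (p%:Z %| (cheb p).[j] - j)%Z.
  by apply: dvdz_trans Cj; rewrite exprS dvdz_mulr.
have [|reg] := boolP (p%:Z %| j ^+ 2 - 4)%Z; last first.
  have [u pu [E fE]] := @cheb_iter_regular j k (fun i => chebU_coprime i Cj1 reg).
  have /dvdzP[s sE] := dvdz_cheb_iter k Cj.
  apply: (@disc_form_linear _ j p%:Z (p%:Z ^+ k.+1) s u E) => //; first exact: expf_neq0.
  rewrite comp_polyB comp_polyC fE addrAC -polyCB sE -addrA [RHS]scalerDr; congr (_ + _).
  by rewrite polyCM mulrC mul_polyC.
have -> : j ^+ 2 - 4 = (j - 2 * 1) * (j - 2 * -1) by ring.
rewrite Euclid_dvdzM => je.
have {je}[e ee je] : exists2 e : int, e * e = 1 & (p%:Z %| j - 2 * e)%Z.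
  by case/orP: je => je; [exists 1 | exists (-1)].
have {Cj}Cj := Cj2 e ee je; have [C2 U2] := cheb_prime_pm2 ee.
(* With y = j - 2e, Taylor expansion at the fixed point 2e gives C_p(j) - j = y (p^2 - 1 + y r). The
   second factor is a unit modulo p, so the congruence passes to y. *)
have {}je : (p%:Z ^+ (2 * k + 1) %| j - 2 * e)%Z.
  have [r] := taylor2_int (cheb p) (2 * e) (j - 2 * e).
  rewrite addrC subrK (cheb_deriv_pair p).1 hornerMn C2 -[(chebU p).[_] *+ p]mulr_natl (natz p) U2 => CjE.
  move: Cj; rewrite CjE.
  have /dvdzP[t tE] := je; set y := j - 2 * e in je tE *.
  rewrite (_ : _ - j = y * (p%:Z ^+ 2 + y * r - 1)); last by rewrite /y; ring.
  rewrite [X in y * X](_ : _ = p%:Z * (p%:Z + t * r) - 1); last by rewrite tE; ring.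
  rewrite mulrC Gauss_dvdzr // coprimezE abszX coprimeXl //.
  rewrite prime_coprime // -[X in (X %| _)%N]/(`|p%:Z|%N) -dvdzE.
  apply/negP => d1; suff: (p%:Z %| 1%R)%Z by rewrite dvdz_prime1.
  rewrite (_ : 1 = p%:Z * (p%:Z + t * r) - (p%:Z * (p%:Z + t * r) - 1)); last by ring.
  by rewrite rpredB // dvdz_mulr.
(* The disc around 2e has radius p^r; k iterations bring it to p^(r + 2k). *)
have main r s : (1 < r)%N || (r == 1)%N && (3 < p)%N ->
    2 * e - j = s * p%:Z ^+ (r + k.*2) -> disc_form (cheb (p ^ k) - j%:P).
  move=> r1 sE.
  have [|E] := @cheb_iter_pm2 e 1 r ((2 * e)%:P + p%:Z ^+ r *: 'X) 'X 0 k ee r1.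
    by rewrite comp_polyX scaler0 addr0.
  rewrite muln1 => fE.
  apply: (@disc_form_linear _ (2 * e) (p%:Z ^+ r) (p%:Z ^+ (r + k.*2)) s 1 E).
  - exact: expf_neq0.
  - exact: expf_neq0.
  - by rewrite dvdz_prime1.
  rewrite comp_polyB comp_polyC fE addrAC -polyCB sE -addrA [RHS]scalerDr scale1r; congr (_ + _).
  by rewrite polyCM mulrC mul_polyC.
have /dvdzP[s sE] : (p%:Z ^+ (2 * k + 1) %| 2 * e - j)%Z.
  by rewrite -opprB rpredN.
have kk : (1 + k.*2 = 2 * k + 1)%N by lia.
have [p3|p3] := ltnP 3 p.
  by apply: (main 1%N s); rewrite ?p3 ?kk.
have {}p3 : p = 3 by move: p_gt2; lia.
(* For p = 3, radius 3 does not give a linear form. If 2e - j is divisible by 3^(2k+2), radius 9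
   does; otherwise s is a unit and the cubic is kept as it is. *)
have [/dvdzP[t st]|ps] := boolP (p%:Z %| s)%Z.
  by apply: (main 2 t) => //; rewrite sE st -mulrA -exprS -kk.
have [k' kE] : exists k', k = k'.+1 by exists k.-1; rewrite prednK.
have C3 : cheb 3 \Po ((2 * e)%:P + p%:Z *: 'X) =
    (2 * e)%:P + p%:Z ^+ 3 *: (('X + (2 * e) *: 'X ^+ 2 + 'X ^+ 3) + p%:Z *: 0).
  rewrite p3 /= !(comp_polyB, comp_polyM, comp_polyX, comp_polyC) -!mul_polyC !(polyCM, polyCN, polyCB).
  have : e%:P * e%:P = 1%:P :> {poly int} by rewrite -polyCM ee.
  set E := e%:P => EE.
  rewrite [LHS](_ : _ = 8%:P * (E * E) * E + 36%:P * (E * E) * 'X + 54%:P * E * 'X ^+ 2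
     + 27%:P * 'X ^+ 3 - 6%:P * E - 9%:P * 'X); last by ring.
  by rewrite EE; ring.
(* The explicit [C3] is the first of the k iterations; the other k' start at exponent 3. *)
have [|E fE] := @cheb_iter_pm2 e 3 3 _ _ _ k' ee _ C3; first by [].
exists (2 * e), p%:Z, (p%:Z ^+ (2 * k + 1)), s.
exists (s%:P + ('X + (2 * e) *: 'X ^+ 2 + 'X ^+ 3) + p%:Z *: E).
exists ('X + (2 * e) *: 'X ^+ 2 + 'X ^+ 3), E; split=> //; first exact: expf_neq0.
  have -> : (p ^ k = p ^ k' * 3)%N by rewrite kE expnSr p3.
  have e3 : (3 + k'.*2 = 2 * k + 1)%N by rewrite kE; lia.
  rewrite comp_polyB comp_polyC fE e3 addrAC -polyCB sE -!addrA [RHS]scalerDr; congr (_ + _).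
  by rewrite polyCM mulrC mul_polyC.
by split=> //; right; split=> //; exists e.
Qed.
End Prime.

(** * p-adic fixed points *)

Lemma int_sqr1 (e : int) : e * e = 1 -> e = 1 \/ e = -1.
Proof.
move=> ee; have /orP[/eqP|/eqP] : (e == 1) || (e == -1); [|by left|by right].
by rewrite -subr_eq0 -addr_eq0 -mulf_eq0 -subr_sqr_1 expr2 ee subrr.
Qed.

Section Padic.
Variables (p : nat) (p_pr : prime p).

Lemma padic_intr (a : int) : a%:~R = padic_of_int p_pr a.
Proof.
have natE n : n%:R = padic_of_int p_pr n%:Z.
  elim: n => [|n IHn] //; rewrite -natr1 IHn; apply: padic_ext => i /=.
  by rewrite modzDm -addn1 PoszD.
case: a => n; first exact: natE.
rewrite NegzE mulrNz -[n.+1%:~R]/(n.+1%:R) natE; apply: padic_ext => i /=.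
by rewrite modzNm.
Qed.

Lemma padic_eqmod_int n (a b : int) :
  padic_eqmod n (a%:~R : padic_int p_pr) b%:~R <-> (p%:Z ^+ n %| a - b)%Z.
Proof.
have pX : p%:R ^+ n = padic_of_int p_pr (p%:Z ^+ n).
  by rewrite -padic_intr rmorphXn.
split=> [[c]|/dvdzP[c abE]].
  rewrite -intrB pX padic_intr => /(congr1 (fun x => padic_res x n)) /=.
  rewrite modzz mulr0 mod0z => /eqP ab0; exact/dvdz_mod0P/eqP.
by exists c%:~R; rewrite -intrB abE intrM rmorphXn.
Qed.

Lemma padic_eqmod_horner n (f : {poly int}) (x y : padic_int p_pr) :
  padic_eqmod n x y -> padic_eqmod n (map_poly intr f).[x] (map_poly intr f).[y].
Proof.
case=> c xy; have [r _] := @taylor2 (padic_int p_pr) (fun _ => True) f y (x - y) I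
  (fun _ _ _ _ => I) (fun _ _ _ _ => I) (fun _ => I) I I.
have -> : y + (x - y) = x by rewrite addrC subrK.
move=> ->; exists ((map_poly intr f^`()).[y] * c + c * (c * p%:R ^+ n) * r).
by move: (p%:R ^+ n) xy => P ->; ring.
Qed.

Lemma padic_eqmodW m n (x y : padic_int p_pr) :
  (m <= n)%N -> padic_eqmod n x y -> padic_eqmod m x y.
Proof.
move=> /subnKC <- [c xy]; exists (c * p%:R ^+ (n - m)).
by rewrite xy exprD -mulrA [p%:R ^+ m * _]mulrC.
Qed.

Lemma padic_eqmod_sym n (x y : padic_int p_pr) : padic_eqmod n x y -> padic_eqmod n y x.
Proof. by case=> c xy; exists (- c); rewrite -opprB xy mulNr. Qed.

Lemma padic_eqmod_trans n (x y z : padic_int p_pr) :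
  padic_eqmod n x y -> padic_eqmod n y z -> padic_eqmod n x z.
Proof.
case=> c xy [d yz]; exists (c + d).
by rewrite mulrDl -xy -yz addrA subrK.
Qed.

Lemma cheb_fixed_point_dvdz n (j : int) (m : padic_int p_pr) :
  root (map_poly intr (cheb p - 'X)) m -> padic_eqmod n j%:~R m ->
  (p%:Z ^+ n %| (cheb p).[j] - j)%Z.
Proof.
move=> /rootP m0 /(padic_eqmod_horner (cheb p - 'X)).
rewrite m0 horner_map -[0]/(0%:~R) => /padic_eqmod_int.
by rewrite subr0 !hornerE.
Qed.

(** From C_p(m) = m and j close to m follows C_p(j) close to j. After this only integer congruences
    are used and m disappears. *)
Lemma near_fixed_point_dvdz (j : int) k :
  (exists2 m : padic_int p_pr,
     root (map_poly intr (cheb p - 'X)) m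
     & let m_is_pm2 := padic_eqmod 1 m 2%:R \/ padic_eqmod 1 m (- 2%:R) in
       (m_is_pm2 -> padic_eqmod (2 * k + 1) j%:~R m)
       /\ (~ m_is_pm2 -> padic_eqmod (k + 1) j%:~R m)) ->
  (p%:Z ^+ k.+1 %| (cheb p).[j] - j)%Z /\
  (forall e : int, e * e = 1 -> (p%:Z %| j - 2 * e)%Z ->
     (p%:Z ^+ (2 * k + 1) %| (cheb p).[j] - j)%Z).
Proof.
case=> m rm /= [pm2 npm2].
have [/pm2 jm|nm] := EM (padic_eqmod 1 m 2%:R \/ padic_eqmod 1 m (- 2%:R)).
  have := cheb_fixed_point_dvdz rm jm; split=> //.
  by apply: cheb_fixed_point_dvdz rm _; apply: padic_eqmodW jm; lia.
have jm := npm2 nm; rewrite addn1 in jm.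
split=> [|e ee je]; first exact: cheb_fixed_point_dvdz rm jm.
(* A j congruent to 2e modulo p forces m to be so too, hence the stronger hypothesis was the one in
   force. *)
case: nm; have m2e : padic_eqmod 1 m (2 * e)%:~R.
  apply: padic_eqmod_trans (padic_eqmod_sym (padic_eqmodW _ jm)) _ => //.
  by apply/padic_eqmod_int; rewrite expr1.
have [eE|eE] := int_sqr1 ee.
- by left; move: m2e; rewrite eE.
- by right; move: m2e; rewrite eE mulrN1 rmorphN.
Qed.

End Padic.

(** The values 0, 2 and -2 are fixed by C_p, hence Chebyshev powers. The values 1 and -1 are fixed
    as well when p > 3; when p = 3 they are congruent to -2 and 2, and the stronger congruence fails
    for them. *)
Lemma sqr_gt4_of_cheb (p k : nat) (j : int) : prime p -> odd p -> (0 < k)%N ->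
  ~ (exists n : int, j = (cheb p).[n]) ->
  (p%:Z ^+ k.+1 %| (cheb p).[j] - j)%Z ->
  (forall e : int, e * e = 1 -> (p%:Z %| j - 2 * e)%Z ->
     (p%:Z ^+ (2 * k + 1) %| (cheb p).[j] - j)%Z) ->
  4 < j ^+ 2.
Proof.
move=> p_pr p_odd k_gt0 notC Cj Cj2; rewrite ltNge; apply/negP => j4.
have p_gt2 := odd_prime_gt2 p_odd p_pr.
have Cjp : (p%:Z %| (cheb p).[j] - j)%Z.
  by apply: dvdz_trans Cj; rewrite exprS dvdz_mulr.
have : [|| j == 0, j == 1, j == -1, j == 2 * 1 | j == 2 * -1].
  have : `|j| <= 2 by rewrite -(@ler_pXn2r _ 2) ?nnegrE // real_normK ?num_real.
  by lia.
have not2 e : e * e = 1 -> j <> 2 * e.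
  move=> ee jE; apply: notC; exists j.
  by rewrite jE (cheb_prime_pm2 p_odd ee).1.
have not1 : j * j <> 1.
  move=> jj; have [p3|p3] := ltnP 3 p; last first.
    have {}p3 : p = 3 by lia.
    (* Here e = -j, since j + 2j = 3j. The congruence would make 9 divide C_3(j) - j = j^3 - 4j =
       -3j. *)
    have NN : (- j) * (- j) = 1 by rewrite mulrNN.
    have := Cj2 _ NN; rewrite p3 (_ : j - 2 * - j = 3 * j); last by ring.
    rewrite dvdz_mulr // => /(_ isT).
    rewrite /= !(hornerD, hornerN, hornerM, hornerX, hornerC).
    rewrite (_ : _ - j = j * j * j - 4 * j); last by ring.
    rewrite jj mul1r (_ : j - 4 * j = (-3) * j); last by ring.
    have -> : (2 * k + 1 = (2 * k - 1).+2)%N by lia.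
    rewrite exprSr exprSr -mulrA => d; have {}d : (3 * 3 %| -3 * j * j)%Z.
      by apply: dvdz_mulr; apply: dvdz_trans d; apply: dvdz_mull.
    by move: d; rewrite -mulrA jj.
  have pell := congr1 (horner^~ j) (cheb_pell p).
  rewrite !(horner_exp, hornerD, hornerN, hornerM, hornerC, hornerX) [j ^+ 2]expr2 jj in pell.
  apply: notC; exists j; apply/eqP; rewrite eq_sym -subr_eq0; apply/eqP.
  (* For j^2 = 1 the Pell identity is C^2 + 3 U^2 = 4. So |C_p(j) - j| <= 3 < p, and a multiple of p
     that small is 0. *)
  have C2 : (cheb p).[j] ^+ 2 <= 4.
    by have := sqr_ge0 (chebU p).[j]; move: pell; move: (_ ^+ 2) (_ ^+ 2) => u v; lia.
  move: Cjp; rewrite dvdzE /=; set x := _ - j => px.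
  apply/eqP; rewrite -absz_eq0; apply/eqP; have [//|x_gt0] := posnP `|x|%N.
  suff x3 : (`|x| <= 3)%N by have := leq_trans (dvdn_leq x_gt0 px) x3; rewrite leqNgt p3.
  rewrite /x; move: C2; rewrite expr2; move: (cheb p).[j] => c c2.
  have : `|c| <= 2 by rewrite -(@ler_pXn2r _ 2) ?nnegrE // real_normK // ?num_real // expr2.
  by case: (int_sqr1 jj) => ->; clear; lia.

case/or4P => [/eqP j0|/eqP j1|/eqP j1|].
- by apply: notC; exists 0; rewrite cheb_at0.
- by apply: not1; rewrite j1.
- by apply: not1; rewrite j1.
- by case/orP=> /eqP; apply: not2.
Qed.

(** * Prime ideals *)

Section IntegersOf.
Variables (L : splittingFieldType rat) (E : {subfield L}).
Local Notation O := (integers_of E).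

Lemma integers_of_int (c : int) : O c%:~R.
Proof. by split; [apply: rpred_int | apply: integral_id]. Qed.

Lemma integers_of_nat (n : nat) : O n%:R.
Proof. exact: (integers_of_int n%:Z). Qed.

Lemma integers_of0 : O 0. Proof. exact: (integers_of_int 0). Qed.
Lemma integers_of1 : O 1. Proof. exact: (integers_of_int 1). Qed.

Lemma integers_ofD x y : O x -> O y -> O (x + y).
Proof. by move=> [Ex Ix] [Ey Iy]; split; [apply: rpredD | apply: integral_add]. Qed.

Lemma integers_ofN x : O x -> O (- x).
Proof. by move=> [Ex Ix]; split; [rewrite rpredN | apply: integral_opp]. Qed.

Lemma integers_ofB x y : O x -> O y -> O (x - y).
Proof. by move=> Ox Oy; apply: integers_ofD => //; apply: integers_ofN. Qed.

Lemma integers_ofM x y : O x -> O y -> O (x * y).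
Proof. by move=> [Ex Ix] [Ey Iy]; split; [apply: rpredM | apply: integral_mul]. Qed.

Lemma integers_of_gal (s : gal_of E) x : O x -> O (s x).
Proof.
move=> [Ex [f mf fx]]; split; first exact: memv_gal.
exists f => //; rewrite -(fmorph_root s) -map_poly_comp in fx.
rewrite (_ : map_poly intr f = map_poly (s \o intr) f) //.
by apply: eq_map_poly => c /=; rewrite rmorph_int.
Qed.

End IntegersOf.

Section PrimeIdeal.
Variables (L : splittingFieldType rat) (E : {subfield L}) (P : L -> Prop).
Hypotheses (prP : prime_ideal E P) (nzP : exists2 x, P x & x != 0).
Local Notation O := (integers_of E).

Lemma pidealO x : P x -> O x. Proof. by case: prP => + _ _ _ _; apply. Qed.
Lemma pideal0 : P 0. Proof. by case: prP => _ []. Qed.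
Lemma pideal1 : ~ P 1. Proof. by case: prP => _ []. Qed.
Lemma pidealD x y : P x -> P y -> P (x + y). Proof. by case: prP => _ _ + _ _; apply. Qed.
Lemma pidealMl a x : O a -> P x -> P (a * x). Proof. by case: prP => _ _ _ + _; apply. Qed.
Lemma pidealMr a x : O a -> P x -> P (x * a). Proof. by rewrite mulrC; apply: pidealMl. Qed.
Lemma pidealM x y : O x -> O y -> P (x * y) -> P x \/ P y.
Proof. by case: prP => _ _ _ _; apply. Qed.
Lemma pidealN x : P x -> P (- x).
Proof. by rewrite -mulN1r; apply: pidealMl; apply: integers_ofN; apply: integers_of1. Qed.
Lemma pidealB x y : P x -> P y -> P (x - y).
Proof. by move=> Px Py; apply: pidealD => //; apply: pidealN. Qed.

Lemma notpidealM x y : O x -> O y -> ~ P x -> ~ P y -> ~ P (x * y).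
Proof. by move=> Ox Oy nx ny /(pidealM Ox Oy)[]. Qed.

Lemma pidealX x n : O x -> P (x ^+ n) -> P x.
Proof.
move=> Ox; elim: n => [/pideal1//|n IHn]; rewrite exprS.
have OX m : O (x ^+ m).
  by elim: m => [|m IHm]; [apply: integers_of1 | rewrite exprS; apply: integers_ofM].
by case/(pidealM Ox (OX n)).
Qed.

(** The lowest nonzero coefficient of an integral equation of x is a multiple of x, hence in P;
    primality of P then singles out a prime factor. *)
Lemma prime_ideal_int : exists2 l : nat, prime l & P l%:R.
Proof.
have [x Px nzx] := nzP.
have [n n_gt0 Pn] : exists2 n : nat, (0 < n)%N & P n%:R.
  have [_ [f mf /rootP fx]] := pidealO Px.
  have {mf} : f != 0 by apply: monic_neq0.
  elim/poly_ind: f fx => [|f c IH]; first by rewrite eqxx.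
  rewrite rmorphD rmorphM /= map_polyX map_polyC !hornerE => fx nzf.
  have [c0|nzc] := eqVneq c 0.
    apply: IH; last by apply: contraNneq nzf => ->; rewrite c0 mul0r addr0.
    by apply/eqP; move/eqP: fx; rewrite c0 addr0 mulf_eq0 (negPf nzx) orbF.
  exists `|c|%N; first by rewrite absz_gt0.
  have Pc : P c%:~R.
    have -> : c%:~R = - ((map_poly intr f).[x] * x).
      by apply/eqP; rewrite -addr_eq0 addrC fx.
    apply: pidealN.
    apply: pidealMl => //; split; last first.
      apply: integral_horner; last by case: (pidealO Px).
      by apply/integral_poly=> i; rewrite coef_map; apply: integral_id.
    apply: rpred_horner; last by case: (pidealO Px).
    by apply/polyOverP=> i; rewrite coef_map rpred_int.
  have [c_ge0|c_lt0] := leP 0 c; first by move: Pc; rewrite -[in X in X -> _](gez0_abs c_ge0).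
  by have := pidealN Pc; rewrite -rmorphN -(ltz0_abs c_lt0).
elim/ltn_ind: n n_gt0 Pn => n IH n_gt0 Pn.
have [n1|n1] := leqP n 1.
  have n_1 : n = 1%N by lia.
  by case: pideal1; rewrite n_1 in Pn; exact: Pn.
have := Pn; rewrite -(divnK (pdiv_dvd n)) natrM.
case/(pidealM (integers_of_nat _ _) (integers_of_nat _ _)) => Pd; last first.
  by exists (pdiv n); rewrite ?pdiv_prime.
apply: IH Pd; last by rewrite divn_gt0 ?pdiv_gt0 // dvdn_leq // pdiv_dvd.
by rewrite ltn_Pdiv // prime_gt1 // pdiv_prime.
Qed.

(** The coefficient domain I is a parameter because the Nakayama argument compares combinations over
    O with combinations over P. *)
Definition span_over (I : L -> Prop) (g : seq L) (x : L) : Prop :=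
  exists2 c : nat -> L, forall i, I (c i) & x = \sum_(i < size g) c i * g`_i.

Lemma span_over_rcons I g y x : span_over I (rcons g y) x <->
  exists2 d, I d & span_over I g (x - d * y).
Proof.
split=> [[c Ic ->]|[d Id [c Ic xE]]].
  exists (c (size g)) => //; exists c => //.
  rewrite size_rcons big_ord_recr /= nth_rcons ltnn eqxx addrK.
  by apply: eq_bigr => i _; rewrite nth_rcons ltn_ord.
exists (fun i => if (i < size g)%N then c i else d) => [i|]; first by case: ifP.
rewrite size_rcons big_ord_recr /= nth_rcons ltnn eqxx -[LHS](subrK (d * y)) xE.
by congr (_ + _); apply: eq_bigr => i _; rewrite nth_rcons ltn_ord.
Qed.

Lemma span_overD I g x y : (forall a b, I a -> I b -> I (a + b)) ->
  span_over I g x -> span_over I g y -> span_over I g (x + y).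
Proof.
move=> ID [c Ic ->] [d Id ->]; exists (fun i => c i + d i) => [i|]; first exact: ID.
by rewrite -big_split; apply: eq_bigr => i _; rewrite mulrDl.
Qed.

Lemma span_overM (I J : L -> Prop) g a x : (forall b, I b -> J (a * b)) ->
  span_over I g x -> span_over J g (a * x).
Proof.
move=> IJ [c Ic ->]; exists (fun i => a * c i) => [i|]; first exact: IJ.
by rewrite mulr_sumr; apply: eq_bigr => i _; rewrite mulrA.
Qed.

(* Nakayama's lemma, one generator at a time and up to a multiplier s outside P. *)
Lemma prime_ideal_not_idempotent (s0 : L) : O s0 -> ~ P s0 ->
  (exists2 g : seq L, forall x, x \in g -> P x & forall x, P x -> span_over O g x) ->
  ~ (forall x, P x -> ideal_mul P P (s0 * x)).
Proof.
move=> Os0 ns0 [g gP gen] idem.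
have [x0 Px0 nzx0] := nzP.
have {gen} : exists2 s, O s /\ ~ P s & forall x, P x -> span_over O g (s * x).
  by exists 1 => [|x Px]; [split; [apply: integers_of1 | apply: pideal1] | rewrite mul1r; apply: gen].
elim/last_ind: g gP => [|g y IH] gP [s [Os ns] gen].
  have [c _ /eqP] := gen x0 Px0; rewrite big_ord0 mulf_eq0 (negPf nzx0) orbF => /eqP s00.
  by case: ns; rewrite s00; apply: pideal0.
have Py : P y by apply: gP; rewrite mem_rcons mem_head.
have [n [a [b [Pa Pb ey]]]] := idem y Py.
(* As s0 y lies in P^2, s s0 y is a combination of the generators with coefficients in P. Its y-term
   d y moves to the left, and y is eliminated at the price of the multiplier s s0 - d, which is
   outside P. *)
have : span_over P (rcons g y) (s * (s0 * y)).
  rewrite ey mulr_sumr; apply: (big_ind (span_over P (rcons g y))) => [||i _].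
  - exists (fun=> 0) => [_|]; first exact: pideal0.
    by rewrite big1 // => i _; rewrite mul0r.
  - by move=> u v; apply: span_overD; apply: pidealD.
  rewrite mulrCA; apply: (@span_overM O P) => [d Od|]; last exact: gen.
  by apply: pidealMr.
case/span_over_rcons=> d Pd; rewrite mulrA -mulrBl => ty.
have Od := pidealO Pd; have Oss0 := integers_ofM Os Os0.
have nt : ~ P (s * s0 - d).
  by move=> /pidealD /(_ Pd); rewrite subrK; apply: notpidealM.
have Ot := integers_ofB Oss0 Od.
apply: IH => [x xg|]; first by apply: gP; rewrite mem_rcons inE xg orbT.
exists ((s * s0 - d) * s) => [|x Px].
  by split; [apply: integers_ofM | apply: notpidealM].
have [e Oe span] := (span_over_rcons _ _ _ _).1 (gen x Px).
rewrite -mulrA -[s * x](subrK (e * y)) mulrDr [_ * (e * y)]mulrCA.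
apply: span_overD; first exact: integers_ofD.
  by apply: (@span_overM O O) span => b' Ob'; apply: integers_ofM.
by apply: (@span_overM P O) ty => b' Pb'; apply: integers_ofM => //; apply: pidealO.
Qed.

End PrimeIdeal.

(** Clear denominators in a rational relation and divide by the content: no prime divides all the
    coefficients any more. *)
Lemma primitive_relation (L : splittingFieldType rat) (g : seq L) : ~~ free g ->
  exists2 c : nat -> int, \sum_(i < size g) (c i)%:~R * g`_i = 0 &
    forall l : nat, prime l -> exists2 i, (i < size g)%N & ~~ (l%:Z %| c i)%Z.
Proof.
move=> nfree; have [k k0 nzk] : exists2 k : 'I_(size g) -> rat,
    \sum_i k i *: g`_i = 0 & exists i, k i != 0.
  apply: contrapT => H; case/negP: nfree; apply/(@freeP _ L _ (in_tuple g)) => k k0 i.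
  by apply/eqP; apply: contrapT => /negP nzi; apply: H; exists k => //; exists i.
pose kk i := if insub i is Some j then k j else 0.
have kkE (i : 'I_(size g)) : kk i = k i by rewrite /kk valK.
have [q [a nza pE]] := rat_poly_scale (\poly_(i < size g) kk i).
have kE (i : 'I_(size g)) : k i = a%:~R^-1 * (q`_i)%:~R.
  by have /polyP/(_ i) := pE; rewrite coef_poly ltn_ord kkE coefZ coef_map.
have qE i : q`_i = zcontents q * (zprimitive q)`_i by rewrite -coefZ -zpolyEprim.
have nzq : zcontents q != 0.
  case: nzk => i; rewrite kE qE; apply: contraNneq => ->.
  by rewrite mul0r mulr0.
exists (fun i => (zprimitive q)`_i) => [|l l_pr].
  have nzc : (zcontents q)%:~R / a%:~R != 0 :> rat.
    by rewrite mulf_neq0 ?invr_eq0 ?intr_eq0.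
  apply: (scalerI nzc); rewrite scaler0 -[RHS]k0 scaler_sumr.
  apply: eq_bigr => i _; rewrite kE qE intrM (mulrzl g`_i) -(@scaler_int rat L _ g`_i) scalerA.
  by congr (_ *: _); rewrite mulrAC mulrC.
have lprim : ~~ (l%:Z %| zcontents (zprimitive q))%Z.
  by rewrite zcontents_primitive -zcontents_eq0 nzq dvdzE /= dvdn1 neq_ltn prime_gt1 ?orbT.
apply: contrapT => H; case/negP: lprim; rewrite dvdz_contents.
apply/polyOverP => i; apply: contrapT => /negP nl; apply: H; exists i => //.
have : (zprimitive q)`_i != 0 by apply: contraNneq nl => ->; apply: dvdz0.
move=> nzi; have : q`_i != 0 by rewrite qE mulf_neq0.
have /polyP/(_ i) := pE; rewrite coef_poly coefZ coef_map; case: ltnP => // _ /esym/eqP.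
by rewrite mulf_eq0 invr_eq0 !intr_eq0 (negPf nza) /= => /eqP-> /eqP.
Qed.

Section PrimeIdeal.
Variables (L : splittingFieldType rat) (E : {subfield L}) (P : L -> Prop).
Hypotheses (prP : prime_ideal E P) (nzP : exists2 x, P x & x != 0).
Local Notation O := (integers_of E).

(* A family of elements of P that stays independent modulo l is free over Q, so a
   maximal one is finite; together with l it generates P. *)
Lemma prime_ideal_fingen :
  exists2 g : seq L, forall x, x \in g -> P x & forall x, P x -> span_over O g x.
Proof.
have [l l_pr Pl] := prime_ideal_int prP nzP.
(* Independence is modulo l O, where O is the whole ring of integers; the case o = 0 bounds the
   length through [primitive_relation]. *)
pose indep (g : seq L) := (forall x, x \in g -> P x) /\
  forall (c : nat -> int) o, O o -> \sum_(i < size g) (c i)%:~R * g`_i = l%:R * o ->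
    forall i, (i < size g)%N -> (l%:Z %| c i)%Z.
have bound g : indep g -> (size g <= \dim {:L})%N.
  case=> _ ind; have [fg|nf] := boolP (free g).
    by move: fg; rewrite /free => /eqP <-; apply: dimvS; apply: subvf.
  have [c c0 cl] := primitive_relation nf; have [i ig] := cl l l_pr.
  by rewrite (ind c 0 (integers_of0 E)) // c0 mulr0.
suff ext n : forall g, indep g -> (\dim {:L} < size g + n)%N ->
    exists2 g : seq L, forall x, x \in g -> P x & forall x, P x -> span_over O g x.
  by apply: (ext (\dim {:L}).+1 [::]); [split | rewrite ltnS].
elim: n => [|n IH] g ig szg; first by have := bound g ig; rewrite leqNgt -[size g]addn0 szg.
have [[x Px ix]|max] := EM (exists2 x, P x & indep (rcons g x)).
  by apply: IH ix _; rewrite size_rcons addSnnS.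
exists (rcons g l%:R) => [x|x Px].
  by rewrite mem_rcons inE => /orP[/eqP-> //|]; case: ig => + _; apply.
have : ~ indep (rcons g x) by move=> ix; apply: max; exists x.
have Pgx y : y \in rcons g x -> P y.
  by rewrite mem_rcons inE => /orP[/eqP-> //|]; case: ig => + _; apply.
move=> nix; have [c [o [Oo rel [i ig' nl]]]] : exists (c : nat -> int) o, [/\ O o,
    \sum_(i < size (rcons g x)) (c i)%:~R * (rcons g x)`_i = l%:R * o &
    exists2 i, (i < size (rcons g x))%N & ~~ (l%:Z %| c i)%Z].
  apply: contrapT => H; apply: nix; split=> // c o Oo rel i ig'.
  by apply: contrapT => /negP nl; apply: H; exists c, o; split=> //; exists i.
move: rel ig'; rewrite size_rcons big_ord_recr /= nth_rcons ltnn eqxx.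
under eq_bigr => k _ do rewrite nth_rcons ltn_ord.
set s := (X in X + _ = _); move=> rel ig'.
(* If l divided the coefficient of x, that term could be absorbed into l o, leaving a relation on g
   alone with all coefficients divisible by l. *)
have nlc : ~~ (l%:Z %| c (size g))%Z.
  apply: contra nl => /dvdzP[d cd]; have [->|ni] := eqVneq i (size g).
    by rewrite cd dvdz_mull.
  have [_ ind] := ig; apply: (ind c (o - d%:~R * x)).
  - apply: integers_ofB => //; apply: integers_ofM; first exact: integers_of_int.
    exact: pidealO Px.
  - rewrite -/s mulrBr -rel cd intrM; set t := (_ * _ * x); suff -> : l%:R * (d%:~R * x) = t.
      by rewrite addrK.
    by rewrite /t mulrCA mulrA.
  by lia.
(* With u c + v l = 1 and c x = l o - s one gets x = l (u o + v x) - u s, a combination of l and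
   g. *)
have /coprimezP[[u v] /= uv] : coprimez (c (size g)) l%:Z.
  by rewrite coprimezE coprime_sym prime_coprime // -dvdzE.
have uvL : (u * c (size g))%:~R + (v * l%:Z)%:~R = 1 :> L by rewrite -intrD uv.
apply/span_over_rcons; exists (u%:~R * o + v%:~R * x).
  apply: integers_ofD; apply: integers_ofM => //; try exact: integers_of_int.
  exact: pidealO Px.
exists (fun i => (- u * c i)%:~R) => [k|]; first exact: integers_of_int.
transitivity ((- u)%:~R * s); last first.
  by rewrite /s mulr_sumr; apply: eq_bigr => k _; rewrite intrM mulrA.
have -> : s = l%:R * o - (c (size g))%:~R * x by rewrite -rel addrK.
rewrite -[X in X - _ = _](mul1r x) -[X in X * x]uvL !intrM mulrNz; ring.
Qed.

End PrimeIdeal.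

(** * Trivial inertia implies unramified *)

Section Inertia.
Variables (L : splittingFieldType rat) (F E : {subfield L}) (P : L -> Prop).
Hypotheses (galFE : galois F E).
Hypotheses (prP : prime_ideal E P) (nzP : exists2 x, P x & x != 0).
Local Notation O := (integers_of E).
Hypothesis inertia1 : forall s, s \in 'Gal(E / F)%g -> s != 1%g ->
  exists2 b, O b & ~ P (s b - b).

(* t represents an element of O (x) O that vanishes under x (x) y |-> x * tau y for all
   tau in S, but not modulo P for tau = 1. *)
Lemma separating_tensor (S : seq (gal_of E)) :
  (forall s, s \in S -> s \in 'Gal(E / F)%g /\ s != 1%g) ->
  exists t : seq (L * L), [/\ forall z, z \in t -> O z.1 /\ O z.2,
    O (\sum_(z <- t) z.1 * z.2), ~ P (\sum_(z <- t) z.1 * z.2) &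
    forall s, s \in S -> \sum_(z <- t) z.1 * s z.2 = 0].
Proof.
elim: S => [|s S IH] sS.
  exists [:: (1, 1)]; rewrite big_seq1 mulr1; split=> //; last exact: pideal1 prP.
    by move=> z; rewrite inE => /eqP->; split; exact: integers_of1.
  exact: integers_of1.
have [s' s'S|t [tO Ot nt t0]] := IH; first by apply: sS; rewrite inE s'S orbT.
have [sG s1] : s \in 'Gal(E / F)%g /\ s != 1%g by apply: sS; rewrite mem_head.
have [b Ob nb] := inertia1 sG s1.
have Osb := integers_of_gal s Ob.
(* This is t multiplied by s b (x) 1 - 1 (x) b. Its value at tau gains the factor s b - tau b, which
   vanishes at tau = s and is outside P at tau = 1. *)
pose t' := [seq (s b * z.1, z.2) | z <- t] ++ [seq (- z.1, b * z.2) | z <- t].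
have valE (f : L -> L) : {morph f : x y / x * y} ->
    \sum_(z <- t') z.1 * f z.2 = (s b - f b) * \sum_(z <- t) z.1 * f z.2.
  move=> fM; rewrite big_cat !big_map /= mulrBl !mulr_sumr -sumrN; congr (_ + _).
    by apply: eq_bigr => z _; rewrite mulrA.
  by apply: eq_bigr => z _; rewrite fM mulNr mulrCA.
exists t'; rewrite (valE id) //; split.
- move=> z; rewrite mem_cat => /orP[] /mapP[w /tO[O1 O2] ->] /=; split=> //.
  + exact: integers_ofM.
  + exact: integers_ofN.
  + exact: integers_ofM.
- by apply: integers_ofM => //; apply: integers_ofB.
- by apply: (notpidealM prP) => //; apply: integers_ofB.
move=> s'; rewrite inE valE; last by move=> x y; rewrite rmorphM.
by case/orP=> [/eqP->|/t0->]; rewrite ?subrr ?mul0r ?mulr0.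
Qed.

(** Since s has finite order it is a power of its inverse. *)
Lemma ideal_gal_stable (s : gal_of E) :
  (forall x, P x -> P ((s^-1)%g x)) -> forall x, P x -> P (s x).
Proof.
move=> sV x Px; have [Ex _] := pidealO prP Px.
have iter_sV n : P (((s^-1) ^+ n)%g x).
  elim: n => [|n IHn]; first by rewrite expg0 gal_id.
  by rewrite expgSr galM //; apply: sV.
by rewrite -[s]invgK invg_expg.
Qed.

(** If s^-1 does not stabilize P, choose x in P with s^-1 x outside P: then s((s^-1 x) y) = x (s y)
    is in P. The product over S of such multipliers will force the traces of elements of u P into
    P. *)
Lemma prime_avoidance (S : seq (gal_of E)) :
  exists u, [/\ O u, ~ P u & forall s, s \in S -> forall x, P x -> P (s (u * x))].
Proof.
elim: S => [|s S [u [Ou nu uS]]].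
  by exists 1; split=> //; [apply: integers_of1 | apply: pideal1 prP].
have [v [Ov nv vs]] : exists v, [/\ O v, ~ P v & forall x, P x -> P (s (v * x))].
  have [sV|] := EM (forall x, P x -> P ((s^-1)%g x)).
    exists 1; split; [exact: integers_of1 | exact: pideal1 prP | move=> x Px].
    by rewrite mul1r; apply: ideal_gal_stable.
  move=> nsV; have [x Px nx] : exists2 x, P x & ~ P ((s^-1)%g x).
    by apply: contrapT => H; apply: nsV => x Px; apply: contrapT => nx; apply: H; exists x.
  exists ((s^-1)%g x); split=> //; first by apply: integers_of_gal; apply: pidealO Px.
  move=> y Py; have [Ex _] := pidealO prP Px.
  rewrite rmorphM /= -galM // mulVg gal_id; apply: (pidealMr prP) => //.
  by apply: integers_of_gal; apply: pidealO Py.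
exists (u * v); split; [exact: integers_ofM | exact: (notpidealM prP) | ].
move=> s'; rewrite inE => /orP[/eqP->|s'S] x Px.
  by rewrite mulrAC mulrC; apply: vs; apply: (pidealMl prP).
by rewrite -mulrA; apply: uS => //; apply: (pidealMl prP).
Qed.

(** If the ideal generated by the primes below lay in P^2, writing u s0 x as a sum of traces from P
    times integers would put u s0 P inside P^2, with u s0 outside P. *)
Theorem trivial_inertia_ramification_index : ramification_index F E P 1.
Proof.
split=> [x [n [a [b [Pa Ob ->]]]]|].
  by exists n, a, b; split=> // i; case: (Pa i).
move=> sub2.
have [|t [tO Ot nt t0]] := @separating_tensor [seq s <- enum 'Gal(E / F)%g | s != 1%g].
  by move=> s; rewrite mem_filter mem_enum => /andP[].
have [u [Ou nu uG]] := prime_avoidance (enum 'Gal(E / F)%g).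
set s0 := \sum_(z <- t) z.1 * z.2 in Ot nt.
apply: (@prime_ideal_not_idempotent _ _ _ prP nzP (u * s0)) => [||| x Px].
- exact: integers_ofM.
- exact: (notpidealM prP).
- exact: prime_ideal_fingen.
have [Ex _] := pidealO prP Px.
have PTr z : O z -> P (galTrace F E (u * x * z)).
  move=> Oz; rewrite /galTrace; apply: (big_ind P) => [|y y'|s sG].
  - exact: pideal0 prP.
  - exact: (pidealD prP).
  by rewrite -mulrA; apply: uG; rewrite ?mem_enum //; apply: (pidealMr prP).
have below z : O z -> ideal_below F P (galTrace F E (u * x * z)).
  move=> Oz; split; last exact: PTr.
  split; last by case: (pidealO prP (PTr z Oz)).
  by apply: mem_galTrace => //; case: Oz Ou => Ez _ [Eu _]; rewrite !rpredM.
(* Exchanging the sums leaves, for each s, the value of the tensor at s; only s = 1 survives. *)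
have val : u * s0 * x = \sum_(z <- t) galTrace F E (u * x * z.2) * z.1.
  transitivity (\sum_(s in 'Gal(E / F)%g) s (u * x) * \sum_(z <- t) z.1 * s z.2).
    rewrite (bigD1 1%g) ?group1 //= gal_id [X in _ + X]big1 => [|s /andP[sG s1]].
      rewrite addr0 mulrAC; congr (_ * _).
      by apply: eq_bigr => z _; rewrite gal_id.
    by rewrite t0 ?mulr0 // mem_filter s1 mem_enum.
  under eq_bigr do rewrite mulr_sumr.
  rewrite exchange_big; apply: eq_bigr => z _; rewrite /galTrace mulr_suml.
  by apply: eq_bigr => s _; rewrite [in RHS]rmorphM /= mulrA mulrAC.
have : ideal_exp E P 2 (u * s0 * x).
  apply: sub2; exists (size t), (fun i => galTrace F E (u * x * (t`_i).2)), (fun i => (t`_i).1).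
  have tO' (i : 'I_(size t)) : O (t`_i).1 /\ O (t`_i).2 by apply/tO/mem_nth.
  split=> [i|i|]; [by apply: below; case: (tO' i) | by case: (tO' i) |].
  by rewrite val (big_nth 0) big_mkord.
(* [ideal_exp E P 2] unfolds to P (P O), so the inner factor still has to be folded back into P. *)
case=> n [a [b [Pa Pb ->]]]; exists n, a, b; split=> // i.
have [m [a' [b' [Pa' Ob' ->]]]] := Pb i.
apply: (big_ind P) => [|y y'|l _]; [exact: pideal0 prP | exact: (pidealD prP) |].
exact: (pidealMr prP).
Qed.

End Inertia.

(** * Roots of C_q - j *)

Lemma intr_ext_eq0 (L : fieldExtType rat) (c : int) : (c%:~R == 0 :> L) = (c == 0).
Proof. by rewrite -(rmorph_int (in_alg L)) fmorph_eq0 intr_eq0. Qed.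

Lemma natr_ext_eq0 (L : fieldExtType rat) (n : nat) : (n%:R == 0 :> L) = (n == 0)%N.
Proof. by rewrite -[n%:R]/(n%:~R) intr_ext_eq0. Qed.

Lemma addrV_inj (K : fieldType) (a b : K) : a != 0 -> b != 0 ->
  a + a^-1 = b + b^-1 -> a = b \/ a = b^-1.
Proof.
move=> nza nzb eqab.
have: (a - b) * (a * b - 1) == 0.
  have -> : (a - b) * (a * b - 1) = a * b * ((a + a^-1) - (b + b^-1)).
    by field; rewrite nzb nza.
  by rewrite eqab subrr mulr0.
rewrite mulf_eq0 !subr_eq0 => /orP[/eqP|/eqP ab1]; [by left | right].
by rewrite -[LHS](mulfK nzb) ab1 mul1r.
Qed.

Lemma subrV_inj (K : fieldType) (a b : K) : a != 0 -> b != 0 ->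
  a - a^-1 = b - b^-1 -> a = b \/ a = - b^-1.
Proof.
move=> nza nzb eqab.
have: (a - b) * (a * b + 1) == 0.
  have -> : (a - b) * (a * b + 1) = a * b * ((a - a^-1) - (b - b^-1)) by field; rewrite nzb nza.
  by rewrite eqab subrr mulr0.
rewrite mulf_eq0 subr_eq0 addr_eq0 => /orP[/eqP|/eqP ab1]; [by left | right].
by rewrite -[LHS](mulfK nzb) ab1 mulN1r.
Qed.

(** By the Pell identity delta / U_q(alpha) is a square root of alpha^2 - 4. Building y from this
    particular root fixes the sign in y^q - y^-q = delta. *)
Lemma cheb_root_param (L : fieldExtType rat) (q : nat) (j : int) (delta alpha : L) :
  delta != 0 -> delta ^+ 2 = j%:~R ^+ 2 - 4%:R ->
  root (map_poly intr (cheb q - j%:P)) alpha ->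
  exists y : L, [/\ y != 0, y + y^-1 = alpha,
    y ^+ q + y ^- q = j%:~R & y ^+ q - y ^- q = delta].
Proof.
move=> nzd d2; rewrite rmorphB /= map_polyC rootE !hornerE subr_eq0 => /eqP Calpha.
have n2 : 2%:R != 0 :> L by rewrite natr_ext_eq0.
have n4 : 4%:R != 0 :> L by rewrite natr_ext_eq0.
set u := (map_poly intr (chebU q)).[alpha].
have pell : delta ^+ 2 = (alpha ^+ 2 - 4) * u ^+ 2.
  have := congr1 (fun f => (map_poly (intr : int -> L) f).[alpha]) (cheb_pell q).
  rewrite !(rmorphXn, rmorphB, rmorphM) /= map_polyX !map_polyC /=.
  rewrite !(horner_exp, hornerD, hornerN, hornerM, hornerC, hornerX) Calpha -/u => E.
  by rewrite d2 -[X in _ - X]E; ring.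
have nzu : u != 0.
  by apply: contra_neq nzd => u0; apply/eqP; rewrite -sqrf_eq0 pell u0 expr0n mulr0.
have e2 : (delta / u) ^+ 2 = alpha ^+ 2 - 4 by rewrite expr_div_n pell mulfK // sqrf_eq0.
pose y := (alpha + delta / u) / 2; pose y' := (alpha - delta / u) / 2.
have yy' : y * y' = 1.
  have -> : y * y' = (alpha ^+ 2 - (delta / u) ^+ 2) / 4 by rewrite /y /y'; field; rewrite ?nzu ?n2 ?n4.
  by rewrite e2 opprB addrCA subrr addr0 divff // (natr_ext_eq0 _ 4).
have nzy : y != 0 by apply: contra_eq_neq yy' => ->; rewrite mul0r eq_sym oner_eq0.
have yV : y^-1 = y' by rewrite -[RHS](mulKf nzy) yy' mulr1.
have ya : y + y^-1 = alpha by rewrite yV /y /y'; field; rewrite ?nzu ?n2 ?n4.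
exists y; split=> //; first by rewrite -chebE // ya.
rewrite -chebU_horner // ya -/u yV [y - y'](_ : _ = delta / u); last by rewrite /y /y'; field; rewrite ?nzu ?n2 ?n4.
by rewrite mulrC divfK.
Qed.

Section ChebyshevRoots.
Variables (L : splittingFieldType rat) (q : nat) (j : int) (zeta delta y : L).
Hypotheses (q_odd : odd q) (prim : q.-primitive_root zeta) (nz_delta : delta != 0).
Hypotheses (nz_y : y != 0) (yD : y ^+ q + y ^- q = j%:~R) (yB : y ^+ q - y ^- q = delta).

Let q_gt0 : (0 < q)%N. Proof. by case: (q) q_odd. Qed.
Let two_neq0 : 2%:R != 0 :> L. Proof. by rewrite natr_ext_eq0. Qed.

Definition cheb_root (w : L) : L := w * y + (w * y)^-1.
Local Notation A := cheb_root.

Lemma unity_root_neq0 (w : L) : w ^+ q = 1 -> w != 0.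
Proof.
move=> wq; apply/eqP => w0; move: wq; rewrite w0 expr0n -[q == 0]/(q == 0)%N gtn_eqF //.
by move/eqP; rewrite eq_sym oner_eq0.
Qed.

Lemma zetaq : zeta ^+ q = 1. Proof. exact: prim_expr_order prim. Qed.

Lemma unity_rootM (w v : L) : w ^+ q = 1 -> v ^+ q = 1 -> (w * v) ^+ q = 1.
Proof. by move=> w1 v1; rewrite exprMn w1 v1 mulr1. Qed.

Lemma unity_rootV (w : L) : w ^+ q = 1 -> w^-1 ^+ q = 1.
Proof. by move=> w1; rewrite exprVn w1 invr1. Qed.

Lemma unity_root_neqN (w v : L) : w ^+ q = 1 -> v ^+ q = 1 -> w <> - v.
Proof.
move=> w1 v1 wv; have: 1 = -1 :> L by rewrite -{1}w1 wv exprNn v1 mulr1 -signr_odd q_odd.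
by move/eqP; rewrite -addr_eq0 (negPf two_neq0).
Qed.

Lemma unity_root_sqrt (w : L) : w ^+ q = 1 -> exists2 v, v ^+ q = 1 & w = v ^+ 2.
Proof.
move=> w1; exists (w ^+ (q.+1)./2); first by rewrite exprAC w1 expr1n.
rewrite -exprM muln2 (_ : (q.+1)./2.*2 = q.+1); last first.
  by rewrite -[RHS]odd_double_half /= q_odd.
by rewrite exprS w1 mulr1.
Qed.

Lemma yq_half : y ^+ q = (j%:~R + delta) / 2 /\ y ^- q = (j%:~R - delta) / 2.
Proof. by rewrite -yD -yB; split; field; rewrite ?two_neq0 ?expf_neq0. Qed.

(** Otherwise y^q would be its own inverse and delta would vanish. This excludes A(w) = A(v) through
    w y = 1/(v y), so the q roots are distinct. *)
Lemma unity_root_y2 (w : L) : w ^+ q = 1 -> w * y ^+ 2 <> 1.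
Proof.
move=> w1 wy; have: (w * y ^+ 2) ^+ q = 1 by rewrite wy expr1n.
rewrite exprMn w1 mul1r exprAC expr2 => yy; case/eqP: nz_delta; rewrite -yB.
by rewrite -[y ^- q]mulr1 -yy mulKf ?subrr // expf_neq0.
Qed.

Lemma cheb_root_inj (w v : L) : w ^+ q = 1 -> v ^+ q = 1 -> A w = A v -> w = v.
Proof.
move=> w1 v1 Awv; have nz (u : L) : u ^+ q = 1 -> u * y != 0.
  by move=> u1; rewrite mulf_neq0 // unity_root_neq0.
have [|wvy] := addrV_inj (nz w w1) (nz v v1) Awv; first exact: mulIf.
case: (unity_root_y2 (unity_rootM w1 v1)).
have: w * y * (v * y) = 1 by rewrite wvy mulVf // nz.
by rewrite mulrACA expr2.
Qed.

Lemma cheb_rootP (w : L) : w ^+ q = 1 -> root (map_poly intr (cheb q - j%:P)) (A w).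
Proof.
move=> w1; rewrite rmorphB /= map_polyC rootE !hornerE chebE; last first.
  by rewrite mulf_neq0 // unity_root_neq0.
by rewrite exprMn w1 mul1r yD subrr.
Qed.

Definition unity_root_seq : seq L := [seq zeta ^+ i | i <- iota 0 q].

Lemma mem_unity_root_seq (w : L) : (w \in unity_root_seq) = (w ^+ q == 1).
Proof.
apply/mapP/eqP => [[i _ ->]|w1]; first by rewrite exprAC zetaq expr1n.
by have [i ->] := prim_rootP prim w1; exists (i : nat) => //; rewrite mem_iota add0n ltn_ord.
Qed.

Lemma uniq_unity_root_seq : uniq unity_root_seq.
Proof.
rewrite map_inj_in_uniq ?iota_uniq // => a b; rewrite !mem_iota /= !add0n => aq bq /eqP.
by rewrite (eq_prim_root_expr prim) !modn_small // => /eqP.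
Qed.

Lemma uniq_cheb_roots : uniq (map A unity_root_seq).
Proof.
rewrite map_inj_in_uniq => [|w v]; last first.
  by rewrite !mem_unity_root_seq => /eqP w1 /eqP v1; apply: cheb_root_inj.
exact: uniq_unity_root_seq.
Qed.

Lemma size_cheb_sub : size (cheb q - j%:P) = q.+1.
Proof.
rewrite size_polyDl size_cheb // size_polyN size_polyC.
by case: (j != 0); rewrite ltnS.
Qed.

Lemma cheb_sub_monic : cheb q - j%:P \is monic.
Proof.
rewrite monicE lead_coefDl; first by rewrite -monicE cheb_monic.
by rewrite size_cheb size_polyN size_polyC; case: (j != 0); rewrite ltnS.
Qed.

Lemma cheb_sub_prod :
  map_poly intr (cheb q - j%:P) = \prod_(w <- unity_root_seq) ('X - (A w)%:P).
Proof.
have mon : map_poly (intr : int -> L) (cheb q - j%:P) \is monic.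
  by rewrite monic_map ?cheb_sub_monic.
rewrite (@all_roots_prod_XsubC _ (map_poly intr (cheb q - j%:P)) (map A unity_root_seq)).
- by rewrite (monicP mon) scale1r big_map.
- rewrite size_map size_map size_iota size_map_poly_id0 ?size_cheb_sub //.
  by rewrite (monicP cheb_sub_monic) rmorph1 oner_eq0.
- apply/allP=> _ /mapP[w + ->]; rewrite mem_unity_root_seq => /eqP.
  exact: cheb_rootP.
by rewrite uniq_rootsE uniq_cheb_roots.
Qed.

Lemma cheb_sub_rootP (x : L) : root (map_poly intr (cheb q - j%:P)) x ->
  exists2 w, w ^+ q = 1 & x = A w.
Proof.
rewrite cheb_sub_prod -(big_map A xpredT (fun a => 'X - a%:P)) root_prod_XsubC.
by case/mapP=> w; rewrite mem_unity_root_seq => /eqP w1 ->; exists w.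
Qed.

(** The left-hand side shows that the right-hand side is an integer of the splitting field, even
    where h itself is not in that field. *)
Lemma cheb_root_mulV (w h : L) : w ^+ q = 1 -> h ^+ q = 1 ->
  A w ^+ 2 - A (w * h) * A (w * h^-1) = - (h - h^-1) ^+ 2.
Proof.
move=> /unity_root_neq0 nzw /unity_root_neq0 nzh; rewrite /A; field.
by rewrite nzw nz_y nzh.
Qed.

Lemma unity_root_expr (w : L) : w ^+ q = 1 -> exists i, w = zeta ^+ i.
Proof. by move=> /(prim_rootP prim)[i ->]; exists i. Qed.

Definition twist_theta : L := (zeta - zeta^-1) * delta.

Section Automorphism.
Variable g : {rmorphism L -> L}.

Lemma aut_delta : g delta = delta \/ g delta = - delta.
Proof.
have d2 : delta ^+ 2 = j%:~R ^+ 2 - 4.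
  by rewrite -yD -yB; field; rewrite ?two_neq0 ?expf_neq0.
have: g delta ^+ 2 = delta ^+ 2 by rewrite -rmorphXn d2 rmorphB rmorphXn rmorph_int rmorph_nat.
by move/eqP; rewrite eqf_sqr => /orP[] /eqP; [left | right].
Qed.

(** y^q and y^-q are (j + delta) / 2 and (j - delta) / 2, so g fixes or exchanges them according to
    its sign on delta. *)
Lemma aut_y : (g delta = delta -> exists2 v, v ^+ q = 1 & g y = v * y) /\
  (g delta = - delta -> exists2 v, v ^+ q = 1 & g y = v * y^-1).
Proof.
have [yq yqV] := yq_half; have gyq : g y ^+ q = (j%:~R + g delta) / 2.
  by rewrite -rmorphXn yq fmorph_div rmorphD rmorph_int rmorph_nat.
split=> gd; rewrite gd in gyq.
  exists (g y / y); last by rewrite divfK.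
  by rewrite expr_div_n gyq -yq divff // expf_neq0.
exists (g y * y); last by rewrite mulfK.
by rewrite exprMn gyq -yqV mulVf // expf_neq0.
Qed.

(** From a - 1/a = b - 1/b follows a = b or a = -1/b; the second is impossible for roots of unity of
    odd order. *)
Lemma aut_theta : g twist_theta = twist_theta ->
  (g zeta = zeta /\ g delta = delta) \/ (g zeta = zeta^-1 /\ g delta = - delta).
Proof.
have nzz := unity_root_neq0 zetaq; have gz1 : g zeta ^+ q = 1 by rewrite -rmorphXn zetaq rmorph1.
have nzgz := unity_root_neq0 gz1.
rewrite /twist_theta rmorphM rmorphB fmorphV => th.
have [gd|gd] := aut_delta; rewrite gd in th *.
  left; split=> //; have /subrV_inj[//|//|//|gz] := mulIf nz_delta th.
  by case: (unity_root_neqN gz1 (unity_rootV zetaq) gz).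
right; split=> //; rewrite mulrN -mulNr in th; have {}th := mulIf nz_delta th.
have E : (g zeta)^-1 - ((g zeta)^-1)^-1 = zeta - zeta^-1 by rewrite invrK -th opprB.
have [||gz|gz] := subrV_inj _ _ E; rewrite ?invr_eq0 //.
  by apply: invr_inj; rewrite gz invrK.
case: (unity_root_neqN (unity_rootV gz1) (unity_rootV zetaq) gz).
Qed.

Lemma aut_unity_root e (w : L) : g zeta = zeta ^ e -> w ^+ q = 1 -> g w = w ^ e.
Proof.
move=> gz /unity_root_expr[i ->]; rewrite rmorphXn gz.
by rewrite !exprnP !exprz_exp mulrC.
Qed.

Lemma aut_cheb_root : g twist_theta = twist_theta ->
  exists2 v, v ^+ q = 1 & forall w, w ^+ q = 1 -> g (A w) = A (w * v).
Proof.
case/aut_theta=> [[gz gd]|[gz gd]].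
  have [v v1 gy] := aut_y.1 gd; exists v => // w w1.
  have gw : g w = w by rewrite (@aut_unity_root 1) ?expr1z.
  by rewrite /A rmorphD fmorphV rmorphM gw gy mulrA.
have [v v1 gy] := aut_y.2 gd; exists v^-1 => [|w w1]; first exact: unity_rootV.
have gw : g w = w^-1 by rewrite (@aut_unity_root (-1)) ?exprN1.
rewrite /A rmorphD fmorphV rmorphM gw gy addrC.
by congr (_ + _); rewrite !invfM !invrK ?mulrA // mulrAC.
Qed.

(** Fixing A(1) leaves g y = y or 1/y, and fixing A(zeta) then decides g zeta. This is how F_j is
    seen to lie in the splitting field. *)
Lemma aut_fix_cheb_root : (forall w, w ^+ q = 1 -> g (A w) = A w) ->
  (g zeta = zeta /\ g delta = delta) \/ (g zeta = zeta^-1 /\ g delta = - delta).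
Proof.
move=> gA; have g1 : (1 : L) ^+ q = 1 by rewrite expr1n.
have gz1 : g zeta ^+ q = 1 by rewrite -rmorphXn zetaq rmorph1.
have nzz := unity_root_neq0 zetaq; have nzgz := unity_root_neq0 gz1.
have nzgy : g y != 0 by rewrite fmorph_eq0.
have := gA 1 g1; have := gA zeta zetaq.
rewrite /A !rmorphD !fmorphV !rmorphM !rmorph1 !mul1r => gAz.
have gdE : g delta = g y ^+ q - g y ^- q by rewrite -yB rmorphB fmorphV !rmorphXn.
case/addrV_inj=> // gy; rewrite gdE; rewrite gy in gAz *.
  left; rewrite yB; split=> //.
  have /addrV_inj[||/(mulIf nz_y)//|] := gAz; rewrite ?mulf_neq0 // => gz.
  case: (unity_root_y2 (unity_rootM gz1 zetaq)).
  have: g zeta * y * (zeta * y) = 1 by rewrite gz mulVf // mulf_neq0.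
  by rewrite mulrACA expr2.
right; rewrite exprVn invrK -yB opprB; split=> //.
have /addrV_inj[|||] := gAz; rewrite ?mulf_neq0 ?invr_eq0 // => gz; last first.
  by move: gz; rewrite invfM => /mulIf-> //; rewrite invr_eq0.
case: (unity_root_y2 (unity_rootM zetaq (unity_rootV gz1))).
rewrite mulrAC expr2 mulrA -gz mulfVK // divff //.
Qed.

End Automorphism.
End ChebyshevRoots.

(** * The twist *)

(** The unit group is the automorphism group of a cyclic group of order p^k, whose structure is
    known for odd p. *)
Lemma units_Zp_odd_pfactor_cyclic (p k : nat) : prime p -> odd p -> (0 < k)%N ->
  cyclic (units_Zp (p ^ k)).
Proof.
move=> p_pr p_odd k_gt0; have q_gt1 : (1 < p ^ k)%N.
  by rewrite -(exp1n k) ltn_exp2r // prime_gt1.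
have oq : #[Zp1 : 'Z_(p ^ k)]%g = (p ^ k)%N by rewrite order_Zp1 Zp_cast.
have : isog (units_Zp (p ^ k)) (Aut <[Zp1 : 'Z_(p ^ k)]>).
  by have := Zp_unit_isog (Zp1 : 'Z_(p ^ k)); rewrite oq.
move/isog_cyclic ->.
have [|||m [_ [_ cF _ _]]] := @cyclic_pgroup_Aut_structure _ p <[Zp1 : 'Z_(p ^ k)]>%G.
- by rewrite /pgroup -orderE oq pnatX pnat_id.
- exact: cycle_cyclic.
- by rewrite -cardG_gt1 -orderE oq.
by case: eqP => [_ AF|_ [t [_ _ _]]]; [move: cF; rewrite -AF | rewrite p_odd => -[[]]].
Qed.

(** A multiplicative map with f 1 = 1 takes unit values, so G / H embeds in the cyclic unit group.
    It is applied to chi eps and to chi alone. *)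
Lemma Zp_character (p k : nat) (gT : finGroupType) (G : {group gT}) (f : gT -> 'Z_(p ^ k)) :
  prime p -> odd p -> (0 < k)%N -> f 1%g = 1 ->
  {in G &, {morph f : x y / (x * y)%g >-> x * y}} ->
  exists H : {group gT}, [/\ H = [set x in G | f x == 1] :> {set gT}, (H <| G)%g,
    cyclic (G / H)%g & (#|G : H|%g <= totient (p ^ k))%N].
Proof.
move=> p_pr p_odd k_gt0 f1 fM; have q_gt0 : (0 < p ^ k)%N by rewrite expn_gt0 prime_gt0.
have q_gt1 : (1 < p ^ k)%N by rewrite -(exp1n k) ltn_exp2r // prime_gt1.
have fU x : x \in G -> f x \is a GRing.unit.
  by move=> Gx; apply/unitrPr; exists (f x^-1)%g; rewrite -fM ?groupV // mulgV.
pose h x : {unit 'Z_(p ^ k)} := insubd (1%g : {unit 'Z_(p ^ k)}) (f x).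
have hE x : x \in G -> val (h x) = f x by move=> /fU fx; rewrite val_insubd fx.
have hM : {in G &, {morph h : x y / (x * y)%g >-> (x * y)%g}}.
  by move=> x y Gx Gy; apply: val_inj; rewrite hE ?groupM // fM //= !hE.
pose phi := Morphism hM.
have kerE : ('ker phi)%g = [set x in G | f x == 1] :> {set gT}.
  apply/setP=> x; rewrite [in RHS]inE; have [Gx|nGx] /= := boolP (x \in G); last first.
    by apply/negbTE; apply: contra nGx => /dom_ker.
  apply/kerP/eqP => // [/(congr1 val)|fx]; first by rewrite /= hE.
  by apply: val_inj; rewrite /= hE.
exists ('ker phi)%G; split; [exact: kerE | | |].
- exact: ker_normal.
- rewrite (isog_cyclic (first_isog phi)); apply: cyclicS (units_Zp_odd_pfactor_cyclic p_pr p_odd k_gt0).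
  by apply/subsetP=> u _; rewrite /units_Zp inE.
rewrite -card_quotient ?ker_norm // (card_isog (first_isog phi)) -card_units_Zp //.
by apply: subset_leq_card; apply/subsetP=> u _; rewrite /units_Zp inE.
Qed.

(** * Powers of zeta with exponents in Z/q *)

Section ZpExponents.
Variables (L : fieldType) (q : nat) (zeta : L).
Hypotheses (q_gt1 : (1 < q)%N) (prim : q.-primitive_root zeta).

Let primT : (Zp_trunc q).+2.-primitive_root zeta.
Proof. by rewrite Zp_cast. Qed.

Lemma expr_Zp_inj (a b : 'Z_q) : zeta ^+ a = zeta ^+ b -> a = b.
Proof.
move/eqP; rewrite (eq_prim_root_expr prim) => /eqP ab; apply: val_inj.
have ltq (c : 'Z_q) : (c < q)%N by rewrite -[X in (_ < X)%N](Zp_cast q_gt1).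
by move: ab; rewrite !modn_small.
Qed.

Lemma expr_ZpM (a b : 'Z_q) : zeta ^+ (a * b)%R = (zeta ^+ a) ^+ b.
Proof.
by rewrite -exprM /= (prim_expr_mod primT).
Qed.

Lemma expr_Zp1 : zeta ^+ (1%R : 'Z_q) = zeta.
Proof. by rewrite /= Zp_cast // modn_small. Qed.

Lemma expr_ZpN1 : zeta ^+ ((-1)%R : 'Z_q) = zeta^-1.
Proof.
have nzz : zeta != 0 by apply: contra_eq_neq (prim_expr_order prim) => ->;
  rewrite expr0n gtn_eqF ?(ltnW q_gt1) // eq_sym oner_eq0.
have: zeta ^+ ((-1 + 1)%R : 'Z_q) = 1 by rewrite addNr.
rewrite /= (prim_expr_mod primT) exprD => /(canRL (mulfK _)).
by rewrite expr_Zp1 => ->; rewrite ?mul1r.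
Qed.

Lemma expr_Zp_ex (x : L) : x ^+ q = 1 -> exists a : 'Z_q, x = zeta ^+ a.
Proof.
move/(prim_rootP prim) => [i ->]; exists (inZp i).
by rewrite /= (prim_expr_mod primT).
Qed.
End ZpExponents.

Section TwistField.
Variables (L : splittingFieldType rat) (q : nat) (zeta delta : L).
Hypotheses (q_gt1 : (1 < q)%N) (prim : q.-primitive_root zeta).
Hypothesis (delta2 : delta ^+ 2 \in 1%VS).
Local Notation A := (twist_ambient zeta delta).
Local Notation chi := (@cyclotomic_char rat L q zeta delta).
Local Notation eps := (@sign_char rat L q zeta delta).

Lemma zeta_ambient : zeta \in A.
Proof. by apply: seqv_sub_adjoin; rewrite mem_head. Qed.

Lemma delta_ambient : delta \in A.
Proof. by apply: seqv_sub_adjoin; rewrite !inE eqxx orbT. Qed.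

Lemma aut_pm_delta (g : 'AEnd(L)) : g delta = delta \/ g delta = - delta.
Proof.
have : g delta ^+ 2 = delta ^+ 2.
  by have /vlineP[c cE] := delta2; rewrite -rmorphXn cE /= linearZ rmorph1.
by move/eqP; rewrite eqf_sqr => /orP[] /eqP; [left | right].
Qed.

Lemma aut_zeta (g : 'AEnd(L)) : exists a : 'Z_q, g zeta = zeta ^+ a.
Proof. by apply: expr_Zp_ex => //; rewrite -rmorphXn (prim_expr_order prim) rmorph1. Qed.

Lemma cyclotomic_charP (g : gal_of A) : g zeta = zeta ^+ chi g.
Proof.
rewrite /cyclotomic_char; case: pickP => [a /eqP //|no].
by have [a ga] := aut_zeta g; have := no a; rewrite ga eqxx.
Qed.

Lemma sign_charP (g : gal_of A) :
  (g delta = delta /\ eps g = 1) \/ (g delta = - delta /\ g delta <> delta /\ eps g = -1).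
Proof.
rewrite /sign_char; case: eqP => [gd|nd]; first by left.
by right; split=> //; case: (aut_pm_delta g).
Qed.

Lemma cyclotomic_charM (g h : gal_of A) : chi (g * h)%g = chi g * chi h.
Proof.
apply: (expr_Zp_inj q_gt1 prim); rewrite -cyclotomic_charP galM ?zeta_ambient //.
by rewrite (cyclotomic_charP g) rmorphXn mulrC (expr_ZpM q_gt1 prim) -(cyclotomic_charP h).
Qed.

Lemma sign_charM (g h : gal_of A) : eps (g * h)%g = eps g * eps h.
Proof.
have gh : (g * h)%g delta = h (g delta) by rewrite galM ?delta_ambient.
case: (sign_charP g) => [[gd ->]|[gd [ngd ->]]]; rewrite gd in gh.
  by rewrite mul1r /sign_char gh.
case: (sign_charP h) => [[hd ->]|[hd [nhd ->]]]; rewrite rmorphN /= hd in gh.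
  by rewrite /sign_char gh mulr1 ifN //; apply/eqP; rewrite -gd.
by rewrite /sign_char gh opprK eqxx mulrNN mulr1.
Qed.

Definition twist_char (g : gal_of A) : 'Z_q := chi g * eps g.

Lemma twist_charM (g h : gal_of A) : twist_char (g * h)%g = twist_char g * twist_char h.
Proof. by rewrite /twist_char cyclotomic_charM sign_charM mulrACA. Qed.

Lemma twist_char1 : twist_char 1%g = 1.
Proof.
rewrite /twist_char /sign_char gal_id eqxx mulr1.
by apply: (expr_Zp_inj q_gt1 prim); rewrite -cyclotomic_charP gal_id expr_Zp1.
Qed.

Lemma twist_char_eq1 (g : gal_of A) : twist_char g = 1 ->
  (g zeta = zeta /\ g delta = delta) \/ (g zeta = zeta^-1 /\ g delta = - delta).
Proof.
rewrite /twist_char cyclotomic_charP.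
case: (sign_charP g) => [[gd ->]|[gd [_ ->]]]; rewrite gd.
  by rewrite mulr1 => ->; left; rewrite expr_Zp1.
rewrite mulrN1 => /(canRL (@opprK _)) ->; right.
by rewrite (expr_ZpN1 q_gt1 prim).
Qed.

Lemma twist_theta_field : (zeta - zeta^-1) * delta \in twist_field q zeta delta.
Proof.
apply/fixedFieldP => [|g].
  by rewrite rpredM ?delta_ambient // rpredB ?rpredV ?zeta_ambient.
rewrite inE => /andP[_ /eqP /twist_char_eq1].
rewrite rmorphM rmorphB fmorphV /= => -[[-> ->]//|[-> ->]].
by rewrite invrK mulrN -mulNr opprB.
Qed.

Lemma limg_ambient (g : 'AEnd(L)) : (g @: A <= A)%VS.
Proof.
rewrite aimg_adjoin_seq; apply/Fadjoin_seqP; split=> [|x].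
  by apply/subvP=> _ /memv_imgP[x /vlineP[c ->] ->]; rewrite linearZ rmorph1 rpredZ ?rpred1.
rewrite !inE => /orP[] /eqP->.
  by have [a ->] := aut_zeta g; rewrite rpredX ?zeta_ambient.
by have [->|->] := aut_pm_delta g; rewrite ?rpredN delta_ambient.
Qed.

(** A converse to [twist_char_eq1], for automorphisms of all of L: their restriction to the ambient
    field lies in the kernel of chi eps. With delta nonzero, -delta is really seen by the sign
    character. *)
Lemma twist_field_fix (g : 'AEnd(L)) : delta != 0 ->
  (g zeta = zeta /\ g delta = delta) \/ (g zeta = zeta^-1 /\ g delta = - delta) ->
  forall x, x \in twist_field q zeta delta -> g x = x.
Proof.
move=> nzd gE x /mem_fixedFieldP[Ax /(_ (gal A g)) gx].
have gK := galK (limg_ambient g).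
rewrite -{1}(gK x Ax) gx // inE; apply/andP; split.
  by rewrite gal_kHom ?sub1v // k1AHom.
have gz : gal A g zeta = g zeta by rewrite gK ?zeta_ambient.
have gd : gal A g delta = g delta by rewrite gK ?delta_ambient.
have n2 : 2%:R != 0 :> L by rewrite natr_ext_eq0.
case: gE => -[gzE gdE].
  rewrite /sign_char gd gdE eqxx mulr1; apply/eqP; apply: (expr_Zp_inj q_gt1 prim).
  by rewrite -cyclotomic_charP gz gzE expr_Zp1.
rewrite /sign_char gd gdE ifN; last first.
  by rewrite eq_sym -addr_eq0 -mulr2n -mulr_natl mulf_neq0.
rewrite mulrN1 eqr_oppLR; apply/eqP/(expr_Zp_inj q_gt1 prim).
by rewrite -cyclotomic_charP gz gzE (expr_ZpN1 q_gt1 prim).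
Qed.

Lemma galois_rat (E : {subfield L}) : normalField 1 E -> galois 1 E.
Proof.
move=> nE; rewrite /galois sub1v nE andbT; apply/separableP=> x _.
by apply: pcharf0_separable => n; rewrite pchar_lalg pchar_num.
Qed.

Lemma normalField_ambient : normalField 1 A.
Proof.
apply/forall_inP=> g _.
rewrite eqEdim limg_dim_eq ?(eqP (AEnd_lker0 _)) ?capv0 // leqnn andbT.
exact: limg_ambient.
Qed.

Lemma twist_char_trivial (g : gal_of A) : g zeta = zeta -> g delta = delta -> g = 1%g.
Proof.
move=> gz gd; have : (A <= fixedSpace g)%VS.
  pose B := [aspace of fixedSpace g]; change (A <= B)%VS.
  apply/Fadjoin_seqP; split=> [|x]; first exact: sub1v.
  by rewrite !inE => /orP[] /eqP->; apply/fixedSpaceP.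
move=> /subvP Afix; apply/eqP/gal_eqP => x /Afix /fixedSpaceP ->.
by rewrite gal_id.
Qed.

End TwistField.

(** * The thin set *)

Lemma fraction_numden (R : idomainType) (x : {fraction R}) :
  exists n d : R, d != 0 /\ x * FracField.tofrac d = FracField.tofrac n.
Proof.
elim/quotW: x => x; exists (frac x).1, (frac x).2; split; first exact: denom_ratioP.
rewrite -[_ * _]/(FracField.mul _ _) !piE; apply/eqmodP => /=.
rewrite FracField.equivfE /FracField.mulf !numden_Ratio ?mulf_neq0 ?oner_eq0 ?denom_ratioP //.
by rewrite !mulr1 mulrC.
Qed.

(** The multiplicity of the root 2 is even on the left and odd on the right. Thus (X^2 - 4) / c is
    not a square in Q(X). *)
Lemma conic_no_root (c : rat) (a b : {poly rat}) : c != 0 -> b != 0 ->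
  c%:P * a ^+ 2 <> ('X ^+ 2 - 4%:P) * b ^+ 2.
Proof.
move=> nzc nzb eqab.
have X24 : 'X ^+ 2 - 4%:P = ('X - 2%:P) * ('X - (-2)%:P) :> {poly rat}.
  by rewrite !polyCN; ring.
have nza : a != 0.
  apply: contra_neq nzb => a0; apply/eqP; rewrite -sqrf_eq0.
  move/esym/eqP: eqab; rewrite a0 expr0n mulr0 mulf_eq0 X24 mulf_eq0 !polyXsubC_eq0 //.
have nzc' : c%:P != 0 :> {poly rat} by rewrite polyC_eq0.
have nzX (e : rat) : 'X - e%:P != 0 by rewrite polyXsubC_eq0.
have := congr1 (mup 2) eqab.
rewrite X24 expr2 expr2 !mupM ?mulf_neq0 //.
rewrite [mup 2 ('X - (-2)%:P)]mupNroot; last by rewrite root_XsubC.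
rewrite [mup 2 c%:P]mupNroot; last by rewrite rootC.
have := mup_XsubCX 1 2 (2 : rat); rewrite expr1 eqxx => ->.
lia.
Qed.

Lemma thin_conic (c : rat) : c != 0 ->
  thin (fun t : rat => exists s : rat, t ^+ 2 - 4 = c * s ^+ 2).
Proof.
move=> nzc; pose f : {poly {poly rat}} := c%:P *: 'X ^+ 2 - ('X ^+ 2 - 4%:P)%:P.
have nzc' : c%:P != 0 :> {poly rat} by rewrite polyC_eq0.
have szc : size (c%:P *: 'X ^+ 2 : {poly {poly rat}}) = 3%N.
  by rewrite size_scale // size_polyXn.
have szf : size f = 3%N.
  by rewrite size_polyDl szc // size_polyN (leq_ltn_trans (size_polyC_leq1 _)).
exists [::], [:: f]; split=> [g|t [s ts]]; last first.
  right; exists f; rewrite ?mem_head //; exists s.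
  by rewrite /f !(hornerE, hornerXn, hornerZ) /= ts; ring.
rewrite inE => /eqP->; split; last by rewrite szf.
have injF : injective (@FracField.tofrac {poly rat}) by move=> a b /eqP; rewrite tofrac_eq => /eqP.
apply: cubic_irreducible; first by rewrite size_map_inj_poly ?rmorph0 ?szf.
move=> x; apply/negP => /rootP fx.
have [n [d [nzd xd]]] := fraction_numden x.
have [] := @conic_no_root c n d nzc nzd.
apply: injF; rewrite [in LHS]rmorphM [in LHS]rmorphXn [in RHS]rmorphM [X in _ = _ * X]rmorphXn /= -xd.
move: fx; rewrite /f rmorphB /= map_polyZ /= map_polyXn map_polyC /=.
rewrite hornerD hornerN hornerZ hornerXn hornerC => /eqP; rewrite subr_eq0 => /eqP fx.
by rewrite exprMn mulrA fx.
Qed.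

(** The irreducibility of the cyclotomic polynomial is carried over from the complex numbers to the
    abstract field L. *)
Lemma minPoly_Cyclotomic (L : fieldExtType rat) (n : nat) (zeta : L) :
  n.-primitive_root zeta -> minPoly 1 zeta = map_poly (in_alg L) (map_poly intr 'Phi_n).
Proof.
move=> prim; have n_gt0 := prim_order_gt0 prim.
have [r rE] := elimT polyOver1P (minPolyOver 1 zeta).
have mapQ (f : {poly int}) : map_poly (in_alg L) (map_poly intr f) = map_poly intr f.
  by rewrite -map_poly_comp; apply: eq_map_poly => c /=; rewrite scaler_int.
have Xn1 (R : nzRingType) : map_poly intr ('X^n - 1 : {poly int}) = 'X^n - 1 :> {poly R}.
  by rewrite rmorphB rmorph1 /= map_polyXn.
have rootPhi : root (map_poly intr 'Phi_n) zeta.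
  have: root (map_poly intr (\prod_(d <- divisors n) 'Phi_d)) zeta.
    by rewrite prod_Cyclotomic // Xn1 rootE !hornerE prim_expr_order // subrr.
  rewrite rmorph_prod rootE horner_prod prodf_seq_eq0 => /hasP[d].
  rewrite -dvdn_divisors // => dn /= Pd; suff dE : d = n by rewrite -dE rootE.
  have d_gt0 := dvdn_gt0 n_gt0 dn.
  apply/eqP; rewrite eqn_dvd dn (prim_order_dvd prim).
  have: root (map_poly intr (\prod_(e <- divisors d) 'Phi_e)) zeta.
    rewrite rmorph_prod rootE horner_prod prodf_seq_eq0; apply/hasP.
    by exists d; rewrite // -dvdn_divisors.
  rewrite prod_Cyclotomic // rmorphB rmorph1 /= map_polyXn rootE !hornerE subr_eq0.
  by [].
have dvr : r %| map_poly intr 'Phi_n.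
  rewrite -(dvdp_map (in_alg L)) -rE mapQ; apply: minPoly_dvdp => //.
  by apply/polyOver1P; exists (map_poly intr 'Phi_n); rewrite mapQ.
have mon_r : r \is monic by have := monic_minPoly 1 zeta; rewrite rE map_monic.
rewrite rE; congr (map_poly _ _); apply/eqP.
rewrite -eqp_monic ?monic_map ?Cyclotomic_monic // /eqp dvr /=.
(* A complex root z of the minimal polynomial r is a primitive n-th root of unity, so its minimal
   polynomial, which divides r, is the full cyclotomic polynomial. *)
have [z rz] : exists z : algC, root (map_poly ratr r) z.
  apply/closed_rootP; rewrite size_map_poly.
  have := size_minPoly 1 zeta; rewrite rE size_map_poly => ->; rewrite eqSS.
  exact: isT.
have [z0 prim0] := C_prim_root_exists n_gt0.
have mapC : map_poly ratr (map_poly intr 'Phi_n : {poly rat}) = cyclotomic z0 n :> {poly algC}.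
  rewrite -(Cintr_Cyclotomic prim0) -map_poly_comp.
  by apply: eq_map_poly => c /=; rewrite rmorph_int.
have primz : n.-primitive_root z.
  rewrite -(root_cyclotomic prim0) -mapC; move: rz; apply: root_dvdp.
  by rewrite dvdp_map.
have [m [mE mon_m] mP] := minCpolyP z.
suff <- : m = map_poly intr 'Phi_n by rewrite -mP.
apply: (map_poly_inj (ratr : {rmorphism rat -> algC})); rewrite -mE mapC.
by rewrite (minCpoly_cyclotomic primz) -(Cintr_Cyclotomic primz) -(Cintr_Cyclotomic prim0).
Qed.

Lemma dim_cyclotomic (L : fieldExtType rat) (n : nat) (zeta : L) :
  n.-primitive_root zeta -> \dim <<1; zeta>> = totient n.
Proof.
move=> prim; rewrite dim_Fadjoin dimv1 muln1; apply: succn_inj.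
rewrite -size_minPoly (minPoly_Cyclotomic prim) size_map_poly.
by rewrite size_map_inj_poly ?size_Cyclotomic //; apply: intr_inj.
Qed.

Lemma root_Cyclotomic_dvdp (L : fieldExtType rat) (n : nat) (zeta : L) (f : {poly rat}) :
  n.-primitive_root zeta ->
  root (map_poly (in_alg L) f) zeta = (map_poly intr 'Phi_n %| f).
Proof.
move=> prim; rewrite -(dvdp_map (in_alg L)) -(minPoly_Cyclotomic prim).
apply/idP/idP => [|dv]; last by move: (root_minPoly 1 zeta); apply: root_dvdp.
by apply: minPoly_dvdp; apply/polyOver1P; exists f.
Qed.

Lemma aut_fix_adjoin (L : splittingFieldType rat) (g : 'AEnd(L)) (x y : L) :
  g x = x -> y \in <<1; x>>%VS -> g y = y.
Proof.
move=> gx /Fadjoin_polyP[f /polyOver1P[r ->] ->].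
rewrite -horner_map /= gx -map_poly_comp; congr (_.[_]).
by apply: eq_map_poly => a /=; rewrite linearZ /= rmorph1.
Qed.

(** * The degree of the specialized twist *)

Section TwistDegree.
Variables (L : splittingFieldType rat) (p k : nat) (zeta delta : L).
Hypotheses (p_pr : prime p) (p_odd : odd p) (k_gt0 : (0 < k)%N).
Local Notation q := (p ^ k)%N.
Hypotheses (prim : q.-primitive_root zeta) (delta2 : delta ^+ 2 \in 1%VS).
Local Notation A := (twist_ambient zeta delta).

Let q_gt1 : (1 < q)%N. Proof. by rewrite -(exp1n k) ltn_exp2r // prime_gt1. Qed.

Lemma twist_gal_eq (g h : gal_of A) : g zeta = h zeta -> g delta = h delta -> g = h.
Proof.
move=> gz gd; apply/eqP; rewrite -(can_eq (mulgK h^-1%g)) mulgV; apply/eqP.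
have hV x : x \in A -> g x = h x -> (g * h^-1)%g x = x.
  by move=> Ax gx; rewrite galM // gx -galM // mulgV gal_id.
apply: twist_char_trivial; apply: hV => //.
  exact: zeta_ambient.
exact: delta_ambient.
Qed.

(** The degree is the index of H = ker (chi eps). An element of H that fixes delta is trivial. So
    for rational delta H is trivial, and the ambient field contains Q(zeta). For delta outside
    Q(zeta) H has at most two elements, while the ambient field has degree at least 2 phi(q). *)
Lemma twist_field_cyclic_degree :
  (cyclic_extension 1%AS (twist_field q zeta delta) /\
   (\dim (twist_field q zeta delta) <= totient q)%N) /\
  (delta \in 1%VS \/ delta \notin <<1; zeta>>%VS ->
   (totient q <= \dim (twist_field q zeta delta))%N).
Proof.
have galA : galois 1 A := galois_rat (normalField_ambient q_gt1 prim delta2).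
have [H [HE nsH cycH idxH]] := @Zp_character p k _ 'Gal(A / 1)%G (@twist_char _ q zeta delta)
  p_pr p_odd k_gt0 (twist_char1 delta q_gt1 prim) (in2W (twist_charM q_gt1 prim delta2)).
set F := twist_field q zeta delta.
have FE : F = fixedField H :> {vspace L} by rewrite HE.
have galF : galois 1 F by rewrite FE; apply: normal_fixedField_galois.
have sFA : (1 <= F <= A)%VS by rewrite sub1v FE fixedField_bound.
have dimF : \dim F = #|'Gal(A / 1)%g : H|%g.
  by rewrite -(dim_fixed_galois galA (normal_sub nsH)) -FE dimv1 divn1.
split; [split; first split=> // | ].
- have /and3P[_ _ nF] := galF.
  rewrite -(isog_cyclic (normalField_isog galA sFA nF)).
  have -> : 'Gal(A / F)%g = H by rewrite FE gal_fixedField.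
  exact: cycH.
- by rewrite dimF.
have dimA : (#|H| * \dim F)%N = \dim A.
  by rewrite dimF Lagrange ?normal_sub // -(galois_dim galA) dimv1 divn1.
have sub_zA : (<<1; zeta>> <= A)%VS by rewrite sub_adjoin1v zeta_ambient.
have H1 g : g \in H -> delta != 0 -> g delta = delta -> g = 1%g.
  rewrite HE inE => /andP[_ /eqP /(twist_char_eq1 q_gt1 prim delta2) gE] nzd gd.
  case: gE => -[gz gd']; first exact: twist_char_trivial.
  case/eqP: nzd; have := gd'; rewrite gd => /eqP.
  by rewrite -addr_eq0 -mulr2n -mulr_natl mulf_eq0 natr_ext_eq0 => /eqP.
(* The sign character is trivial here, so chi g = 1. *)
have H2 g : g \in H -> delta = 0 -> g = 1%g.
  rewrite HE inE => /andP[_ /eqP]; rewrite /twist_char /sign_char => + d0.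
  have gd : g delta = delta by have [//|->] := aut_pm_delta delta2 g; rewrite d0 oppr0.
  rewrite gd eqxx mulr1 => chi1; apply: twist_char_trivial => //.
  by rewrite (cyclotomic_charP q_gt1 prim) chi1 expr_Zp1.
have fix1 (g : 'AEnd(L)) x : x \in 1%VS -> g x = x.
  by case/vlineP=> c ->; rewrite linearZ /= rmorph1.
case=> [d1|dz].
  have /trivgP H1' : (H \subset [1])%g.
    apply/subsetP=> g gH; rewrite inE; apply/eqP; have [d0|nzd] := eqVneq delta 0.
      exact: H2.
    by apply: H1 => //; apply: fix1.
  have H_1 : #|H| = 1%N by rewrite H1' cards1.
  by move: dimA; rewrite H_1 mul1n => ->; rewrite -(dim_cyclotomic prim) dimvS.
have nzd : delta != 0 by apply: contraNneq dz => ->; apply: mem0v.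
have leH : (#|H| <= 2)%N.
  rewrite -card_bool; pose b (g : gal_of A) := g delta == delta.
  rewrite -(card_in_imset (f := b) (D := H)); first exact: max_card.
  move=> g h gH hH; rewrite /b; move: (gH) (hH); rewrite HE !inE.
  move=> /andP[_ /eqP /(twist_char_eq1 q_gt1 prim delta2) gE].
  move=> /andP[_ /eqP /(twist_char_eq1 q_gt1 prim delta2) hE].
  have [gd|ngd] := eqVneq (g delta) delta; have [hd|nhd] := eqVneq (h delta) delta => // _.
    by rewrite (H1 g) // (H1 h).
  case: gE => -[gz gd]; first by rewrite gd eqxx in ngd.
  case: hE => -[hz hd]; first by rewrite hd eqxx in nhd.
  by apply: twist_gal_eq; rewrite ?gz ?hz ?gd ?hd.
have : (totient q * 2 <= \dim A)%N.
  rewrite -(dim_cyclotomic prim).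
  have /dvdnP[m dA] : (\dim <<1; zeta>> %| \dim A)%N by apply: field_dimS.
  rewrite dA mulnC leq_mul2r; apply/orP; right; rewrite ltnNge; apply/negP => m1.
  case/negP: dz; have -> : (<<1; zeta>> = A :> {vspace L})%VS.
    apply/eqP; rewrite eqEdim sub_zA dA -[leqRHS]mul1n leq_mul2r m1 orbT //.
  exact: delta_ambient.
move=> dA; rewrite -(@leq_pmul2r 2) //; apply: leq_trans dA _.
by rewrite -dimA mulnC leq_mul2l leH orbT.
Qed.

(** A generator of the cyclic Galois group negates both delta and rho = h(zeta), so their quotient
    is rational: a cyclic extension has at most one quadratic subfield. The equation h(zeta)^2 = c
    is stated as a divisibility by the cyclotomic polynomial to make c independent of L and zeta. *)
Lemma twist_degenerate (c : rat) (h : {poly rat}) :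
  (forall s : rat, c != s ^+ 2) -> map_poly intr 'Phi_q %| h ^+ 2 - c%:P ->
  delta \notin 1%VS -> delta \in <<1; zeta>>%VS ->
  exists s : rat, delta ^+ 2 = (c * s ^+ 2)%:A.
Proof.
move=> nsq dvh nd1 dz.
have galA : galois 1 A := galois_rat (normalField_ambient q_gt1 prim delta2).
have ker1 (g : gal_of A) : g zeta = zeta -> g = 1%g.
  move=> gz; apply: twist_char_trivial => //.
  exact: aut_fix_adjoin gz dz.
have chi1 : cyclotomic_char q (1%g : gal_of A) = 1.
  by apply: (expr_Zp_inj q_gt1 prim); rewrite -(cyclotomic_charP q_gt1 prim) gal_id expr_Zp1.
have [H [HE nsH cycH _]] := @Zp_character p k _ 'Gal(A / 1)%G (@cyclotomic_char _ _ q zeta delta)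
  p_pr p_odd k_gt0 chi1 (in2W (cyclotomic_charM q_gt1 prim)).
have {cycH}/cyclicP[g gE] : cyclic 'Gal(A / 1)%g.
  have H1 : H = 1%G.
    apply/trivGP/subsetP=> g; rewrite HE !inE => /andP[_ /eqP chig]; apply/eqP/ker1.
    by rewrite (cyclotomic_charP q_gt1 prim) chig expr_Zp1.
  by rewrite H1 in cycH; rewrite (isog_cyclic (quotient1_isog _)).
have fix_g x : x \in A -> g x = x -> x \in 1%VS.
  move=> Ax gx; rewrite -(galois_fixedField galA); apply/fixedFieldP => // u.
  rewrite gE => /cycleP[n ->]; elim: n => [|n IH]; first by rewrite expg0 gal_id.
  by rewrite expgSr galM // IH.
have pm x : x \in A -> x ^+ 2 \in 1%VS -> x \notin 1%VS -> g x = - x.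
  move=> Ax /vlineP[a x2] nx; have : g x ^+ 2 = x ^+ 2.
    by rewrite -rmorphXn x2 /= linearZ rmorph1.
  by move/eqP; rewrite eqf_sqr => /orP[/eqP /(fix_g x Ax) x1|/eqP//]; rewrite x1 in nx.
have gd := pm delta (delta_ambient _ _) delta2 nd1.
pose rho := (map_poly (in_alg L) h).[zeta].
have Arho : rho \in A.
  apply: rpred_horner; last exact: zeta_ambient.
  by apply/polyOverP=> i; rewrite coef_map rpredZ ?rpred1.
have rho2 : rho ^+ 2 = c%:A.
  have : root (map_poly (in_alg L) (h ^+ 2 - c%:P)) zeta.
    by rewrite (root_Cyclotomic_dvdp _ prim).
  rewrite rmorphB rmorphXn /= map_polyC rootE !hornerE subr_eq0.
  by move/eqP.
have nrho : rho \notin 1%VS.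
  apply/negP => /vlineP[s rhoE]; case/negP: (nsq s); apply/eqP.
  apply: (fmorph_inj (in_alg L)); rewrite rmorphXn /=.
  by rewrite -rhoE rho2.
have grho : g rho = - rho by apply: pm => //; rewrite rho2 rpredZ ?rpred1.
have nzrho : rho != 0 by apply: contraNneq nrho => ->; apply: mem0v.
have /vlineP[s sE] : delta / rho \in 1%VS.
  apply: fix_g; first by rewrite rpred_div ?delta_ambient.
  by rewrite fmorph_div /= gd grho invrN mulrNN.
exists s; have -> : delta = s%:A * rho by rewrite -sE divfK.
by rewrite exprMn rho2 -(rmorphXn (in_alg L)) -(rmorphM (in_alg L)) mulrC.
Qed.

End TwistDegree.

(** T is fixed before L, zeta and j. It is empty if Q(zeta) has no quadratic subfield; otherwise it
    is the conic of one c, chosen by excluded middle. *)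
Lemma twist_thin_set (p k : nat) (p_pr : prime p) (p_odd : odd p) (k_gt0 : (0 < k)%N) :
  exists T : rat -> Prop, thin T /\
    forall (j : int) (L : splittingFieldType rat) (zeta delta : L),
      (p ^ k).-primitive_root zeta -> delta ^+ 2 = j%:~R ^+ 2 - 4%:R -> ~ T j%:~R ->
      cyclic_extension 1%AS (twist_field (p ^ k) zeta delta) /\
      \dim (twist_field (p ^ k) zeta delta) = totient (p ^ k).
Proof.
pose bad (c : rat) := exists h : {poly rat},
  (forall s : rat, c != s ^+ 2) /\ map_poly intr 'Phi_(p ^ k) %| h ^+ 2 - c%:P.
have [T [thinT TP]] : exists T : rat -> Prop, thin T /\
    ((exists c, bad c) -> exists2 c, bad c & forall t s, t ^+ 2 - 4 = c * s ^+ 2 -> T t).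
  have [[c cP]|no] := EM (exists c, bad c); last first.
    by exists (fun=> False); split=> // ; exists [::], [::]; split.
  exists (fun t => exists s, t ^+ 2 - 4 = c * s ^+ 2); split.
    apply: thin_conic; case: cP => h [/(_ 0)]; by rewrite expr0n.
  by move=> _; exists c => // t s ts; exists s.
exists T; split=> // j L zeta delta prim d2 nT.
have dQ : delta ^+ 2 = ((j%:~R ^+ 2 - 4) : rat)%:A.
  by rewrite d2 -[RHS]/(in_alg L _) rmorphB rmorphXn rmorph_int rmorph_nat.
have delta2 : delta ^+ 2 \in 1%VS by rewrite dQ rpredZ ?rpred1.
have [[cyc le1] ge] := twist_field_cyclic_degree p_pr p_odd k_gt0 prim delta2.
split=> //; apply/eqP; rewrite eqn_leq le1 /=; apply: ge.
have [d1|nd1] := boolP (delta \in 1%VS); first by left.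
have [dz|ndz] := boolP (delta \in <<1; zeta>>%VS); last by right.
case: nT; have [|c [h [nsq dvh]] cT] := TP.
  have /Fadjoin_polyP[f /polyOver1P[h ->] dE] := dz.
  (* In the degenerate case j^2 - 4 is itself a bad constant, the polynomial h expressing delta in
     terms of zeta. *)
  exists (j%:~R ^+ 2 - 4), h; split=> [s|].
    apply: contraNneq nd1 => sE; have : delta ^+ 2 = s%:A ^+ 2.
      by rewrite dQ sE -[LHS]/(in_alg L _) rmorphXn.
    by move/eqP; rewrite eqf_sqr => /orP[] /eqP->; rewrite ?rpredN rpredZ ?rpred1.
  rewrite -(root_Cyclotomic_dvdp _ prim) rmorphB rmorphXn /= map_polyC rootE !hornerE.
  by rewrite -dE dQ subrr.
have [s sE] := twist_degenerate p_pr p_odd k_gt0 prim delta2 nsq dvh nd1 dz.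
apply: (cT _ s); apply: (fmorph_inj (in_alg L)).
by rewrite -[LHS]/(_%:A) -dQ sE.
Qed.

(** * Irreducibility of C_q - j *)

(** What is wanted is U_n(c) nonzero for n > 0; strict growth is the form that passes through the
    recurrence. *)
Lemma chebU_growth (c : int) n : 2 <= `|c| -> `|(chebU n).[c]| < `|(chebU n.+1).[c]|.
Proof.
move=> c2; elim: n => [|n IHn]; first by rewrite !hornerE normr0 normr1.
rewrite chebUSS !(hornerD, hornerN, hornerM, hornerX).
apply: lt_le_trans (lerB_dist _ _); rewrite normrM.
move: IHn c2; set x := `|_|; set y := `|_|; set z := `|c|; have := normr_ge0 (chebU n.+1).[c].
rewrite -/y; nia.
Qed.

Lemma cheb_eq2 (c : int) n : (0 < n)%N -> 2 <= `|c| -> (cheb n).[c] = 2 -> c ^+ 2 = 4.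
Proof.
case: n => // n _ c2 Cc; have := congr1 (horner^~ c) (cheb_pell n.+1).
rewrite /= !(horner_exp, hornerD, hornerN, hornerM, hornerC, hornerX) Cc => pell.
have : (c ^+ 2 - 4) * (chebU n.+1).[c] ^+ 2 = 0.
  by rewrite -(subKr (2 ^+ 2) (_ * _)) pell.
move/eqP; rewrite mulf_eq0 sqrf_eq0 => /orP[|/eqP U0]; first by rewrite subr_eq0 => /eqP.
by have := chebU_growth n c2; rewrite U0 normr0 ltNge normr_ge0.
Qed.

Lemma odd_expr_eq1 (r : rat) n : odd n -> r ^+ n = 1 -> r = 1.
Proof.
move=> n_odd rn; have [r_ge0|r_lt0] := leP 0 r; last first.
  by have := exprn_odd_lt0 r n_odd; rewrite rn r_lt0.
by apply/eqP; rewrite -(pexpr_eq1 (odd_gt0 n_odd) r_ge0) rn.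
Qed.

Lemma monic_int_rat_root (f : {poly int}) (r : rat) :
  f \is monic -> root (map_poly intr f) r -> exists2 m : int, r = m%:~R & root f m.
Proof.
move=> mf fr; have : (ratr r : algC) \in Num.int.
  apply: Cint_rat_Aint; first exact: Crat_rat.
  apply: (@root_monic_Aint (map_poly intr f)); last 1 first.
  - by apply/polyOverP=> i; rewrite coef_map intr_int.
  - rewrite -(fmorph_root (ratr : {rmorphism rat -> algC})) -map_poly_comp in fr.
    by move: fr; congr (root _ _); apply: eq_map_poly => c /=; rewrite rmorph_int.
  by apply: monic_map.
case/intrP=> m rm; have {}rm : r = m%:~R.
  by apply: (fmorph_inj (ratr : {rmorphism rat -> algC})); rewrite /= rm rmorph_int.
exists m => //; move: fr; rewrite rm !rootE horner_map /= intr_eq0.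
by [].
Qed.

Section Irreducibility.
Variables (L : splittingFieldType rat) (p k : nat) (j : int) (zeta delta : L).
Hypotheses (p_pr : prime p) (p_odd : odd p) (k_gt0 : (0 < k)%N).
Local Notation q := (p ^ k)%N.
Hypotheses (prim : q.-primitive_root zeta).
Hypotheses (delta2 : delta ^+ 2 = j%:~R ^+ 2 - 4%:R) (j2 : 4 < j ^+ 2).
Hypothesis (notC : ~ (exists n : int, j = (cheb p).[n])).

Let q_odd : odd q. Proof. by rewrite oddX p_odd orbT. Qed.
Let q_gt1 : (1 < q)%N. Proof. by rewrite -(exp1n k) ltn_exp2r // prime_gt1. Qed.

Lemma delta2_rat : delta ^+ 2 = ((j%:~R ^+ 2 - 4) : rat)%:A.
Proof. by rewrite delta2 -[RHS]/(in_alg L _) rmorphB rmorphXn rmorph_int rmorph_nat. Qed.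

Lemma delta2_1 : delta ^+ 2 \in 1%VS.
Proof. by rewrite delta2_rat rpredZ ?rpred1. Qed.

Lemma delta_neq0 : delta != 0.
Proof.
rewrite -sqrf_eq0 delta2 -[4%:R]/(4%:~R) -rmorphXn -rmorphB intr_ext_eq0 subr_eq0.
by rewrite gt_eqF.
Qed.

Lemma delta_irrational : delta \notin 1%VS.
Proof.
apply/negP => /vlineP[s sE].
have s2 : s ^+ 2 = j%:~R ^+ 2 - 4.
  apply: (fmorph_inj (in_alg L)); rewrite rmorphXn /= -[s%:A]/(s *: 1) -sE.
  exact: delta2_rat.
have mon : ('X ^+ 2 - (j ^+ 2 - 4)%:P : {poly int}) \is monic by apply: monicXnsubC.
have [|m sm /rootP] := monic_int_rat_root mon (r := s).
  by rewrite rmorphB /= map_polyXn map_polyC rootE !hornerE s2 /= intrB rmorphXn subrr.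
rewrite !hornerE => /eqP; rewrite subr_eq0 => /eqP mj.
(* Squares of natural numbers a < b with b > 2 differ by at least 2b - 1 > 4. *)
have : `|m| ^+ 2 = `|j| ^+ 2 - 4 by rewrite !real_normK ?num_real.
have : 4 < `|j| ^+ 2 by rewrite real_normK ?num_real.
have := normr_ge0 m; have := normr_ge0 j; move: `|m| `|j| => a b.
rewrite !expr2 => b0 a0 b4 ab; have ltab : a < b by nia.
have : b <= 2 by nia.
nia.
Qed.

Lemma quadratic_conj : exists g : gal_of {:L}, g delta = - delta.
Proof.
apply: contrapT => no; case/negP: delta_irrational.
have galL : galois 1 {:L} by apply: galois_rat; apply: normalFieldf.
rewrite -(galois_fixedField galL); apply/fixedFieldP => [|g _]; first exact: memvf.
by have [//|gd] := aut_pm_delta delta2_1 g; case: no; exists g.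
Qed.

Lemma quadratic_coords x : x \in <<1; delta>>%VS -> exists a b : rat, x = a%:A + b%:A * delta.
Proof.
case/Fadjoin_polyP=> f /polyOver1P[r ->] ->.
elim/poly_ind: r => [|r c [a [b IH]]].
  by exists 0, 0; rewrite rmorph0 horner0 !scale0r mul0r addr0.
exists (b * (j%:~R ^+ 2 - 4) + c), a.
rewrite rmorphD rmorphM /= map_polyX map_polyC !hornerE IH.
by rewrite -[(_ + c)%:A]/(in_alg L _) rmorphD rmorphM /= -delta2_rat; ring.
Qed.

Lemma quadratic_norm (g : 'AEnd(L)) x : g delta = - delta -> x \in <<1; delta>>%VS ->
  exists a b : rat, x + g x = (2 * a)%:A /\ x * g x = (a ^+ 2 - b ^+ 2 * (j%:~R ^+ 2 - 4))%:A.
Proof.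
move=> gd /quadratic_coords[a [b xE]]; exists a, b.
have gx : g x = a%:A - b%:A * delta.
  by rewrite xE rmorphD rmorphM /= gd !linearZ /= rmorph1 mulrN.
have e1 : (2 * a)%:A = 2 * a%:A :> L.
  by rewrite -[LHS]/(in_alg L _) rmorphM rmorph_nat.
have e2 : (a ^+ 2 - b ^+ 2 * (j%:~R ^+ 2 - 4))%:A = a%:A ^+ 2 - b%:A ^+ 2 * delta ^+ 2.
  by rewrite delta2_rat -[LHS]/(in_alg L _) rmorphB rmorphXn rmorphM rmorphXn.
by rewrite gx xE e1 e2; split; ring.
Qed.

Lemma quadratic_norm_eq1 (g : 'AEnd(L)) x n : g delta = - delta ->
  x \in <<1; delta>>%VS -> odd n -> (x * g x) ^+ n = 1 -> x * g x = 1.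
Proof.
move=> gd /(quadratic_norm gd)[a [b [_ ->]]] n_odd.
move/eqP; rewrite -[_%:A]/(in_alg L _) -rmorphXn fmorph_eq1 => /eqP /(odd_expr_eq1 n_odd) ->.
by rewrite rmorph1.
Qed.

(** The norm of xi is rational with odd power 1, so it is 1. The trace c is then an integer root of
    C_q - 2, and |c| >= 2 because D > 0. Hence c is 2 or -2 and xi is rational. *)
Lemma quadratic_unity_root xi : xi \in <<1; delta>>%VS -> xi ^+ q = 1 -> xi = 1.
Proof.
move=> E0xi xi1; have [g gd] := quadratic_conj.
have N1 : xi * g xi = 1.
  apply: (quadratic_norm_eq1 gd E0xi q_odd).
  by rewrite exprMn -rmorphXn xi1 rmorph1 mulr1.
have nzxi := unity_root_neq0 q_odd xi1.
have gxi : g xi = xi^-1 by rewrite -[LHS](mulKf nzxi) N1 mulr1.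
have [a [b [tr nm]]] := quadratic_norm gd E0xi.
have ab : a ^+ 2 - b ^+ 2 * (j%:~R ^+ 2 - 4) = 1.
  by apply: (fmorph_inj (in_alg L)); rewrite rmorph1 /= -nm.
have mon : cheb q - 2%:P \is monic by apply: cheb_sub_monic.
have [|c ac /rootP] := monic_int_rat_root mon (r := 2 * a).
  rewrite -(fmorph_root (in_alg L)) -map_poly_comp.
  rewrite (eq_map_poly (g := intr : int -> L)) => [|n /=]; last by rewrite scaler_int.
  rewrite /= -tr gxi rmorphB /= map_polyC rootE !hornerE chebE //.
  by rewrite xi1 invr1 subrr.
rewrite hornerD hornerN hornerC => /eqP; rewrite subr_eq0 => /eqP Cc.
have a2 : 1 <= a ^+ 2.
  rewrite -[a ^+ 2](subrK (b ^+ 2 * (j%:~R ^+ 2 - 4))) ab lerDl mulr_ge0 ?sqr_ge0 //.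
  by rewrite subr_ge0 -[4]/(4%:~R) -rmorphXn ler_int ltW.
have c2 : 2 <= `|c|.
  rewrite -(@ler_pXn2r _ 2) ?nnegrE // real_normK ?num_real // -(ler_int rat) [X in _ <= X]rmorphXn /= -ac.
  by rewrite exprMn [X in X <= _](_ : _ = 2 ^+ 2) ?rmorphXn // ler_peMr.
have := cheb_eq2 _ c2 Cc; rewrite expn_gt0 prime_gt0 // => /(_ isT) c4.
have a21 : a ^+ 2 = 1.
  have E : (2 * a) ^+ 2 = 4 by rewrite ac -rmorphXn c4.
  by apply: (@mulfI rat 4) => //; rewrite mulr1 -[RHS]E; ring.
(* With norm 1 and a^2 = 1, the quadratic polynomial of xi is (X - a)^2. *)
have xia : xi = a%:A.
  apply/eqP; rewrite -subr_eq0 -sqrf_eq0; apply/eqP.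
  have -> : (xi - a%:A) ^+ 2 = xi * (xi + g xi) - xi * g xi - xi * (2 * a)%:A + a%:A ^+ 2.
    rewrite -![(_ * _)%:A]/(in_alg L _) rmorphM rmorph_nat /=; ring.
  by rewrite tr N1 -(rmorphXn (in_alg L)) a21 rmorph1; ring.
rewrite xia; move: xi1; rewrite xia -[_%:A]/(in_alg L _) -rmorphXn => /eqP.
by rewrite fmorph_eq1 => /eqP /(odd_expr_eq1 q_odd) ->; rewrite rmorph1.
Qed.

Section Root.
Variable y : L.
Hypotheses (nz_y : y != 0) (yD : y ^+ q + y ^- q = j%:~R) (yB : y ^+ q - y ^- q = delta).

(** y^q has norm 1, hence so does v. The trace c = v + 1/v is then an integer with C_(p^(k-e))(c) =
    j, which exhibits j as a value of C_p. *)
Lemma not_pth_power v e : v \in <<1; delta>>%VS -> (e < k)%N ->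
  v ^+ (p ^ (k - e)) <> y ^+ q.
Proof.
move=> E0v ek vy; have [g gd] := quadratic_conj.
have n_odd : odd (p ^ (k - e)) by rewrite oddX p_odd orbT.
have [yq yqV] := yq_half nz_y yD yB.
have gyq : g (y ^+ q) = y ^- q by rewrite yqV yq fmorph_div rmorphD rmorph_int rmorph_nat /= gd.
have N1 : v * g v = 1.
  apply: (quadratic_norm_eq1 gd E0v n_odd).
  by rewrite exprMn -rmorphXn vy /= gyq divff // expf_neq0.
have nzv : v != 0 by apply: contra_eq_neq N1 => ->; rewrite mul0r eq_sym oner_eq0.
have gv : g v = v^-1 by rewrite -[LHS](mulKf nzv) N1 mulr1.
have [a [b [tr _]]] := quadratic_norm gd E0v.
have mon : cheb (p ^ (k - e)) - j%:P \is monic by apply: cheb_sub_monic.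
have [|c ac /rootP] := monic_int_rat_root mon (r := 2 * a).
  rewrite -(fmorph_root (in_alg L)) -map_poly_comp.
  rewrite (eq_map_poly (g := intr : int -> L)) => [|n /=]; last by rewrite scaler_int.
  rewrite /= -tr gv rmorphB /= map_polyC rootE !hornerE chebE //.
  by rewrite vy yD subrr.
rewrite hornerD hornerN hornerC => /eqP; rewrite subr_eq0 => /eqP Cc.
apply: notC; exists (cheb (p ^ (k - e).-1)).[c].
rewrite -horner_comp -cheb_comp -expnS prednK ?subn_gt0 //.
Qed.

Lemma adjoin_degree_root : (q <= adjoin_degree <<1; delta>>%AS y)%N.
Proof.
set E0 := <<1; delta>>%AS; set d := adjoin_degree E0 y.
have [yq _] := yq_half nz_y yD yB.
have q_gt0 : (0 < q)%N by apply: ltnW.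
have E0yq : y ^+ q \in E0.
  rewrite yq; apply: rpred_div; last exact: rpred_nat.
  by apply: rpredD; [apply: rpred_int | apply: memv_adjoin].
have zq := prim_expr_order prim.
have fact : 'X^q - (y ^+ q)%:P = \prod_(w <- unity_root_seq q zeta) ('X - (w * y)%:P).
  rewrite (@all_roots_prod_XsubC _ ('X^q - (y ^+ q)%:P) [seq w * y | w <- unity_root_seq q zeta]).
  - by rewrite (monicP (monicXnsubC _ _)) // scale1r big_map.
  - by rewrite size_map size_map size_iota size_XnsubC.
  - apply/allP=> _ /mapP[w + ->]; rewrite (mem_unity_root_seq prim) => /eqP w1.
    by rewrite rootE !hornerE exprMn w1 mul1r subrr.
  rewrite uniq_rootsE map_inj_uniq; last exact: mulIf.
  exact: uniq_unity_root_seq prim.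
(* The roots of the minimal polynomial of y are d of the numbers w y; up to sign, its constant
   coefficient is W y^d. *)
have [W W1 E0W] : exists2 W, W ^+ q = 1 & W * y ^+ d \in E0.
  have /dvdp_prod_XsubC[m] : minPoly E0 y %| \prod_(w <- unity_root_seq q zeta) ('X - (w * y)%:P).
    rewrite -fact; apply: minPoly_dvdp; last by rewrite rootE !hornerE subrr.
    by rewrite rpredB ?rpredX ?polyOverX // polyOverC.
  set s := mask m _ => minE.
  have {}minE : minPoly E0 y = \prod_(w <- s) ('X - (w * y)%:P).
    by apply/eqP; rewrite -eqp_monic ?monic_minPoly ?monic_prod_XsubC.
  have sd : size s = d.
    by apply: succn_inj; rewrite -(size_prod_XsubC s (fun w => w * y)) -minE size_minPoly.
  exists (\prod_(w <- s) w).
    rewrite -prodrXl big_seq big1 // => w /mem_mask.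
    by rewrite (mem_unity_root_seq prim) => /eqP.
  have -> : \prod_(w <- s) w * y ^+ d = (-1) ^+ d * (minPoly E0 y)`_0.
    rewrite minE -(big_map (fun w => w * y) xpredT (fun a => 'X - a%:P)) coef0_prod_XsubC.
    rewrite size_map sd big_map mulrA -exprMn mulrNN mulr1 expr1n mul1r.
    by rewrite big_split /= big_const_seq count_predT sd iter_mulr_1.
  by rewrite rpredM ?rpredX ?rpredN ?rpred1 //; apply/polyOverP/minPolyOver.
rewrite leqNgt; apply/negP => dq.
have d_gt0 : (0 < d)%N by [].
have /(dvdn_pfactor _ _ p_pr)[e ek gE] := dvdn_gcdr d q.
have {}ek : (e < k)%N.
  rewrite ltn_neqAle ek andbT; apply/eqP => e_k; move: dq; rewrite ltnNge => /negP[].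
  by apply: dvdn_leq => //; rewrite -{1}e_k -gE dvdn_gcdl.
have [u v uv _] := egcdnP q d_gt0; rewrite gE in uv.
(* Bezout: u d = v q + p^e with p^e = gcd(d, q), so V is y^(p^e) up to a root of unity. *)
pose V := (W * y ^+ d) ^+ u / (y ^+ q) ^+ v.
have VE : V = W ^+ u * y ^+ (p ^ e).
  rewrite /V exprMn -!exprM [(d * u)%N]mulnC uv exprD [(q * v)%N]mulnC.
  by rewrite mulrCA mulrC mulKf // expf_neq0.
have E0V : V \in E0 by apply: rpred_div; apply: rpredX.
have Vn : V ^+ (p ^ (k - e)) = W ^+ (u * p ^ (k - e)) * y ^+ q.
  by rewrite VE exprMn -!exprM -expnD subnKC // ltnW.
apply: (not_pth_power E0V ek); rewrite Vn.
(* The remaining root of unity is a quotient of elements of the quadratic field, hence trivial. *)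
rewrite [W ^+ _](_ : _ = 1) ?mul1r //; apply: quadratic_unity_root.
  rewrite -[W ^+ _](mulfK (expf_neq0 q nz_y)) -Vn.
  by apply: rpred_div; [apply: rpredX|].
by rewrite exprAC W1 expr1n.
Qed.

End Root.

Lemma minPoly_cheb_root alpha : root (map_poly intr (cheb q - j%:P)) alpha ->
  minPoly (1%AS : {subfield L}) alpha = map_poly intr (cheb q - j%:P).
Proof.
move=> ra; have [y [nzy ya yD yB]] := cheb_root_param delta_neq0 delta2 ra.
set E0 := <<1; delta>>%AS.
have mon : map_poly (intr : int -> L) (cheb q - j%:P) \is monic.
  by rewrite monic_map // cheb_sub_monic.
have szf : size (map_poly (intr : int -> L) (cheb q - j%:P)) = q.+1.
  rewrite size_map_poly_id0 ?size_cheb_sub //.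
  by rewrite (monicP (cheb_sub_monic _ _)) // rmorph1 oner_eq0.
have dv : minPoly (1%AS : {subfield L}) alpha %| map_poly intr (cheb q - j%:P).
  apply: minPoly_dvdp => //; apply/polyOverP=> i; rewrite coef_map; exact: rpred_int.
apply/eqP; rewrite -eqp_monic ?monic_minPoly //.
rewrite -dvdp_size_eqp // szf eqn_leq.
apply/andP; split.
  by rewrite -szf dvdp_leq // monic_neq0.
have := dvdp_leq (monic_neq0 (monic_minPoly 1%AS alpha)) (minPolyS alpha (sub1v E0)).
apply: leq_trans; rewrite size_minPoly ltnS.
apply: leq_trans (adjoin_degree_root nzy yD yB) _.
(* Over E0 the root alpha generates y, by the formula of [cheb_root_param], so its degree is at
   least that of y. *)
rewrite -(@leq_pmul2r (\dim E0)) ?adim_gt0 // -!dim_Fadjoin dimvS //.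
apply/FadjoinP; split; first exact: subv_adjoin.
set u := (map_poly intr (chebU q)).[alpha].
have uE : u * (y - y^-1) = delta by rewrite /u -ya chebU_horner.
have nzu : u != 0 by apply: contraNneq delta_neq0 => u0; rewrite -uE u0 mul0r.
have n2 : 2%:R != 0 :> L by rewrite natr_ext_eq0.
have -> : y = (alpha + delta / u) / 2.
  by rewrite -uE mulrAC divff // mul1r -ya; field; rewrite n2 nzy.
have Ea : alpha \in <<E0; alpha>>%VS by apply: memv_adjoin.
rewrite rpred_div ?rpred_nat // rpredD // rpred_div //.
  by apply: (subvP (subv_adjoin _ _)); apply: memv_adjoin.
by apply: rpred_horner => //; apply/polyOverP=> i; rewrite coef_map; apply: rpred_int.
Qed.

End Irreducibility.

(** * Roots above p *)

Section Reversal.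
Variables (q : nat) (h : int).
(* If H has degree at most q and constant term h then X^q + scaled_rev H is
   X^q H(h / X) / h, whose roots are the h / u with H(u) = 0. *)
Definition scaled_rev (G : {poly int}) : {poly int} :=
  \poly_(m < q) (G`_(q - m) * h ^+ (q - m).-1).

Lemma scaled_revD F G : scaled_rev (F + G) = scaled_rev F + scaled_rev G.
Proof.
apply/polyP=> i; rewrite coefD !coef_poly coefD; case: ifP => _; last by rewrite addr0.
by rewrite mulrDl.
Qed.

Lemma scaled_revZ c G : scaled_rev (c *: G) = c *: scaled_rev G.
Proof.
apply/polyP=> i; rewrite coefZ !coef_poly coefZ; case: ifP => _; last by rewrite mulr0.
by rewrite mulrA.
Qed.

Lemma scaled_revC c : scaled_rev c%:P = 0.
Proof.
apply/polyP=> i; rewrite coef_poly coefC coef0; case: ifP => // iq.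
by rewrite subn_eq0 leqNgt iq mul0r.
Qed.

Lemma scaled_revXn i : (0 < i <= q)%N -> scaled_rev 'X^i = h ^+ i.-1 *: 'X^(q - i).
Proof.
move=> iq; apply/polyP=> m; rewrite coef_poly coefZ !coefXn.
have [mq|mq] := ltnP m q; last by rewrite gtn_eqF ?mulr0 //; lia.
have -> : (q - m == i)%N = (m == q - i)%N by lia.
by case: eqP => [->|_]; rewrite ?mul0r ?mulr0 // subKn ?mul1r ?mulr1 //; lia.
Qed.

Lemma scaled_rev_monic G : 'X^q + scaled_rev G \is monic.
Proof.
have sz : (size (scaled_rev G) < size ('X^q : {poly int}))%N.
  by rewrite size_polyXn ltnS size_poly.
by rewrite monicE lead_coefDl // lead_coefXn.
Qed.

Hypothesis q_gt0 : (0 < q)%N.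

Lemma scaled_rev_root (K : fieldType) (H : {poly int}) (u : K) : u != 0 ->
  (size H <= q.+1)%N -> H`_0 = h -> root (map_poly intr H) u ->
  root (map_poly intr ('X^q + scaled_rev H)) (h%:~R / u).
Proof.
move=> nzu szH H0 /rootP Hu; apply/rootP.
apply: (mulIf (expf_neq0 q nzu)); rewrite mul0r.
transitivity (h%:~R ^+ q.-1 * (map_poly intr H).[u]); last by rewrite Hu mulr0.
rewrite (@horner_coef_wide _ q.+1 (map_poly intr H)); last first.
  by apply: leq_trans _ szH; rewrite map_polyE (leq_trans (size_Poly _)) ?size_map.
rewrite rmorphD /= map_polyXn hornerD hornerXn mulrDl -exprMn divfK //.
rewrite (@horner_coef_wide _ q (map_poly intr (scaled_rev H))); last first.
  rewrite map_polyE (leq_trans (size_Poly _)) ?size_map //; exact: size_poly.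
rewrite big_ord_recl coef_map H0 expr0 mulr1 mulrDr -exprSr prednK //; congr (_ + _).
rewrite mulr_suml mulr_sumr (reindex_inj rev_ord_inj) /=; apply: eq_bigr => i _.
rewrite !coef_map coef_poly /= /bump /= add1n.
have -> : (q - i.+1 < q)%N by lia.
have -> : (q - (q - i.+1) = i.+1)%N by have := ltn_ord i; lia.
rewrite rmorphM rmorphXn /= expr_div_n.
have -> : u ^+ q = u ^+ (q - i.+1) * u ^+ i.+1 by rewrite -exprD subnK // ltn_ord.
have -> : h%:~R ^+ q.-1 = h%:~R ^+ i * h%:~R ^+ (q - i.+1) :> K.
  by rewrite -exprD; congr (_ ^+ _); have := ltn_ord i; lia.
by field; rewrite expf_neq0.
Qed.

End Reversal.

(** * Simple roots modulo a prime above p *)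

Section AboveP.
Variables (L : splittingFieldType rat) (E : {subfield L}) (P : L -> Prop) (p : nat).
Hypotheses (prP : prime_ideal E P) (p_pr : prime p) (Pp : P p%:R).
Local Notation O := (integers_of E).

Lemma pideal_dvdz (c : int) : (p%:Z %| c)%Z -> P c%:~R.
Proof.
by case/dvdzP=> d ->; rewrite rmorphM; apply: (pidealMl prP) => //; apply: integers_of_int.
Qed.

Lemma pideal_ndvdz (c : int) : ~~ (p%:Z %| c)%Z -> ~ P c%:~R.
Proof.
move=> nc Pc; have /coprimezP[[u v] /= uv] : coprimez c p%:Z.
  by rewrite coprimezE coprime_sym prime_coprime // -dvdzE.
apply: (pideal1 prP); rewrite -[1]/(1%:~R) -uv rmorphD !rmorphM.
by apply: (pidealD prP); apply: (pidealMl prP) => //; apply: integers_of_int.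
Qed.

Lemma integers_of_horner (f : {poly int}) x : O x -> O (map_poly intr f).[x].
Proof.
move=> Ox; elim/poly_ind: f => [|f c IH]; first by rewrite rmorph0 horner0; apply: integers_of0.
rewrite rmorphD rmorphM /= map_polyX map_polyC !hornerE.
by apply: integers_ofD; [apply: integers_ofM | apply: integers_of_int].
Qed.

Lemma integers_ofX x n : O x -> O (x ^+ n).
Proof.
move=> Ox; elim: n => [|n IHn]; first exact: integers_of1.
by rewrite exprS; apply: integers_ofM.
Qed.

Lemma pideal_p_horner (f : {poly int}) x : O x -> P (map_poly intr (p%:Z *: f)).[x].
Proof.
move=> Ox; rewrite map_polyZ hornerZ; apply: (pidealMr prP) => //.
exact: integers_of_horner.
Qed.

Lemma pideal_sub_notin a b : P a -> ~ P b -> ~ P (a + b).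
Proof. by move=> Pa nb Pab; apply: nb; rewrite -(addKr a b); apply: (pidealD prP) => //; apply: (pidealN prP). Qed.

(** With t = x' - x, Taylor gives 0 = g'(x) t + t^2 r, so g'(x) = -t r. A root that is simple modulo
    P is congruent to no other root. *)
Lemma congruent_roots_deriv (g : {poly int}) x x' : O x -> O x' -> x != x' ->
  root (map_poly intr g) x -> root (map_poly intr g) x' -> P (x' - x) ->
  P (map_poly intr g^`()).[x].
Proof.
move=> Ox Ox' nxx /rootP gx /rootP gx' Pt; set t := x' - x in Pt.
have [r Or] := taylor2 g (integers_of0 E) (@integers_ofD _ E) (@integers_ofM _ E)
  (@integers_of_int _ E) Ox (pidealO prP Pt).
have -> : x + t = x' by rewrite /t addrC subrK.
rewrite gx gx' add0r => /esym/eqP.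
have nzt : t != 0 by rewrite subr_eq0 eq_sym.
rewrite expr2 -mulrA [t * (t * r)]mulrC -mulrDl mulf_eq0 (negPf nzt) orbF addr_eq0 => /eqP ->.
by apply: (pidealN prP); apply: (pidealMr prP).
Qed.

Section SimpleRoots.
Variables (q : nat) (h : int) (H E1 : {poly int}).
Hypothesis q_ge3 : (2 < q)%N.
Let g := 'X^q + scaled_rev q h H.

(** Modulo p, g is X^(q-1) (X + u), and as p divides q its derivative is -u X^(q-2). The first
    conclusion will force some root out of P: the coefficient of degree q - 1 is minus the sum of
    the roots. *)
Lemma scaled_rev_simple_linear (h1 u : int) : (p %| q)%N -> H = h1%:P + u *: 'X + p%:Z *: E1 ->
  ~~ (p%:Z %| u)%Z -> ~~ (p%:Z %| g`_q.-1)%Z /\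
  forall x, O x -> root (map_poly intr g) x -> ~ P x -> ~ P (map_poly intr g^`()).[x].
Proof.
move=> pq HE pu; have gE : g = 'X^q + u *: 'X^(q.-1) + p%:Z *: scaled_rev q h E1.
  rewrite /g HE !scaled_revD scaled_revC !scaled_revZ -['X]expr1 scaled_revXn; last by lia.
  by rewrite expr0 scale1r add0r subn1 addrA.
split.
  rewrite gE !(coefD, coefZ, coefXn) eqxx mulr1.
  have -> : (q.-1 == q)%N = false by lia.
  rewrite add0r; apply: contra pu => d.
  by rewrite -(rpredDr _ (x := p%:Z * (scaled_rev q h E1)`_q.-1)) // dvdz_mulr.
move=> x Ox _ nx; rewrite gE !derivD !derivZ !derivXn !rmorphD hornerD.
move/(pidealD prP)/(_ (pidealN prP (pideal_p_horner (scaled_rev q h E1)^`() Ox))).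
rewrite addrK hornerD /= map_polyZ !rmorphMn /= !map_polyXn hornerZ !hornerMn !hornerXn.
have -> : x ^+ q.-1 *+ q + u%:~R * (x ^+ q.-1.-1 *+ q.-1) =
   q%:R * (x ^+ q.-1 + u%:~R * x ^+ q.-2) + (- u)%:~R * x ^+ q.-2.
  rewrite -[x ^+ q.-1 *+ q]mulr_natl -[x ^+ q.-1.-1 *+ _]mulr_natl.
  have -> : q%:R = (q.-1)%:R + 1 :> L by rewrite natr1 prednK //; lia.
  by rewrite rmorphN /=; ring.
apply: pideal_sub_notin.
  apply: (pidealMr prP); last by have := @pideal_dvdz q%:Z; apply.
  by apply: integers_ofD; [|apply: integers_ofM; [exact: integers_of_int|]]; apply: integers_ofX.
apply: (notpidealM prP); [exact: integers_of_int | exact: integers_ofX | | ].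
  by apply: pideal_ndvdz; rewrite rpredN.
by move/(pidealX prP Ox).
Qed.

(** Modulo 3, g is X^(q-3) T and T' = 2 (X + e h). At X = -e h the value of T is -e h^3, a unit, so
    T has no multiple root. *)
Lemma scaled_rev_simple_cubic (h1 e : int) : ~~ (p%:Z %| h)%Z -> p = 3 -> e * e = 1 ->
  H = h1%:P + ('X + (2 * e) *: 'X ^+ 2 + 'X ^+ 3) + p%:Z *: E1 ->
  ~~ (p%:Z %| g`_q.-1)%Z /\
  forall x, O x -> root (map_poly intr g) x -> ~ P x -> ~ P (map_poly intr g^`()).[x].
Proof.
move=> ph p3 ee HE.
pose T : {poly int} := 'X^3 + 'X^2 + (2 * e * h) *: 'X + (h ^+ 2)%:P.
have gE : g = 'X^(q - 3) * T + p%:Z *: scaled_rev q h E1.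
  rewrite /g HE !scaled_revD scaled_revC !scaled_revZ -['X]expr1 !scaled_revXn; try by lia.
  have Xq i : (i <= 3)%N -> 'X^(q - i) = 'X^(q - 3) * 'X^(3 - i) :> {poly int}.
    by move=> i3; rewrite -exprD; congr (_ ^+ _); lia.
  have Xq0 : 'X^q = 'X^(q - 3) * 'X^3 :> {poly int} by rewrite -(Xq 0%N) ?subn0.
  rewrite Xq0 (Xq 1%N) // (Xq 2%N) // /T -!mul_polyC polyCM !rmorphXn; ring.
split.
  rewrite gE coefD coefZ coefXnM; have -> : (q.-1 < q - 3)%N = false by lia.
  have -> : (q.-1 - (q - 3) = 2)%N by lia.
  rewrite /T !(coefD, coefZ, coefXn, coefX, coefC) /= mulr0 !addr0 add0r.
  apply/negP => d; suff: (p%:Z %| 1%R)%Z by rewrite (dvdz_prime1 p_pr).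
  by rewrite -(rpredDr _ (x := p%:Z * (scaled_rev q h E1)`_q.-1)) // dvdz_mulr.
move=> x Ox /rootP gx nx.
have PE := pideal_p_horner (scaled_rev q h E1) Ox.
have xq n : ~ P (x ^+ n) by move/(pidealX prP Ox).
have PT : P (map_poly intr T).[x].
  have : P (x ^+ (q - 3) * (map_poly intr T).[x]).
    move: gx; rewrite gE rmorphD rmorphM /= map_polyXn hornerD hornerM hornerXn.
    by move/eqP; rewrite addr_eq0 => /eqP ->; apply: (pidealN prP).
  by case/(pidealM prP (integers_ofX _ Ox) (integers_of_horner _ Ox)) => [/xq|].
have nP2 : ~ P 2%:R.
  move=> P2; apply: (pideal1 prP); have -> : 1 = p%:R - 2%:R :> L by rewrite p3; ring.
  exact: (pidealB prP).
rewrite gE derivD derivZ derivM derivXn !rmorphD hornerD.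
move/(pidealD prP)/(_ (pidealN prP (pideal_p_horner (scaled_rev q h E1)^`() Ox))).
rewrite addrK !rmorphM /= hornerD !hornerM map_polyXn hornerXn.
move/(pidealD prP)/(_ (pidealN prP (pidealMl prP (integers_of_horner ('X^((q - 3).-1) *+ (q - 3)) Ox) PT))).
rewrite addrAC subrr add0r.
case/(pidealM prP (integers_ofX _ Ox) (integers_of_horner _ Ox)) => [/xq //|].
have TE : (map_poly intr T).[x] = x ^+ 3 + x ^+ 2 + 2 * e%:~R * h%:~R * x + h%:~R ^+ 2.
  rewrite /T !rmorphD /= map_polyZ map_polyX !map_polyXn map_polyC.
  by rewrite !(hornerD, hornerZ, hornerX, hornerXn, hornerC) /= rmorphXn !intrM.
have dTE : (map_poly intr T^`()).[x] = p%:R * x ^+ 2 + 2%:R * (x + e%:~R * h%:~R).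
  rewrite /T !derivD derivC addr0 derivZ derivX !derivXn !rmorphD /= map_polyZ rmorph1 /=.
  rewrite !map_polyXn !(hornerD, hornerZ, hornerMn, hornerXn, hornerC) /= !intrM p3; ring.
have Oeh : O (x + e%:~R * h%:~R).
  by apply: integers_ofD => //; apply: integers_ofM; apply: integers_of_int.
rewrite dTE; move/(pidealD prP)/(_ (pidealN prP (pidealMr prP (integers_ofX 2 Ox) Pp))).
rewrite addrAC subrr add0r; case/(pidealM prP (integers_of_nat E 2) Oeh) => // Pxe.
have e2 : e%:~R * e%:~R = 1 :> L by rewrite -rmorphM ee.
(* This is division of T by x + e h, with remainder -e h^3 once e^2 = 1 is used. *)
have : P (e * h ^+ 3)%:~R.
  have -> : (e * h ^+ 3)%:~R = (x + e%:~R * h%:~R) *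
     (x ^+ 2 + x - e%:~R * h%:~R * x + e%:~R * h%:~R + e%:~R * e%:~R * h%:~R ^+ 2) - (map_poly intr T).[x]
     + (1 - e%:~R * e%:~R) * (h%:~R ^+ 2 + e%:~R * h%:~R ^+ 3) :> L.
    by rewrite TE rmorphM rmorphXn; ring.
  rewrite e2 subrr mul0r addr0 mul1r; apply: (pidealB prP) => //; apply: (pidealMr prP) => //.
  have Oe := integers_of_int E e; have Oh := integers_of_int E h.
  have Oeh' := integers_ofM Oe Oh.
  apply: integers_ofD; last exact: integers_ofX.
  apply: integers_ofD => //; apply: integers_ofB; last exact: integers_ofM.
  by apply: integers_ofD => //; apply: integers_ofX.
apply: pideal_ndvdz; rewrite Euclid_dvdzM // Euclid_dvdzX // negb_or ph andbT.
by apply/negP => pe; have := dvdz_prime1 p_pr; rewrite -ee dvdz_mulr.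
Qed.

End SimpleRoots.
End AboveP.

(** * The splitting field of C_q - j *)

Section ChebyshevSplittingField.
Variables (L : splittingFieldType rat) (p k : nat) (j : int) (zeta delta y : L).
Hypotheses (p_pr : prime p) (p_odd : odd p) (k_gt0 : (0 < k)%N).
Local Notation q := (p ^ k)%N.
Hypotheses (prim : q.-primitive_root zeta) (nz_delta : delta != 0).
Hypothesis delta2 : delta ^+ 2 \in 1%VS.
Hypotheses (nz_y : y != 0) (yD : y ^+ q + y ^- q = j%:~R) (yB : y ^+ q - y ^- q = delta).
Variable K : {subfield L}.
Hypothesis splitK : splittingFieldFor 1 (map_poly intr (cheb q - j%:P)) K.

Local Notation A := (cheb_root y).
Local Notation Fj := (twist_field q zeta delta).

Let q_odd : odd q. Proof. by rewrite oddX p_odd orbT. Qed.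
Let q_gt1 : (1 < q)%N. Proof. by rewrite -(exp1n k) ltn_exp2r // prime_gt1. Qed.
Let one_q : (1 : L) ^+ q = 1. Proof. exact: expr1n. Qed.

Lemma cheb_root_mem w : w ^+ q = 1 -> A w \in K.
Proof.
move=> w1; have [rs fE <-] := splitK.
have := cheb_rootP q_odd nz_y yD w1; rewrite (eqp_root fE) root_prod_XsubC.
exact: seqv_sub_adjoin.
Qed.

Lemma cheb_root_gen (E : {subfield L}) : (forall w, w ^+ q = 1 -> A w \in E) -> (K <= E)%VS.
Proof.
move=> AE; have [rs fE <-] := splitK; apply/Fadjoin_seqP; split=> [|x xrs].
  exact: sub1v.
have : root (map_poly intr (cheb q - j%:P)) x by rewrite (eqp_root fE) root_prod_XsubC.
by case/(cheb_sub_rootP q_odd prim nz_delta nz_y yD yB) => w w1 ->; apply: AE.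
Qed.

Lemma cheb_root_aut_eq1 (s : gal_of K) : (forall w, w ^+ q = 1 -> s (A w) = A w) -> s = 1%g.
Proof.
move=> sA; pose B := [aspace of fixedSpace s].
have /subvP KB : (K <= B)%VS by apply: cheb_root_gen => w w1; apply/fixedSpaceP/sA.
by apply/eqP/gal_eqP => x /KB /fixedSpaceP ->; rewrite gal_id.
Qed.

Lemma galois_splitK : galois 1 K.
Proof.
apply: galois_rat; apply/(splitting_normalField (sub1v _)).
exists (map_poly intr (cheb q - j%:P)) => //.
by apply/polyOverP=> i; rewrite coef_map; apply: rpred_int.
Qed.

Lemma twist_field_sub : (Fj <= K)%VS.
Proof.
have galL : galois 1 {:L} by apply: galois_rat; apply: normalFieldf.
have galKL : galois K {:L} by apply: galoisS galL; rewrite sub1v subvf.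
apply/subvP=> x Fx; rewrite -(galois_fixedField galKL).
apply/fixedFieldP => [|g gK]; first exact: memvf.
apply: (twist_field_fix q_gt1 prim delta2) => //.
apply: (aut_fix_cheb_root q_odd prim nz_delta nz_y yB) => w w1.
by apply: fixed_gal gK _; [apply: subvf | apply: cheb_root_mem].
Qed.

Lemma galois_twist_splitK : galois Fj K.
Proof. by apply: galoisS galois_splitK; rewrite sub1v twist_field_sub. Qed.

Lemma gal_cheb_root (s : gal_of K) : s \in 'Gal(K / Fj)%g ->
  exists2 v, v ^+ q = 1 & forall w, w ^+ q = 1 -> s (A w) = A (w * v).
Proof.
move=> sG; apply: (aut_cheb_root q_odd prim nz_delta nz_y yD yB).
by apply: fixed_gal sG _; [apply: twist_field_sub | apply: twist_theta_field].
Qed.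

(** Sending s to its translation v is an injective morphism into the multiplicative group of L, and
    finite groups of that kind are cyclic. *)
Lemma cyclic_twist_splitK : cyclic_extension Fj K.
Proof.
split; first exact: galois_twist_splitK.
have ex_v (s : gal_of K) : exists v, s \in 'Gal(K / Fj)%g ->
    v ^+ q = 1 /\ forall w, w ^+ q = 1 -> s (A w) = A (w * v).
  have [sG|nsG] := boolP (s \in 'Gal(K / Fj)%g); last by exists 1.
  by have [v v1 vA] := gal_cheb_root sG; exists v.
have [f fP] := choice ex_v.
have inj := cheb_root_inj q_odd nz_delta nz_y yB.
apply: (@field_mul_group_cyclic _ 'Gal(K / Fj)%G L f) => [s t sG tG|s sG].
  have [fs1 sA] := fP s sG; have [ft1 tA] := fP t tG.
  have [fst1 stA] := fP _ (groupM sG tG).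
  apply: inj => //; first exact: unity_rootM.
  by rewrite -[f (s * t)%g]mul1r -stA // galM ?cheb_root_mem // sA // mul1r tA.
have [fs1 sA] := fP s sG; split=> [fs|s1].
  by apply: cheb_root_aut_eq1 => w w1; rewrite sA // fs mulr1.
by apply: inj => //; rewrite -[f s]mul1r -sA // s1 gal_id.
Qed.

Lemma integers_of_cheb_root w : w ^+ q = 1 -> integers_of K (A w).
Proof.
move=> w1; split; first exact: cheb_root_mem.
exists (cheb q - j%:P); first by apply: cheb_sub_monic q_odd.
exact: cheb_rootP.
Qed.

Section PrimeIdeal.
Variable P : L -> Prop.
Hypothesis prP : prime_ideal K P.
Local Notation O := (integers_of K).

Lemma cheb_root_disc_in w u : w ^+ q = 1 -> u ^+ q = 1 ->
  O (A w ^+ 2 - A (w * u) * A (w * u^-1)).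
Proof.
move=> w1 u1; have u1' := unity_rootV u1.
apply: integers_ofB; first by apply: integers_ofX; apply: integers_of_cheb_root.
by apply: integers_ofM; apply: integers_of_cheb_root; apply: unity_rootM.
Qed.

(** The powers of u^2 sum to 0, so q is the sum of the 1 - u^(2i) and hence a multiple of 1 - u^2.
    Squaring makes q^2 a multiple of (u - 1/u)^2. *)
Lemma unity_root_disc_notin u : ~ P p%:R -> u ^+ q = 1 -> u != 1 -> ~ P (- (u - u^-1) ^+ 2).
Proof.
move=> nPp u1 nu1 PL; have nzu := unity_root_neq0 q_odd u1.
have nu2 : u ^+ 2 != 1.
  apply: contra_neq nu1 => u2; rewrite -[u]mul1r -[1 in LHS]u1 -exprSr.
  have qE : q.+1 = (q.+1)./2.*2 by rewrite -[LHS]odd_double_half /= q_odd.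
  by rewrite qE -mul2n exprM u2 expr1n.
pose r := \sum_(i < q) \sum_(l < i) (u ^+ 2) ^+ l.
have qr : q%:R = (1 - u ^+ 2) * r.
  rewrite mulr_sumr.
  under eq_bigr => i _.
    rewrite -opprB mulNr -subrX1 opprB.
    over.
  rewrite sumrB sumr_const card_ord.
  suff -> : \sum_(i < q) (u ^+ 2) ^+ i = 0 by rewrite subr0.
  apply/eqP; have : (u ^+ 2 - 1) * (\sum_(i < q) (u ^+ 2) ^+ i) == 0.
    by rewrite -subrX1 exprAC u1 expr1n subrr.
  by rewrite mulf_eq0 subr_eq0 (negPf nu2).
have uI : integralOver (intr : int -> L) u.
  exists ('X^q - 1); first by apply: monicXnsubC; apply: ltnW.
  by rewrite rmorphB /= map_polyXn rmorph1 rootE !hornerE u1 subrr.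
have XI n x : integralOver (intr : int -> L) x -> integralOver (intr : int -> L) (x ^+ n).
  move=> xI; elim: n => [|n IHn]; first exact: integral1.
  by rewrite exprS; apply: integral_mul.
have rI : integralOver (intr : int -> L) r.
  apply: (big_ind (integralOver intr)) => [||i _]; [exact: integral0 | exact: integral_add | ].
  apply: (big_ind (integralOver intr)) => [||l _]; [exact: integral0 | exact: integral_add | ].
  exact: XI (XI _ _ uI).
have qL : q%:R ^+ 2 = - (u * r) ^+ 2 * (- (u - u^-1) ^+ 2) by rewrite qr; field.
have nzL : - (u - u^-1) ^+ 2 != 0.
  apply: contra_eq_neq qL => ->; rewrite mulr0 -natrX natr_ext_eq0.
  by rewrite -lt0n !expn_gt0 prime_gt0.
(* u and r may lie outside K; the cofactor is in K as a quotient of q^2 by an element of K. *)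
have Oc : O (- (u * r) ^+ 2).
  split; last by apply: integral_opp; apply: XI; apply: integral_mul.
  have -> : - (u * r) ^+ 2 = q%:R ^+ 2 / (- (u - u^-1) ^+ 2) by rewrite qL mulfK.
  apply: rpred_div; first by rewrite rpredX ?rpred_nat.
  by rewrite -(cheb_root_mulV q_odd nz_y one_q u1); case: (cheb_root_disc_in one_q u1).
have := pidealMl prP Oc PL; rewrite -qL => /(pidealX prP (integers_of_nat K q)).
by rewrite natrX => /(pidealX prP (integers_of_nat K p)).
Qed.

Lemma inertia_away_from_p v : ~ P p%:R -> v ^+ q = 1 -> v != 1 ->
  exists2 b, O b & exists2 w, w ^+ q = 1 & b = A w /\ ~ P (A (w * v) - A w).
Proof.
move=> nPp v1 nv1; apply: contrapT => no.
have all_in w : w ^+ q = 1 -> P (A (w * v) - A w).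
  move=> w1; apply: contrapT => nP; apply: no; exists (A w).
    exact: integers_of_cheb_root.
  by exists w.
have [h h1 vE] := unity_root_sqrt q_odd v1.
have h1' := unity_rootV h1; have nzh := unity_root_neq0 q_odd h1.
have nh1 : h != 1 by apply: contra_neq nv1 => hE; rewrite vE hE expr1n.
have A24 w : w ^+ q = 1 -> P (A w ^+ 2 - 4).
  move=> w1; have nzw := unity_root_neq0 q_odd w1.
  have OA : O (A w ^+ 2 - 4).
    by apply: integers_ofB (integers_of_nat _ 4); apply: integers_ofX; apply: integers_of_cheb_root.
  have OL := cheb_root_disc_in one_q h1; rewrite (cheb_root_mulV q_odd nz_y one_q h1) in OL.
  have Pd := all_in _ (unity_rootM w1 h1'); have Od := pidealO prP Pd.
  have := pidealMl prP Od Pd.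
  (* With v = h^2 the difference is A(w h) - A(w / h) = (h - 1/h) (w y - 1/(w y)), and the square of
     the last factor is A(w)^2 - 4. *)
  have -> : (A (w * h^-1 * v) - A (w * h^-1)) * (A (w * h^-1 * v) - A (w * h^-1)) =
      - (- (h - h^-1) ^+ 2 * (A w ^+ 2 - 4)).
    by rewrite vE /cheb_root; field; rewrite nzh nz_y nzw.
  move/(pidealN prP); rewrite opprK => /(pidealM prP OL OA)[|//].
  by move/(unity_root_disc_notin nPp h1 nh1).
apply: (unity_root_disc_notin nPp v1 nv1).
(* This is [cheb_root_mulV] with y^2 for y, as A(w)^2 - 2 = w^2 y^2 + 1/(w^2 y^2). *)
have -> : - (v - v^-1) ^+ 2 = (A 1 ^+ 2 - 4) ^+ 2 + 4%:R * (A 1 ^+ 2 - 4)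
    - (A h ^+ 2 - 4) * (A h^-1 ^+ 2 - 4) - 2%:R * (A h ^+ 2 - 4) - 2%:R * (A h^-1 ^+ 2 - 4).
  by rewrite vE /cheb_root; field; rewrite nzh nz_y.
have P1 := A24 1 one_q; have Ph := A24 h h1; have Ph' := A24 h^-1 h1'.
have Pn n x : P x -> P (n%:R * x) by apply: (pidealMl prP); apply: integers_of_nat.
apply: (pidealB prP); last exact: Pn.
apply: (pidealB prP); last exact: Pn.
apply: (pidealB prP); last by apply: (pidealMl prP) => //; apply: (pidealO prP).
apply: (pidealD prP); last exact: Pn.
by rewrite expr2; apply: (pidealMl prP) => //; apply: (pidealO prP).
Qed.

(** The integer b is a reversed root h R / (A(w) - a) outside P. An s in the inertia group would
    make it congruent to another root of g, although it is simple modulo P. *)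
Lemma inertia_at_p v : P p%:R -> disc_form p (cheb q - j%:P) -> v ^+ q = 1 -> v != 1 ->
  exists2 b, O b & forall s : gal_of K,
    (forall w, w ^+ q = 1 -> s (A w) = A (w * v)) -> ~ P (s b - b).
Proof.
move=> Pp [a [R [c [h1 [H [G [E1 [nzR nzc ph1 fE [HE HG]]]]]]]]] v1 nv1.
set f := cheb q - j%:P in fE.
pose h := H`_0; pose g := 'X^q + scaled_rev q h H.
have p_gt2 := odd_prime_gt2 p_odd p_pr.
have q_ge3 : (2 < q)%N.
  by apply: leq_trans p_gt2 _; rewrite -{1}(expn1 p) leq_exp2l // prime_gt1.
have pq : (p %| q)%N by rewrite -{1}(expn1 p) dvdn_exp2l.
have G0 : G`_0 = 0.
  case: HG => [[u _ ->]|[_ [e _ ->]]]; first by rewrite coefZ coefX mulr0.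
  by rewrite !(coefD, coefZ, coefX, coefXn) /= mulr0 !addr0.
(* The reversal divides by the exact constant term of H, which is the h1 of the disc form only
   modulo p. *)
have hE : h = h1 + p%:Z * E1`_0 by rewrite /h HE !coefD coefC G0 coefZ addr0.
have ph : ~~ (p%:Z %| h)%Z.
  by apply: contra ph1 => d; rewrite -(rpredDr _ (x := p%:Z * E1`_0)) -?hE // dvdz_mulr.
have nzh : h != 0 by apply: contraNneq ph => ->; apply: dvdz0.
have [pg simple] : ~~ (p%:Z %| g`_q.-1)%Z /\
    forall x, O x -> root (map_poly intr g) x -> ~ P x -> ~ P (map_poly intr g^`()).[x].
  case: HG => [[u pu GE]|[p3 [e ee GE]]]; rewrite GE in HE.
    exact: (scaled_rev_simple_linear prP p_pr Pp h q_ge3 pq HE pu).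
  exact: (scaled_rev_simple_cubic prP p_pr Pp q_ge3 ph p3 ee HE).
have szH : size H = q.+1.
  have := congr1 (fun P : {poly int} => size P) fE; rewrite size_scale // => <-.
  rewrite size_comp_poly2 ?size_cheb_sub // addrC size_polyDl size_scale ?size_polyX //.
  by rewrite ltnS size_polyC_leq1.
have nzRL : R%:~R != 0 :> L by rewrite intr_ext_eq0.
pose om w : L := h%:~R / ((A w - a%:~R) / R%:~R).
have rootH w : w ^+ q = 1 -> root (map_poly intr H) ((A w - a%:~R) / R%:~R).
  move=> w1; have := cheb_rootP q_odd nz_y yD w1; rewrite -/f; set t := _ / _.
  have -> : A w = (map_poly intr (a%:P + R *: 'X)).[t].
    rewrite /t rmorphD /= map_polyC map_polyZ map_polyX hornerD hornerC hornerZ hornerX /=.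
    by field.
  rewrite !rootE -horner_comp -map_comp_poly fE map_polyZ hornerZ mulf_eq0 intr_ext_eq0.
  by rewrite (negPf nzc).
have nzu w : w ^+ q = 1 -> (A w - a%:~R) / R%:~R != 0.
  move=> /rootH; apply: contraTneq => ->; rewrite rootE horner_coef0 coef_map /= intr_ext_eq0.
  exact: nzh.
have om_root w : w ^+ q = 1 -> root (map_poly intr g) (om w).
  by move=> w1; apply: scaled_rev_root; rewrite ?szH ?nzu ?rootH ?(ltnW q_gt1).
have O_om w : w ^+ q = 1 -> O (om w).
  move=> w1; split; last by exists g; [apply: scaled_rev_monic | apply: om_root].
  apply: rpred_div; first exact: rpred_int.
  apply: rpred_div; last exact: rpred_int.
  by apply: rpredB; [apply: cheb_root_mem | apply: rpred_int].
have om_inj w w' : w ^+ q = 1 -> w' ^+ q = 1 -> om w = om w' -> w = w'.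
  move=> w1 w1' omE; apply: (cheb_root_inj q_odd nz_delta nz_y yB) => //.
  have nzhL : h%:~R != 0 :> L by rewrite intr_ext_eq0.
  have /invr_inj /(mulIf _) := mulfI nzhL omE.
  by rewrite invr_eq0 => /(_ nzRL) /(addIr _).
(* If all reversed roots were in P, so would be their sum, which is minus the coefficient of g
   excluded by [pg]. *)
have [w w1 nPw] : exists2 w, w ^+ q = 1 & ~ P (om w).
  apply: contrapT => no; have Pom w : w ^+ q = 1 -> P (om w).
    by move=> w1; apply: contrapT => nP; apply: no; exists w.
  have mong : map_poly (intr : int -> L) g \is monic by rewrite monic_map ?scaled_rev_monic.
  have gE : map_poly intr g = \prod_(x <- map om (unity_root_seq q zeta)) ('X - x%:P).
    rewrite (@all_roots_prod_XsubC _ (map_poly intr g) (map om (unity_root_seq q zeta))).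
    - by rewrite (monicP mong) scale1r.
    - rewrite !size_map size_iota size_map_poly_id0; last first.
        by rewrite (monicP (scaled_rev_monic _ _ _)) rmorph1 oner_eq0.
      by rewrite size_polyDl size_polyXn // ltnS size_poly.
    - by apply/allP=> _ /mapP[w + ->]; rewrite (mem_unity_root_seq prim) => /eqP /om_root.
    rewrite uniq_rootsE map_inj_in_uniq ?uniq_unity_root_seq // => w w'.
    by rewrite !(mem_unity_root_seq prim) => /eqP w1 /eqP w1'; apply: om_inj.
  have sz : size (map om (unity_root_seq q zeta)) = q by rewrite !size_map size_iota.
  have := coefPn_prod_XsubC (ps := map om (unity_root_seq q zeta)).
  rewrite -gE sz coef_map /= => /(_ _)/eqP; rewrite -lt0n ltnW // => /(_ isT) /eqP sumE.
  apply: (pideal_ndvdz prP p_pr Pp pg); rewrite sumE; apply: (pidealN prP).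
  rewrite big_map big_seq; apply: (big_ind P) => [||x]; [exact: pideal0 prP | exact: (pidealD prP) |].
  by rewrite (mem_unity_root_seq prim) => /eqP; apply: Pom.
exists (om w) => [|s sA]; first exact: O_om.
have wv1 := unity_rootM w1 v1.
have -> : s (om w) = om (w * v).
  by rewrite /om !fmorph_div rmorphB !rmorph_int /= sA.
move=> Pd; apply: (simple _ (O_om _ w1) (om_root _ w1) nPw).
apply: (congruent_roots_deriv prP (O_om _ w1) (O_om _ wv1)) Pd; try exact: om_root.
apply: contra_neq nv1 => /(om_inj _ _ w1 wv1) wE.
by apply: (mulfI (unity_root_neq0 q_odd w1)); rewrite -wE mulr1.
Qed.

End PrimeIdeal.

Lemma twist_splitK_unramified : disc_form p (cheb q - j%:P) -> 4 < j ^+ 2 ->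
  unramified Fj K.
Proof.
move=> disc j2; split=> [P prP nzP|sigma real x Kx]; last first.
  have th := real _ (twist_theta_field q_gt1 prim delta2).
  have zs1 : sigma zeta ^+ q = 1 by rewrite -rmorphXn (prim_expr_order prim) rmorph1.
  have nzz : sigma zeta != 0 by rewrite fmorph_eq0 (unity_root_neq0 q_odd (prim_expr_order prim)).
  have zc : (sigma zeta)^* = (sigma zeta)^-1.
    have : `|sigma zeta| ^+ q = 1 by rewrite -normrX zs1 normr1.
    move/eqP; rewrite pexpr_eq1 ?normr_ge0 ?(ltnW q_gt1) // => /eqP nz1.
    by rewrite [RHS]invC_norm nz1 expr1n invr1 mul1r.
  have d_real : sigma delta \is Num.real.
    have d2E : sigma delta ^+ 2 = (j ^+ 2 - 4)%:~R.
      rewrite -rmorphXn (_ : delta ^+ 2 = (j ^+ 2 - 4)%:~R) ?rmorph_int //.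
      by rewrite -yB rmorphB rmorphXn /= -yD; field; rewrite expf_neq0.
    have d2_ge0 : 0 <= sigma delta ^+ 2 by rewrite d2E ler0z subr_ge0 ltW.
    have : sigma delta ^+ 2 == sqrtC (sigma delta ^+ 2) ^+ 2 by rewrite sqrtCK.
    have sq_real : sqrtC (sigma delta ^+ 2) \is Num.real by rewrite ger0_real ?sqrtC_ge0.
    by rewrite eqf_sqr => /orP[] /eqP->; rewrite ?rpredN.
  have /eqP : sigma ((zeta - zeta^-1) * delta) = - sigma ((zeta - zeta^-1) * delta).
    rewrite -{1}(CrealP th) rmorphM rmorphB fmorphV rmorphM rmorphB fmorphV /= zc invrK.
    by rewrite (CrealP d_real) -mulNr opprB.
  rewrite -addr_eq0 -mulr2n -mulr_natl mulf_eq0 pnatr_eq0 /= fmorph_eq0 mulf_eq0.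
  rewrite (negPf nz_delta) orbF subr_eq0 => /eqP zz.
  have nzzeta := unity_root_neq0 q_odd (prim_expr_order prim).
  (* A real image of [twist_theta] would vanish, making zeta its own inverse, against q odd and q >
     1. *)
  have : zeta ^+ 2 == 1 by rewrite expr2 {2}zz divff.
  rewrite -(prim_order_dvd prim) => q2; have := @dvdn_leq q 2 isT q2.
  by move: q_odd q_gt1; case: (q) => [|[|[|n]]].
apply: trivial_inertia_ramification_index => //; first exact: galois_twist_splitK.
move=> s sG ns1; have [v v1 sA] := gal_cheb_root sG.
have nv1 : v != 1.
  by apply: contra_neq ns1 => vE; apply: cheb_root_aut_eq1 => w w1; rewrite sA // vE mulr1.
have [Pp|nPp] := EM (P p%:R).
  by have [b Ob bP] := inertia_at_p prP Pp disc v1 nv1; exists b => //; apply: bP.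
have [b Ob [w w1 [bE nP]]] := inertia_away_from_p prP nPp v1 nv1.
by exists b => //; rewrite bE sA.
Qed.

End ChebyshevSplittingField.

Unset Implicit Arguments.

Theorem theorem2 (p k : nat) (p_pr : prime p) (p_odd : odd p) (k_gt0 : (0 < k)%N) :
  exists T : rat -> Prop,
    thin T
    /\ forall (j : int) (L : splittingFieldType rat) (zeta delta : L),
      (p ^ k).-primitive_root zeta ->
      delta ^+ 2 = j%:~R ^+ 2 - 4%:R ->
      let Fj := twist_field (p ^ k) zeta delta in
      (~ T j%:~R ->
         cyclic_extension 1%AS Fj /\ \dim Fj = totient (p ^ k))
      /\ (cyclic_extension 1%AS Fj -> \dim Fj = totient (p ^ k) ->
          ~ (exists n : int, j = (cheb p).[n]) ->
          (exists2 m : padic_int p_pr,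
             root (map_poly intr (cheb p - 'X)) m
             & let m_is_pm2 := padic_eqmod 1 m 2%:R \/ padic_eqmod 1 m (- 2%:R) in
               (m_is_pm2 -> padic_eqmod (2 * k + 1) j%:~R m)
               /\ (~ m_is_pm2 -> padic_eqmod (k + 1) j%:~R m)) ->
          forall K : {subfield L},
            splittingFieldFor 1 (map_poly intr (cheb (p ^ k) - j%:P)) K ->
            (forall alpha : L, root (map_poly intr (cheb (p ^ k) - j%:P)) alpha ->
               splittingFieldFor 1 (minPoly 1 alpha) K)
            /\ [/\ (Fj <= K)%VS, cyclic_extension Fj K & unramified Fj K]).
Proof.
have [T [thinT TP]] := twist_thin_set p_pr p_odd k_gt0.
exists T; split=> // j L zeta delta prim d2 Fj; split=> [nT|_ _ notC near K splitK].
  exact: TP prim d2 nT.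
have [Cj Cj2] := near_fixed_point_dvdz near.
have j2 := sqr_gt4_of_cheb p_pr p_odd k_gt0 notC Cj Cj2.
have disc := disc_form_cheb p_pr p_odd k_gt0 Cj Cj2.
split=> [alpha ra|].
  by rewrite (minPoly_cheb_root p_pr p_odd k_gt0 prim d2 j2 notC ra).
have nzd := delta_neq0 d2 j2.
have q_odd : odd (p ^ k) by rewrite oddX p_odd orbT.
have [alpha ra] : exists alpha : L, root (map_poly intr (cheb (p ^ k) - j%:P)) alpha.
  have [rs fE _] := splitK; case: rs fE => [|alpha rs] fE.
    have := eqp_size fE; rewrite big_nil size_poly1 size_map_poly_id0.
      by rewrite size_cheb_sub // => -[]; case: (p ^ k)%N q_odd.
    by rewrite (monicP (cheb_sub_monic _ q_odd)) rmorph1 oner_eq0.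
  by exists alpha; rewrite (eqp_root fE) root_prod_XsubC mem_head.
have [y [nzy _ yD yB]] := cheb_root_param nzd d2 ra.
have d21 := delta2_1 d2; split.
- exact: (twist_field_sub p_pr p_odd k_gt0 prim nzd d21 nzy yD yB splitK).
- exact: (cyclic_twist_splitK p_pr p_odd k_gt0 prim nzd d21 nzy yD yB splitK).
exact: (twist_splitK_unramified p_pr p_odd k_gt0 prim nzd d21 nzy yD yB splitK disc j2).
Qed.
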